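(* Let $1\le p<\infty$. For every $u_0\in L^p(\Gamma_r)$ there exists a unique solution $u\in \mathcal C([0,\infty);L^p(\Gamma_r))$ of the problem $$(P^* )\quad\begin{cases} 0=\int_{\Omega_r\cup\Gamma_r}J(x-y)\,[u(y,t)-u(x,t)]\,dy, & x\in\Omega_r,\ t>0,\\ \frac{\partial u}{\partial t}(x,t)=\int_{\Omega_r\cup\Gamma_r}J(x-y)\,[u(y,t)-u(x,t)]\,dy, & x\in\Gamma_r,\ t>0,\\ u(x,0)=u_0(x), & x\in\Gamma_r. \end{cases}$$ Moreover, $u$ preserves the total mass of the initial condition, that is, $\int_{\Gamma_r}u(x,t)\,dx=\int_{\Gamma_r}u_0(x)\,dx$ for every $t>0$, and for every $u_0\in L^p(\Gamma_r)$ there exist two positive constants $C=C(u_0)$ and $C'=C'(\Gamma_r,p,\Omega_r)$ such that, for all $t>0$, $$\int_{\Gamma_r}\Big|u(x,t)-\frac{1}{|\Gamma_r|}\int_{\Gamma_r}u_0\Big|^p\,dx\le C e^{-C't}.$$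
   Context: Setting: $\widehat\Omega\subset\mathbb R^n$ is a fixed bounded smooth domain. $J:\mathbb R^n\to\mathbb R$ is a fixed kernel that is continuous, nonnegative, radially symmetric, decreasing (as a function of $|x|$), compactly supported with $\mathrm{supp}(J)=B_R(0)$ (the ball of radius $R$ centred at $0$), and $\int_{\mathbb R^n}J(w)\,dw=1$. For $0<r\le R$, $\Gamma_r=\{x\in\widehat\Omega:\mathrm{dist}(x,\partial\widehat\Omega)\le r\}$ is a narrow strip inside $\widehat\Omega$, and $\Omega_r=\widehat\Omega\setminus\Gamma_r$. Notion of solution: the unknown is $u(\cdot,t)$ on $\Gamma_r$; for each $t$ it is extended to $\Omega_r$ as the (unique) function in $L^p(\Omega_r)$ for which the first equation holds for a.e. $x\in\Omega_r$ with $u(\cdot,t)$ prescribed on $\Gamma_r$. The second equation holds with $u$ differentiable in $t$, as an identity in $L^p(\Gamma_r)$ (equivalently, its time-integrated form with initial value $u_0$ holds). *)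

(* Defs.v *)
From HB Require Import structures.
From mathcomp Require Import all_boot all_order all_algebra.
From mathcomp Require Import all_classical all_reals all_analysis.

Set Implicit Arguments.
Unset Strict Implicit.
Unset Printing Implicit Defensive.

Import Order.TTheory GRing.Theory Num.Theory.
Import numFieldNormedType.Exports.

Local Open Scope classical_set_scope.
Local Open Scope ring_scope.

Fact rV_display : measure_display. Proof. exact: default_measure_display. Qed.

Definition rV_coord (R : realType) (n : nat) (i : 'I_n) (x : 'rV[R]_n) : R :=
  x ord0 i.

(* The sigma-algebra generated by the coordinates is the Borel sigma-algebra. *)
HB.instance Definition _ (R : realType) (n : nat) :=
  @isMeasurable.Build rV_display 'rV[R]_n
    (g_sigma_preimage (@rV_coord R n))
    (@sigma_algebra0 _ _ _)
    (@sigma_algebraC _ _)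
    (@sigma_algebra_bigcup _ _ _).

(* Lebesgue measure on R^n as an iterated integral; lebesgue_rV_box below gives
   its value on boxes, which characterizes it. *)
Fixpoint lebesgue_rV (R : realType) (n : nat) :
    set 'rV[R]_n -> \bar R :=
  match n with
  | 0%N => fun A => \d_ (0 : 'rV[R]_0) A
  | m.+1 => fun A => (\int[lebesgue_measure]_t
       lebesgue_rV [set y : 'rV[R]_m | A (row_mx (t%:M : 'rV[R]_1) y)])%E
  end.

Lemma measurable_rV_coord (R : realType) (n : nat) (i : 'I_n) :
  measurable_fun [set: 'rV[R]_n] (@rV_coord R n i).
Proof.
move=> _ Y mY; rewrite setTI; apply: sub_sigma_algebra => /=.
rewrite -bigcup_seq/=; exists i => /=; first by rewrite mem_index_enum.
by exists Y => //; rewrite setTI.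
Qed.

Lemma measurable_fun_rVP d (T : measurableType d) (R : realType) (n : nat)
    (f : T -> 'rV[R]_n) :
  measurable_fun [set: T] f <->
  forall i, measurable_fun [set: T] (@rV_coord R n i \o f).
Proof.
split=> [mf i|mf]; first exact: measurableT_comp (measurable_rV_coord i) mf.
have : g_sigma_preimage (fun i => @rV_coord R n i \o f) `<=` measurable.
  apply: smallest_sub; first exact: sigma_algebra_measurable.
  case: n => [|n] in f mf *; first by rewrite big_ord0.
  rewrite -bigcup_mkord_ord; apply: bigcup_sub => i Ii.
  by move=> A [B mB <-]; exact: mf.
case: n => [|n] in f mf *; last first.
  rewrite g_sigma_preimage_comp => prefS.
  by move=> _ A mA; apply: prefS; exists A.
move=> _ _ A mA; rewrite setTI.
suff : A = set0 \/ A = setT.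
  by case=> ->; rewrite ?preimage_set0 ?preimage_setT.
have [A0|/set0P[a Aa]] := eqVneq A set0; [by left|right].
by apply/seteqP; split=> // x _; rewrite (_ : x = a)//; apply/rowP => -[].
Qed.

Definition rV_cons (R : realType) (m : nat) (z : R * 'rV[R]_m) :
    'rV[R]_(1 + m) :=
  row_mx (z.1%:M : 'rV[R]_1) z.2.

Lemma rV_cons_lshift (R : realType) (m : nat) (z : R * 'rV[R]_m) (j : 'I_1) :
  rV_cons z ord0 (lshift m j) = z.1.
Proof. by rewrite row_mxEl (ord1 j) mxE. Qed.

Lemma rV_cons_rshift (R : realType) (m : nat) (z : R * 'rV[R]_m) (j : 'I_m) :
  rV_cons z ord0 (rshift 1 j) = z.2 ord0 j.
Proof. by rewrite row_mxEr. Qed.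

Lemma measurable_rV_cons (R : realType) (m : nat) :
  measurable_fun setT (@rV_cons R m).
Proof.
apply/measurable_fun_rVP => i.
case: (@split_ordP 1 m i) => j ->.
  rewrite (_ : _ \o _ = fst); first exact: measurable_fst.
  by apply/funext => z; exact: rV_cons_lshift.
rewrite (_ : _ \o _ = @rV_coord R m j \o snd).
  by apply: measurableT_comp => //; exact: measurable_rV_coord.
by apply/funext => z; exact: rV_cons_rshift.
Qed.

Definition rV_uncons (R : realType) (m : nat) (x : 'rV[R]_(1 + m)) :
    R * 'rV[R]_m :=
  (x ord0 (lshift m ord0), \row_j x ord0 (rshift 1 j)).

Lemma rV_consK (R : realType) (m : nat) : cancel (@rV_cons R m) (@rV_uncons R m).
Proof.
move=> [t y]; rewrite /rV_uncons rV_cons_lshift /=; congr (_, _).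
by apply/rowP => j; rewrite mxE rV_cons_rshift.
Qed.

Lemma rV_unconsK (R : realType) (m : nat) : cancel (@rV_uncons R m) (@rV_cons R m).
Proof.
move=> x; apply/rowP => i.
case: (@split_ordP 1 m i) => j ->; first by rewrite rV_cons_lshift (ord1 j).
by rewrite rV_cons_rshift mxE.
Qed.

Lemma measurable_rV_uncons (R : realType) (m : nat) :
  measurable_fun setT (@rV_uncons R m).
Proof.
apply/measurable_fun_pairP; split; first exact: measurable_rV_coord.
apply/measurable_fun_rVP => i.
rewrite (_ : _ \o _ = @rV_coord R (1 + m) (rshift 1 i)).
  exact: measurable_rV_coord.
by apply/funext => x /=; rewrite /rV_coord mxE.
Qed.

Lemma product_measure1_sigma_finite d1 d2 (T1 : measurableType d1)
    (T2 : measurableType d2) (R : realType)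
    (m1 : {sigma_finite_measure set T1 -> \bar R})
    (m2 : {sigma_finite_measure set T2 -> \bar R}) :
  sigma_finite setT (m1 \x m2)%E.
Proof.
have /sigma_finiteP[F [TF ndF Foo]] := sigma_finiteT m1.
have /sigma_finiteP[G [TG ndG Goo]] := sigma_finiteT m2.
exists (fun k => F k `*` G k).
  rewrite -setXTT TF TG predeqE => -[x y]; split.
    move=> [/= [k _ Fkx] [l _ Gly]]; exists (maxn k l) => //; split.
    - by move: x Fkx; exact/subsetPset/ndF/leq_maxl.
    - by move: y Gly; exact/subsetPset/ndG/leq_maxr.
  by move=> [k _ []/= ? ?]; split; exists k.
move=> k; have [? ?] := Foo k; have [? ?] := Goo k.
split; first exact: measurableX.
by rewrite product_measure1E// lte_mul_pinfty// ge0_fin_numE.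
Qed.

Lemma rV_pushforward_sigma_finite (R : realType) (m : nat)
    (mu : set (measurableTypeR R * 'rV[R]_m) -> \bar R) :
  sigma_finite setT mu -> sigma_finite setT (pushforward mu (@rV_cons R m)).
Proof.
move=> [F FT Foo].
exists (fun k => @rV_uncons R m @^-1` F k) => [|k].
  by rewrite -preimage_bigcup -FT preimage_setT.
have [mF Fk] := Foo k; split.
  by rewrite -[X in measurable X]setTI; exact: measurable_rV_uncons.
rewrite /pushforward -comp_preimage (_ : _ \o _ = id) ?preimage_id//.
by apply/funext => z; exact: rV_consK.
Qed.

Lemma lebesgue_rV_measure_ex (R : realType) (n : nat) :
  exists mu : {sigma_finite_measure set 'rV[R]_n -> \bar R},
    lebesgue_rV (n := n) = mu :> (set 'rV[R]_n -> \bar R).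
Proof.
elim: n => [|m [mu IH]]; first by exists (\d_ (0 : 'rV[R]_0)).
pose lam : {sigma_finite_measure set (measurableTypeR R) -> \bar R} :=
  lebesgue_measure.
pose pr : {measure set (measurableTypeR R * 'rV[R]_m)%type -> \bar R} :=
  (lam \x mu)%E.
pose f : set 'rV[R]_m.+1 -> \bar R := pushforward pr (@rV_cons R m).
have f0 : f set0 = 0%E by rewrite /f /pushforward preimage_set0 measure0.
have f_ge0 A : (0 <= f A)%E by exact: (@measure_ge0 _ _ _ pr).
have f_add : semi_sigma_additive f.
  exact: (@measure_semi_sigma_additive _ _ _
    (measure_function_pushforward__canonical__measure_function_Measure
       pr (@measurable_rV_cons R m))).
have f_fin : sigma_finite setT f.
  exact/rV_pushforward_sigma_finite/product_measure1_sigma_finite.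
pose fM := isMeasure.Build _ _ _ f f0 f_ge0 f_add.
pose f' : {measure set 'rV[R]_m.+1 -> \bar R} := HB.pack f fM.
pose fS := Measure_isSigmaFinite.Build _ _ _ f' f_fin.
pose nu : {sigma_finite_measure set 'rV[R]_m.+1 -> \bar R} :=
  HB.pack (Measure.sort f') fS.
exists nu; apply/funext => A /=.
rewrite /f /pushforward/= /product_measure1/=.
apply: eq_integral => t _; rewrite IH/=; congr (mu _).
by apply/seteqP; split=> y; rewrite /xsection/= inE.
Qed.

Lemma lebesgue_rV0 (R : realType) (n : nat) : lebesgue_rV (set0 : set 'rV[R]_n) = 0.
Proof. by have [mu ->] := lebesgue_rV_measure_ex R n; exact: measure0. Qed.

Lemma lebesgue_rV_ge0 (R : realType) (n : nat) (A : set 'rV[R]_n) :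
  (0 <= lebesgue_rV A)%E.
Proof. by have [mu ->] := lebesgue_rV_measure_ex R n; exact: measure_ge0. Qed.

Lemma lebesgue_rV_sigma_additive (R : realType) (n : nat) :
  semi_sigma_additive (@lebesgue_rV R n).
Proof.
have [mu ->] := lebesgue_rV_measure_ex R n.
exact: measure_semi_sigma_additive.
Qed.

HB.instance Definition _ (R : realType) (n : nat) :=
  isMeasure.Build _ _ _ (@lebesgue_rV R n) (@lebesgue_rV0 R n)
    (@lebesgue_rV_ge0 R n) (@lebesgue_rV_sigma_additive R n).

Lemma lebesgue_rV_sigma_finite (R : realType) (n : nat) :
  sigma_finite setT (@lebesgue_rV R n).
Proof.
have [mu ->] := lebesgue_rV_measure_ex R n; exact: sigma_finiteT.
Qed.

HB.instance Definition _ (R : realType) (n : nat) :=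
  Measure_isSigmaFinite.Build _ _ _ (@lebesgue_rV R n)
    (@lebesgue_rV_sigma_finite R n).

Lemma measurable_rV_box (R : realType) (n : nat) (B : 'I_n -> set R) :
  (forall i, measurable (B i)) ->
  measurable [set x : 'rV[R]_n | forall i, B i (x ord0 i)].
Proof.
move=> mB.
rewrite (_ : mkset _ =
    \bigcap_(i in [set: 'I_n]) (@rV_coord R n i @^-1` B i)).
  apply: fin_bigcap_measurable => // i _.
  by rewrite -[X in measurable X]setTI; exact: measurable_rV_coord.
by apply/seteqP; split=> [x Bx i _|x Bx i]; [exact: Bx|exact: (Bx i)].
Qed.

Lemma lebesgue_rV_box (R : realType) (n : nat) (B : 'I_n -> set R) :
  (forall i, measurable (B i)) ->
  lebesgue_rV [set x : 'rV[R]_n | forall i, B i (x ord0 i)] =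
  (\prod_(i < n) lebesgue_measure (B i))%E.
Proof.
elim: n B => [|m IH] B mB.
  by rewrite big_ord0 /= diracE mem_set// => -[].
rewrite big_ord_recl -IH//.
have e0 : lshift m (@ord0 0) = ord0 :> 'I_m.+1 by exact/val_inj.
have e1 j : rshift 1 j = lift ord0 j :> 'I_m.+1 by exact/val_inj.
have := product_measure1E (@lebesgue_measure R) (@lebesgue_rV R m) (mB ord0)
  (measurable_rV_box (fun i => mB (lift ord0 i))).
move=> <-; rewrite /= /product_measure1; apply: eq_integral => t _ /=.
congr lebesgue_rV; apply/seteqP; split=> y; rewrite /xsection/= ?inE/=.
  move=> By; split.
    have : B (lshift m (@ord0 0)) (rV_cons (t, y) ord0 (lshift m (@ord0 0))).
      exact: By.
    by rewrite rV_cons_lshift e0.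
  move=> i.
  have : B (rshift 1 i) (rV_cons (t, y) ord0 (rshift 1 i)) by exact: By.
  by rewrite rV_cons_rshift e1.
move=> [Bt By] i.
change (B i (rV_cons (t, y) ord0 i)); case: (@split_ordP 1 m i) => j ->.
  by rewrite rV_cons_lshift (ord1 j) e0.
by rewrite rV_cons_rshift e1.
Qed.

(* The library norm on 'rV[R]_n is the sup norm; it induces the same topology
   and the same bounded sets. *)
Definition enorm (R : realType) (n : nat) (x : 'rV[R]_n) : R :=
  Num.sqrt (\sum_(i < n) x ord0 i ^+ 2).

Definition boundary (T : topologicalType) (A : set T) : set T :=
  closure A `\` interior A.

Definition euclid_dist (R : realType) (n : nat) (x : 'rV[R]_n) (A : set 'rV[R]_n) : R :=
  inf [set enorm (x - y) | y in A].

Fixpoint Ck (R : realType) (m k : nat) (f : 'rV[R]_m -> R) : Prop :=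
  match k with
  | 0%N => continuous f
  | k'.+1 => (forall x, differentiable f x) /\
             (forall v : 'rV[R]_m, Ck k' ('D_v f))
  end.

Definition smooth (R : realType) (m : nat) (f : 'rV[R]_m -> R) : Prop :=
  forall k, Ck k f.

(* Near each of its boundary points, Omega is, up to relabelling and reorienting
   the coordinate axes, the region above the graph of a smooth function of the
   other n - 1 coordinates. *)
Definition smooth_boundary (R : realType) (n : nat) (Omega : set 'rV[R]_n) :
    Prop :=
  forall x0, boundary Omega x0 ->
    exists (i : 'I_n) (s : bool) (g : 'rV[R]_n.-1 -> R), smooth g /\
      \forall x \near x0, Omega x <-> g (col' i x) < (-1) ^+ s * x ord0 i.

Definition bounded_smooth_domain (R : realType) (n : nat)
    (Omega : set 'rV[R]_n) : Prop :=
  [/\ Omega !=set0, open Omega, connected Omega, bounded_set Omega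
    & smooth_boundary Omega].

Record nonlocal_kernel (R : realType) (n : nat) (rho : R) (J : 'rV[R]_n -> R) :
    Prop := NonlocalKernel {
  kernel_continuous : continuous J;
  kernel_ge0 : forall x, 0 <= J x;
  kernel_radial : forall x y, enorm x = enorm y -> J x = J y;
  kernel_decreasing : forall x y, enorm x <= enorm y -> J y <= J x;
  kernel_support : closure [set x | J x != 0] = [set x | enorm x <= rho];
  kernel_mass : (\int[@lebesgue_rV R n]_x (J x)%:E = 1)%E
}.

(* Gamma_r; its complement Omega_r in Omega is inner_region. *)
Definition strip (R : realType) (n : nat) (Omega : set 'rV[R]_n) (r : R) :
    set 'rV[R]_n :=
  [set x | Omega x /\ euclid_dist x (boundary Omega) <= r].

Definition inner_region (R : realType) (n : nat) (Omega : set 'rV[R]_n) (r : R) :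
    set 'rV[R]_n :=
  Omega `\` strip Omega r.

(* L^p(D) for functions on R^n of which only the values on D matter: f \_ D is
   f on D and 0 elsewhere. *)
Definition Lp_on (R : realType) (n : nat) (D : set 'rV[R]_n) (p : R)
    (f : 'rV[R]_n -> R) : Prop :=
  f \_ D \in Lfun (@lebesgue_rV R n) p%:E.

Definition Lp_norm_on (R : realType) (n : nat) (D : set 'rV[R]_n) (p : R)
    (f : 'rV[R]_n -> R) : \bar R :=
  'N[@lebesgue_rV R n]_p%:E[EFin \o (f \_ D)].

Definition nonlocal (R : realType) (n : nat) (J : 'rV[R]_n -> R)
    (D : set 'rV[R]_n) (v : 'rV[R]_n -> R) (x : 'rV[R]_n) : R :=
  \int[@lebesgue_rV R n]_(y in D) (J (x - y) * (v y - v x)).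

(* v extends w from Gamma_r to Omega_r by the first equation. *)
Definition is_extension (R : realType) (n : nat) (Omega : set 'rV[R]_n)
    (J : 'rV[R]_n -> R) (r p : R) (w v : 'rV[R]_n -> R) : Prop :=
  [/\ forall x, strip Omega r x -> v x = w x,
      Lp_on (inner_region Omega r) p v
    & {ae @lebesgue_rV R n, forall x, inner_region Omega r x ->
        0 = nonlocal J (inner_region Omega r `|` strip Omega r) v x}].

Definition is_the_extension (R : realType) (n : nat) (Omega : set 'rV[R]_n)
    (J : 'rV[R]_n -> R) (r p : R) (w v : 'rV[R]_n -> R) : Prop :=
  is_extension Omega J r p w v /\
  forall v', is_extension Omega J r p w v' ->
    ae_eq (@lebesgue_rV R n) (inner_region Omega r) v' v.

Definition Lp_continuous (R : realType) (n : nat) (D : set 'rV[R]_n) (p : R)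
    (u : R -> 'rV[R]_n -> R) : Prop :=
  (forall t, 0 <= t -> Lp_on D p (u t)) /\
  (forall t, 0 <= t ->
     Lp_norm_on D p (u s \- u t)
       @[s --> within [set s | 0 <= s] (nbhs t)] --> 0%E).

Definition Lp_derivative (R : realType) (n : nat) (D : set 'rV[R]_n) (p : R)
    (u : R -> 'rV[R]_n -> R) (t : R) (w : 'rV[R]_n -> R) : Prop :=
  Lp_norm_on D p (fun x => h^-1 * (u (t + h) x - u t x) - w x)
    @[h --> 0^'] --> 0%E.

Definition is_solution (R : realType) (n : nat) (Omega : set 'rV[R]_n)
    (J : 'rV[R]_n -> R) (r p : R) (u0 : 'rV[R]_n -> R)
    (u : R -> 'rV[R]_n -> R) : Prop :=
  [/\ Lp_continuous (strip Omega r) p u,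
      forall t, 0 < t -> exists2 v, is_the_extension Omega J r p (u t) v &
        Lp_derivative (strip Omega r) p u t
          (nonlocal J (inner_region Omega r `|` strip Omega r) v)
    & ae_eq (@lebesgue_rV R n) (strip Omega r) (u 0) u0].

Definition mean_on (R : realType) (n : nat) (D : set 'rV[R]_n)
    (f : 'rV[R]_n -> R) : R :=
  (fine (@lebesgue_rV R n D))^-1 * \int[@lebesgue_rV R n]_(x in D) f x.

(* Main.v *)
Require Import Defs.
From mathcomp Require Import all_boot all_order all_algebra.
From mathcomp Require Import all_classical all_reals all_analysis.
From mathcomp Require Import measurable_realfun.
From mathcomp Require Import ring lra.

Set Implicit Arguments.
Unset Strict Implicit.
Unset Printing Implicit Defensive.

Import Order.TTheory GRing.Theory Num.Theory.
Import numFieldNormedType.Exports.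

Local Open Scope classical_set_scope.
Local Open Scope ring_scope.

(** The first equation is a Dirichlet problem with datum on the strip, so the
    system is an evolution on the strip alone, driven by a random walk watched
    only while it is there.

    For a small c > 0 let S g x = g x + c * (integral over Omega of
    J (x - y) * (g y - g x) in y). Since J is bounded, nonnegative and
    symmetric, S is an averaging operator: it is linear and positive, fixes
    constants and preserves the integral over Omega ([lazy_step_averaging]).
    The first equation says that u is S-harmonic off the strip. As J is bounded
    below by a positive constant near 0 and Omega is connected, the walk can be
    led from anywhere to anywhere along finitely many overlapping small cubes,
    which gives a Doeblin bound: S^m g >= de * (integral of g), for g >= 0, at
    every point ([lazy_step_minorized], [finite_cube_cover_chain]). In
    particular the probability of not having met the strip after k steps decays
    geometrically, so that each integrable f on the strip has an S-harmonic
    extension E f, a sum over the hitting time ([harmonic_extension_spec]), and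
    the extension is unique ([subharmonic_le0], [harmonic_ae_eq0]).

    With P f = S (E f) on the strip and ka = 1 / c, the second equation reads
    du/dt = ka * (P u - u). The operator P is again averaging
    ([trace_step_averaging]) and inherits a Doeblin bound
    ([trace_step_minorized]). The solution is the average of the iterates
    P^k u0 for the Poisson law of parameter ka * t ([semigroup]); it is
    differentiable in L^p by Taylor estimates for the Poisson averages
    ([semigroup_evolution]), and its mass is constant because P preserves
    mass ([semigroup_mass]). It is unique because averaging operators contract
    L^p, by Jensen's inequality, and hence the L^p distance of two solutions
    cannot increase ([evolution_contraction]).

    For the decay, the Doeblin bound lets P^m be written as th * Q plus a
    multiple of the integral, with Q averaging and th < 1. On functions of mean
    zero only th * Q remains, and P^k decays like la^k in L^p
    ([averaging_iter_decay]). The Poisson law turns the factors la^k into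
    exp (- (1 - la) * ka * t) ([semigroup_decay]). *)

(** * Real inequalities and series *)

Section real_inequalities.
Context {R : realType}.
Implicit Types (a s p : R).

(** Convexity of the p-th power of the absolute value, through a supporting line
    of slope p * |a|^(p - 1) * sg a. For p > 1 the inequality is Young's
    inequality for |a|^(p - 1) and |s|. Averaging this line gives the forms of
    Jensen's inequality used below. *)
Lemma powR_norm_tangent p a : 1 <= p ->
  exists l, forall s, `|a| `^ p + l * (s - a) <= `|s| `^ p.
Proof.
rewrite le_eqVlt => /predU1P[<-|p1].
  exists (Num.sg a) => s; rewrite !powRr1// mulrBr -normrEsg addrC subrK.
  rewrite (le_trans (ler_norm _))// normrM normr_sg.
  by case: (a != 0); rewrite ?mul1r ?mul0r.
have p0 : 0 < p by rewrite (lt_trans ltr01).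
have p10 : 0 < p - 1 by rewrite subr_gt0.
exists (p * `|a| `^ (p - 1) * Num.sg a) => s.
have aE : `|a| `^ (p - 1) * Num.sg a * a = `|a| `^ p.
  rewrite -mulrA -normrEsg.
  have [->|a0] := eqVneq a 0; first by rewrite normr0 mulr0 powR0// gt_eqF.
  rewrite -{2}[`|a|]powRr1// -powRD ?subrK//.
  by rewrite normr_eq0 a0 implybT.
have young : `|a| `^ (p - 1) * `|s| <= `|a| `^ p / (p / (p - 1)) + `|s| `^ p / p.
  have -> : `|a| `^ p = (`|a| `^ (p - 1)) `^ (p / (p - 1)).
    by rewrite -powRrM mulrC divfK ?gt_eqF.
  apply: conjugate_powR; rewrite ?powR_ge0 ?divr_gt0//.
  by field; rewrite !gt_eqF.
have sgs : `|a| `^ (p - 1) * (Num.sg a * s) <= `|a| `^ (p - 1) * `|s|.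
  apply: ler_wpM2l; first exact: powR_ge0.
  rewrite (le_trans (ler_norm _))// normrM normr_sg.
  by case: (a != 0); rewrite ?mul1r ?mul0r.
have := ler_wpM2l (ltW p0) (le_trans sgs young).
have -> : p * (`|a| `^ p / (p / (p - 1)) + `|s| `^ p / p) =
    (p - 1) * `|a| `^ p + `|s| `^ p by field; rewrite !gt_eqF.
rewrite -aE; lra.
Qed.

(** Jensen's inequality for weights of total mass at most one. The missing mass
    is harmless because it may be placed at 0, where the power vanishes. *)
Lemma powR_norm_sum_le p (w x : nat -> R) n : 1 <= p ->
  (forall k, 0 <= w k) -> \sum_(0 <= k < n) w k <= 1 ->
  `|\sum_(0 <= k < n) w k * x k| `^ p <= \sum_(0 <= k < n) w k * `|x k| `^ p.
Proof.
move=> p1 w0 w1; pose a := \sum_(0 <= k < n) w k * x k; rewrite -/a.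
have p0 : 0 < p by rewrite (lt_le_trans ltr01).
have [l tan] := powR_norm_tangent a p1.
(* the supporting line at a lies below the power at 0, where the power is 0 *)
have at0 : `|a| `^ p - l * a <= 0.
  have := tan 0; rewrite normr0 powR0 ?gt_eqF// sub0r mulrN; lra.
apply: le_trans (_ : \sum_(0 <= k < n) w k * (`|a| `^ p + l * (x k - a)) <= _).
  have -> : \sum_(0 <= k < n) w k * (`|a| `^ p + l * (x k - a)) =
      (\sum_(0 <= k < n) w k) * (`|a| `^ p - l * a) + l * a.
    have aE : l * a = \sum_(0 <= k < n) l * (w k * x k) by rewrite mulr_sumr.
    rewrite mulr_suml [X in _ = _ + X]aE -big_split/=.
    by apply: eq_bigr => k _; ring.
  have : 0 <= (1 - \sum_(0 <= k < n) w k) * (l * a - `|a| `^ p).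
    by apply: mulr_ge0; [rewrite subr_ge0|lra].
  lra.
by apply: ler_sum => k _; rewrite ler_wpM2l.
Qed.

(** By Bernoulli's inequality la = 1 - (1 - th) / m satisfies th <= la^m; the
    prefactor th^-1 pays for the incomplete last block of fewer than m steps. *)
Lemma geometric_decay m (th : R) : (0 < m)%N -> 0 < th -> th < 1 ->
  exists2 la : R, 0 < la < 1 &
  forall a : nat -> R, (forall k, 0 <= a k) ->
    (forall k, a k.+1 <= a k) -> (forall k, a (k + m)%N <= th * a k) ->
    forall k, a k <= th^-1 * la ^+ k * a 0%N.
Proof.
move=> m0 th0 th1; have m0R : 0 < m%:R :> R by rewrite ltr0n.
have m1R : 1 <= m%:R :> R by rewrite ler1n.
pose la := 1 - (1 - th) / m%:R.
have q1 : (1 - th) / m%:R <= 1 - th by rewrite ler_pdivrMr//; nra.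
have q0 : 0 < (1 - th) / m%:R by rewrite divr_gt0// subr_gt0.
have la01 : 0 < la < 1 by rewrite /la; lra.
have [la0 la1] := andP la01.
have bern : th <= la ^+ m.
  have bern k : 1 - ((1 - th) / m%:R) * k%:R <= la ^+ k.
    elim: k => [|k ih]; first by rewrite mulr0 subr0.
    rewrite exprS -natr1; apply: le_trans (ler_wpM2l (ltW la0) ih).
    have k0 : 0 <= k%:R :> R by [].
    rewrite /la; set q := _ / _ in q0 *; nra.
  by have := bern m; rewrite divfK ?gt_eqF//; lra.
exists la => // a a0 am ath k.
have a_le j : a j <= a 0%N.
  by elim: j => [//|j ih]; exact: le_trans ih.
elim/ltn_ind: k => k ih.
have [km|mk] := ltnP k m.
  apply: (le_trans (a_le k)); rewrite ler_peMl// mulrC ler_pdivlMr// mul1r.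
  apply: (le_trans bern); apply: ler_wiXn2l; rewrite ?ltW//; exact: ltnW.
rewrite -(subnK mk); apply: (le_trans (ath _)).
have km : (k - m < k)%N by rewrite ltn_subrL m0 (leq_trans m0 mk).
apply: le_trans (ler_wpM2l (ltW th0) (ih _ km)) _.
rewrite exprD -!mulrA mulrCA ler_wpM2l ?invr_ge0 ?(ltW th0)//.
rewrite [leLHS]mulrCA ler_wpM2l ?exprn_ge0 ?(ltW la0)//.
by rewrite ler_wpM2r.
Qed.

Lemma series_dominated_tail (w v : nat -> R) : (forall k, `|w k| <= v k) ->
  cvgn (series v) ->
  cvgn (series w) /\
  forall n, `|limn (series w) - series w n| <= limn (series v) - series v n.
Proof.
move=> wv cv.
have cw : cvgn (series w).
  apply: normed_cvg; apply: series_le_cvg cv => //= k.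
  exact: le_trans (wv k).
split=> // n.
have tail N : (n <= N)%N ->
    `|series w N - series w n| - (series v N - series v n) <= 0.
  move=> nN; rewrite !sub_series_geq// subr_le0.
  by apply: (le_trans (ler_norm_sum _ _ _)); apply: ler_sum => k _.
rewrite -subr_le0.
apply: (@cvgr_to_le _ \oo _ R
  (fun N => `|series w N - series w n| - (series v N - series v n))).
  apply: cvgB; first by apply: cvg_norm; apply: cvgB => //; exact: cvg_cst.
  by apply: cvgB => //; exact: cvg_cst.
by exists n => // N /= nN; exact: tail.
Qed.

Lemma series_geometric_tail (w : nat -> R) (K la : R) : 0 <= la < 1 ->
  (forall k, `|w k| <= K * la ^+ k) ->
  cvgn (series w) /\
  forall n, `|limn (series w) - series w n| <= K / (1 - la) * la ^+ n.
Proof.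
move=> /andP[la0 la1] wK.
have nla : `|la| < 1 by rewrite ger0_norm.
have cv : series (geometric K la) x @[x --> \oo] --> K / (1 - la).
  exact: cvg_geometric_series.
have [|cw tail] := @series_dominated_tail w (geometric K la) wK.
  by apply/cvg_ex; eexists; exact: cv.
split => // n; apply: (le_trans (tail n)); rewrite (cvg_lim _ cv)//.
rewrite geometric_seriesE ?lt_eqF//=.
by rewrite le_eqVlt; apply/orP; left; apply/eqP; ring.
Qed.

Lemma le0_geometric (x K la : R) : 0 <= la < 1 ->
  (forall n, x <= K * la ^+ n) -> x <= 0.
Proof.
move=> /andP[la0 la1] xK.
have nla : `|la| < 1 by rewrite ger0_norm.
have := cvg_geometric K nla.
move=> /cvgr_to_ge; apply; apply: nearW => n; exact: xK.
Qed.

End real_inequalities.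

(** * Integrable real functions on a set *)

Section integrable_real_functions.
Context d (T : measurableType d) (R : realType).
Variables (mu : {measure set T -> \bar R}) (D : set T).
Hypothesis mD : measurable D.
Implicit Types (f g : T -> R) (a : R).

Local Notation L1 f := (mu.-integrable D (EFin \o f)).

Lemma integrable_measurable_fun f : L1 f -> measurable_fun D f.
Proof. by move=> /measurable_int /measurable_EFinP. Qed.

Lemma integrable_eq_in f g : (forall x, D x -> f x = g x) -> L1 f -> L1 g.
Proof.
move=> fg; apply: eq_integrable => // x /[!inE] Dx /=.
by rewrite fg.
Qed.

Lemma integrable_lin a f g : L1 f -> L1 g -> L1 (fun x => a * f x + g x).
Proof.
move=> If Ig; have := integrableD mD (integrableZl mD a If) Ig.
exact: eq_integrable.
Qed.

Lemma integrable_dominated f g : measurable_fun D f ->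
  (forall x, D x -> `|f x| <= g x) -> L1 g -> L1 f.
Proof.
move=> mf fg; apply: le_integrable => //; first exact/measurable_EFinP.
move=> x Dx /=; rewrite lee_fin (le_trans (fg x Dx))//; exact: ler_norm.
Qed.

Lemma integrable_finite_cst a : (mu D < +oo)%E -> L1 (cst a).
Proof.
move=> Doo; apply: measurable_bounded_integrable => //.
exact: bounded_cst.
Qed.

Lemma Rintegral_lin a f g : L1 f -> L1 g ->
  \int[mu]_(x in D) (a * f x + g x) =
  a * \int[mu]_(x in D) f x + \int[mu]_(x in D) g x.
Proof.
move=> If Ig; rewrite RintegralD// ?RintegralZl//.
exact: (integrableZl mD a If).
Qed.

Lemma eq_Rintegral_in f g : (forall x, D x -> f x = g x) ->
  \int[mu]_(x in D) f x = \int[mu]_(x in D) g x.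
Proof. by move=> fg; apply: eq_Rintegral => x /[!inE]; exact: fg. Qed.

Lemma integrable_restrict_sub A f : measurable A -> A `<=` D ->
  mu.-integrable A (EFin \o f) -> L1 (f \_ A).
Proof.
move=> mA AD If.
have If' : mu.-integrable setT (EFin \o (f \_ A)).
  have := (integrable_mkcond _ mA).1 If.
  by apply: eq_integrable => // x _; rewrite restrict_EFin.
exact: integrableS If'.
Qed.

Lemma integrable_split A f : measurable A -> A `<=` D ->
  mu.-integrable A (EFin \o f) -> mu.-integrable (D `\` A) (EFin \o f) -> L1 f.
Proof.
move=> mA AD IA IDA.
have J1 : L1 (f \_ A) by exact: integrable_restrict_sub.
have J2 : L1 (f \_ (D `\` A)).
  by apply: integrable_restrict_sub IDA; [exact: measurableD|move=> x []].
apply: (integrable_eq_in _ (integrable_lin 1 J1 J2)) => x Dx.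
rewrite mul1r !patchE; have [Ax|nAx] := pselect (A x).
  by rewrite mem_set// memNset ?addr0// => -[].
by rewrite memNset// mem_set ?add0r.
Qed.

Lemma Rintegral_subset_le A f : measurable A -> A `<=` D -> L1 f ->
  (forall x, D x -> 0 <= f x) -> \int[mu]_(x in A) f x <= \int[mu]_(x in D) f x.
Proof.
move=> mA AD If f0; rewrite -[X in _ <= Rintegral _ X _](setDUK AD).
rewrite Rintegral_setU//; last 3 first.
- exact: measurableD.
- by rewrite setDUK.
- by apply/disj_setPS => x [Ax []].
by rewrite lerDl; apply: Rintegral_ge0 => x [Dx _]; exact: f0.
Qed.

Lemma eq_Rintegral_ae f g : measurable_fun D f -> measurable_fun D g ->
  {ae mu, forall x, D x -> f x = g x} ->
  \int[mu]_(x in D) f x = \int[mu]_(x in D) g x.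
Proof.
move=> mf mg fg; congr fine; apply: ae_eq_integral => //.
- exact/measurable_EFinP.
- exact/measurable_EFinP.
- by apply: filterS fg => x fgx Dx /=; rewrite fgx.
Qed.

Lemma Rintegral_eq0_ae f : L1 f -> (forall x, D x -> 0 <= f x) ->
  \int[mu]_(x in D) f x = 0 -> {ae mu, forall x, D x -> f x = 0}.
Proof.
move=> If f0 If0.
have [/(_ _) + _] := ae_eq_integral_abs mu mD (measurable_int mu If).
have -> : (\int[mu]_(x in D) `|(EFin \o f) x| = 0)%E.
  rewrite -[RHS]/((0 : R)%:E) -If0 /Rintegral fineK; last exact: integrable_fin_num If.
  by apply: eq_integral => x /[!inE] Dx; rewrite /= ger0_norm// f0.
by move=> /(_ erefl); apply: filterS => x /= fx Dx; have [] := fx Dx.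
Qed.

End integrable_real_functions.

(** * Averaging operators and their decay on functions of mean zero *)

Section averaging_operators.
Context d (T : measurableType d) (R : realType).
Variables (mu : {measure set T -> \bar R}) (G : set T).
Hypothesis mG : measurable G.
Hypothesis finG : (mu G < +oo)%E.
Implicit Types (f g : T -> R) (P : (T -> R) -> T -> R).

Local Notation L1 f := (mu.-integrable G (EFin \o f)).
Local Notation Int f := (\int[mu]_(x in G) f x).

(** Markov operators preserving the measure restricted to G. Everything is
    required at each point of G, and not almost everywhere, so that iterates and
    series can be handled pointwise; values off G are left free. *)
Record averaging P : Prop := Averaging {
  averaging_integrable : forall f, L1 f -> L1 (P f);
  averaging_lin : forall a f g, L1 f -> L1 g -> forall x, G x ->
    P (fun y => a * f y + g y) x = a * P f x + P g x;
  averaging_ge0 : forall f, L1 f -> (forall x, G x -> 0 <= f x) ->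
    forall x, G x -> 0 <= P f x;
  averaging_cst1 : forall x, G x -> P (cst 1) x = 1;
  averaging_mass : forall f, L1 f -> Int (P f) = Int f
}.

Section averaging_theory.
Variable P : (T -> R) -> T -> R.
Hypothesis avgP : averaging P.

Lemma averaging_le f g : L1 f -> L1 g -> (forall x, G x -> f x <= g x) ->
  forall x, G x -> P f x <= P g x.
Proof.
move=> If Ig fg x Gx; rewrite -subr_ge0.
have := averaging_ge0 avgP (integrable_lin mG (-1) If Ig).
move=> /(_ _ x Gx); rewrite (averaging_lin avgP)// mulN1r addrC; apply.
by move=> y Gy; rewrite mulN1r addrC subr_ge0 fg.
Qed.

Lemma eq_averaging f g : L1 f -> L1 g -> (forall x, G x -> f x = g x) ->
  forall x, G x -> P f x = P g x.
Proof.
move=> If Ig fg x Gx; apply/le_anti/andP; split.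
  by apply: averaging_le => // y Gy; rewrite fg.
by apply: averaging_le => // y Gy; rewrite fg.
Qed.

Lemma averaging_affine a b f : L1 f -> forall x, G x ->
  P (fun y => a * f y + b) x = a * P f x + b.
Proof.
move=> If x Gx.
have I1 c : L1 (cst c) by exact: integrable_finite_cst.
rewrite (averaging_lin avgP _ If (I1 b))//; congr (_ + _).
have -> : P (fun=> b) x = P (fun y => b * cst 1 y + cst 0 y) x.
  apply: eq_averaging => //; [exact: I1|exact: integrable_lin|].
  by move=> y _ /=; rewrite mulr1 addr0.
rewrite (averaging_lin avgP)// averaging_cst1// mulr1.
have -> : P (cst 0) x = P (fun y => (-1) * cst 0 y + cst 0 y) x.
  apply: eq_averaging => //; first exact: integrable_lin.
  by move=> y _ /=; rewrite mulr0 addr0.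
by rewrite (averaging_lin avgP)// mulN1r addNr addr0.
Qed.

Lemma averaging_norm_le f g : L1 f -> L1 g -> (forall x, G x -> `|f x| <= g x) ->
  forall x, G x -> `|P f x| <= P g x.
Proof.
move=> If Ig fg x Gx; rewrite ler_norml; apply/andP; split; last first.
  by apply: averaging_le => // y Gy; exact: le_trans (ler_norm _) (fg _ Gy).
have -> : - P g x = P (fun y => -1 * g y + 0) x.
  by rewrite averaging_affine// mulN1r addr0.
apply: averaging_le => //.
  by apply: integrable_lin => //; exact: integrable_finite_cst.
move=> y Gy; rewrite mulN1r addr0 lerNl (le_trans _ (fg _ Gy))//.
by rewrite -normrN ler_norm.
Qed.

(** Jensen's inequality: apply P to the supporting line at P f x. *)
Lemma averaging_powR p f : 1 <= p -> L1 f -> L1 (fun x => `|f x| `^ p) ->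
  forall x, G x -> `|P f x| `^ p <= P (fun y => `|f y| `^ p) x.
Proof.
move=> p1 If Ifp x Gx; have [l tan] := powR_norm_tangent (P f x) p1.
set c := `|P f x| `^ p.
have <- : P (fun y => l * f y + (c - l * P f x)) x = c.
  by rewrite averaging_affine//; ring.
apply: averaging_le => //.
  by apply: integrable_lin => //; exact: integrable_finite_cst.
by move=> y Gy; apply: le_trans (tan (f y)); rewrite /c; lra.
Qed.

Lemma averaging_powR_integrable p f : 1 <= p ->
  L1 f -> L1 (fun x => `|f x| `^ p) -> L1 (fun x => `|P f x| `^ p).
Proof.
move=> p1 If Ifp.
have IPfp := averaging_integrable avgP Ifp.
apply: (integrable_dominated mG _ _ IPfp) => [|x Gx].
  apply: (measurableT_comp (measurable_powR _)).
  apply: measurableT_comp => //.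
  exact: integrable_measurable_fun (averaging_integrable avgP If).
by rewrite ger0_norm ?powR_ge0// averaging_powR.
Qed.

Lemma averaging_powR_contraction p f : 1 <= p ->
  L1 f -> L1 (fun x => `|f x| `^ p) ->
  Int (fun x => `|P f x| `^ p) <= Int (fun x => `|f x| `^ p).
Proof.
move=> p1 If Ifp; rewrite -(averaging_mass avgP Ifp).
apply: le_Rintegral => //; first exact: averaging_powR_integrable.
  exact: averaging_integrable.
exact: averaging_powR.
Qed.

End averaging_theory.

Lemma averaging_iter P k : averaging P -> averaging (fun f => iter k P f).
Proof.
move=> avgP; elim: k => [|k ih]; first by split.
have Ik f : L1 f -> L1 (iter k P f) by exact: (averaging_integrable ih).
split => /=.
- by move=> f If; apply: (averaging_integrable avgP); exact: Ik.
- move=> a f g If Ig x Gx.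
  rewrite -(averaging_lin avgP) ?Ik//; apply: (eq_averaging avgP) => //.
  + by apply: Ik; exact: integrable_lin.
  + by apply: integrable_lin => //; exact: Ik.
  + by move=> y Gy; rewrite (averaging_lin ih).
- move=> f If f0 x Gx; apply: (averaging_ge0 avgP) => //; first exact: Ik.
  by move=> y Gy; exact: (averaging_ge0 ih).
- move=> x Gx; rewrite -[RHS](averaging_cst1 avgP Gx).
  have I1 : L1 (cst 1) by exact: integrable_finite_cst.
  apply: (eq_averaging avgP) => //; first exact: Ik.
  by move=> y Gy; rewrite (averaging_cst1 ih).
- by move=> f If; rewrite (averaging_mass avgP) ?Ik// (averaging_mass ih).
Qed.

(** Removing the minorizing part from P leaves th * Q with Q averaging and
    th = 1 - de * mu G. On a function of mean zero P agrees with th * Q, and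
    th^p <= th. *)
Lemma averaging_minorized_contraction P (de p : R) f : averaging P ->
  0 < de -> de * fine (mu G) < 1 ->
  (forall g, L1 g -> (forall x, G x -> 0 <= g x) ->
     forall x, G x -> de * Int g <= P g x) ->
  1 <= p -> L1 f -> L1 (fun x => `|f x| `^ p) -> Int f = 0 ->
  Int (fun x => `|P f x| `^ p) <=
    (1 - de * fine (mu G)) * Int (fun x => `|f x| `^ p).
Proof.
move=> avgP de0 de1 minP p1 If Ifp f0.
pose th : R := 1 - de * fine (mu G); rewrite -/th.
have th0 : 0 < th by rewrite subr_gt0.
have th1 : th <= 1 by rewrite /th lerBlDr lerDl mulr_ge0 ?(ltW de0) ?fine_ge0.
have I1 c : L1 (cst c) by exact: integrable_finite_cst.
(* normalized so that Q fixes constants and preserves the integral *)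
pose Q g x := th^-1 * P g x + (- th^-1 * de * Int g).
have IQ g : L1 g -> L1 (Q g).
  move=> Ig; apply: integrable_lin => //; first exact: (averaging_integrable avgP).
  exact: I1.
have avgQ : averaging Q.
  split => //.
  - move=> a g h Ig Ih x Gx; rewrite /Q (averaging_lin avgP)//.
    by rewrite (Rintegral_lin mG a Ig Ih); ring.
  - move=> g Ig g0 x Gx; rewrite /Q mulNr mulNr -mulrA -mulrBr mulr_ge0//.
      by rewrite invr_ge0 ltW.
    by rewrite subr_ge0 minP.
  - move=> x Gx; rewrite /Q (averaging_cst1 avgP)// Rintegral_cst//= mul1r.
    by rewrite -mulrA mulNr -mulrBr mulVf// gt_eqF.
  - move=> g Ig; rewrite /Q (Rintegral_lin mG _ (averaging_integrable avgP Ig)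
      (I1 (- th^-1 * de * Int g))).
    have -> c : Int (fun=> c) = c * fine (mu G) by exact: Rintegral_cst.
    have thn0 : th != 0 by rewrite gt_eqF.
    rewrite (averaging_mass avgP)//; move: (Int g) => i.
    transitivity (i * (th / th)); last by rewrite mulfV// mulr1.
    have thE : th = 1 - de * fine (mu G) by [].
    by rewrite [X in _ = i * (X / _)]thE; ring.
have PE x : P f x = th * Q f x.
  by rewrite /Q f0 mulr0 addr0 mulrA mulfV ?mul1r// gt_eqF.
have IQp : L1 (fun x => `|Q f x| `^ p) by exact: averaging_powR_integrable.
have -> : Int (fun x => `|P f x| `^ p) = th `^ p * Int (fun x => `|Q f x| `^ p).
  rewrite -RintegralZl//; apply: eq_Rintegral => x _.
  by rewrite PE normrM (gtr0_norm th0) powRM// ltW.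
apply: ler_pM => //; rewrite ?powR_ge0//.
- by apply: Rintegral_ge0 => x _; exact: powR_ge0.
- by apply: ge1r_powR => //; rewrite th0 th1.
- exact: averaging_powR_contraction.
Qed.

(** Doeblin's theorem in L^p: the p-th power of the norm loses the factor th over
    each block of m steps and does not grow in between. *)
Lemma averaging_iter_decay P m (de : R) : averaging P -> (0 < m)%N ->
  0 < de -> de * fine (mu G) < 1 -> (0 < mu G)%E ->
  (forall g, L1 g -> (forall x, G x -> 0 <= g x) ->
     forall x, G x -> de * Int g <= iter m P g x) ->
  exists B la : R, [/\ 0 < B, 0 < la < 1 &
    forall p f k, 1 <= p -> L1 f -> L1 (fun x => `|f x| `^ p) -> Int f = 0 ->
      Int (fun x => `|iter k P f x| `^ p) <=
      B * la ^+ k * Int (fun x => `|f x| `^ p)].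
Proof.
move=> avgP m0 de0 de1 G0 minP.
have muG0 : 0 < fine (mu G) by rewrite fine_gt0// G0.
pose th : R := 1 - de * fine (mu G).
have th0 : 0 < th by rewrite subr_gt0.
have th1 : th < 1 by rewrite /th ltrBlDr ltrDl mulr_gt0.
have [la la01 decay] := geometric_decay m0 th0 th1.
exists th^-1, la; split => //; first by rewrite invr_gt0.
move=> p f k p1 If Ifp f0.
pose F j := iter j P f.
have avgF j := averaging_iter j avgP.
have IF j : L1 (F j) by exact: (averaging_integrable (avgF j)).
have IFp j : L1 (fun x => `|F j x| `^ p).
  exact: (averaging_powR_integrable (avgF j)).
apply: (decay (fun j => Int (fun x => `|F j x| `^ p))) => j.
- by apply: Rintegral_ge0 => x _; exact: powR_ge0.
- exact: (averaging_powR_contraction avgP p1 (IF j) (IFp j)).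
- rewrite /F addnC iterD.
  apply: (averaging_minorized_contraction (avgF m)) => //.
  + exact: IF.
  + exact: IFp.
  + by rewrite (averaging_mass (avgF j)).
Qed.

End averaging_operators.

Section averaging_localized.
Context d (T : measurableType d) (R : realType).
Variables (mu : {measure set T -> \bar R}) (D : set T).
Hypotheses (mD : measurable D) (finD : (mu D < +oo)%E).
Variables (S : (T -> R) -> T -> R) (be : R).
Implicit Types (f g : T -> R).

Local Notation L1 f := (mu.-integrable D (EFin \o f)).
Local Notation Int f := (\int[mu]_(x in D) f x).

Hypotheses (avgS : averaging mu D S) (be0 : 0 <= be)
  (Sbd : forall g, L1 g -> forall x, D x ->
    `|S g x| <= `|g x| + be * Int (fun y => `|g y|)).

Lemma averagingB f g x : L1 f -> L1 g -> D x ->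
  S (fun y => f y - g y) x = S f x - S g x.
Proof.
move=> If Ig Dx; rewrite addrC -mulN1r -(averaging_lin avgS)//.
apply: (eq_averaging mD avgS) => //.
- have := integrable_lin mD (-1) Ig If.
  by apply: integrable_eq_in => // y _; rewrite mulN1r addrC.
- exact: integrable_lin.
- by move=> y _; rewrite mulN1r addrC.
Qed.

Lemma integrable_sub f g : L1 f -> L1 g -> L1 (fun y => f y - g y).
Proof.
move=> If Ig; have := integrable_lin mD (-1) Ig If.
by apply: integrable_eq_in => // y _; rewrite mulN1r addrC.
Qed.

(** S is bounded pointwise up to an L1 term, so an estimate that is uniform
    relative to a weight W survives S, with a larger weight. This is what allows
    S to be exchanged with limits at each point. *)
Lemma averaging_dist f g W e : L1 f -> L1 g -> L1 W ->
  (forall x, D x -> `|f x - g x| <= e * W x) ->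
  forall x, D x -> `|S f x - S g x| <= e * (W x + be * Int W).
Proof.
move=> If Ig IW fgW x Dx; have Ifg := integrable_sub If Ig.
rewrite -averagingB//; apply: (le_trans (Sbd Ifg Dx)).
rewrite mulrDr; apply: lerD; first exact: fgW.
rewrite mulrCA ler_wpM2l// -RintegralZl//; apply: le_Rintegral => //.
- exact: integrable_norm.
- exact: (integrableZl mD e IW).
Qed.

End averaging_localized.

(** * Poisson averages of a sequence *)

Section poisson_average.
Context {R : realType}.
Implicit Types (a : nat -> R) (W s t M : R).

(** The ratio 2 is a convenience: growth like 2^k is absorbed by the factorials,
    and shifting the sequence by one only doubles W. *)
Definition exp_bounded W a := forall k, `|a k| <= 2 ^+ k * W.

(** The mean of a N for N Poisson distributed of parameter s. It is written with
    a power series so that it can be differentiated termwise. *)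
Definition poisson a s :=
  expR (- s) * limn (pseries (fun k => a k / k`!%:R) s).

Lemma exp_bounded_shift W a : exp_bounded W a ->
  exp_bounded (2 * W) (fun k => a k.+1).
Proof. by move=> aW k; apply: le_trans (aW k.+1) _; rewrite exprSr mulrA. Qed.

Lemma exp_bounded_ge0 W a : exp_bounded W a -> 0 <= W.
Proof. by move=> /(_ 0%N); rewrite mul1r; exact: le_trans. Qed.

Lemma pseries_exp_bounded W a s : exp_bounded W a ->
  cvgn (pseries (fun k => a k / k`!%:R) s) /\
  forall n, `|limn (pseries (fun k => a k / k`!%:R) s) -
              pseries (fun k => a k / k`!%:R) s n| <=
    W * (expR (2 * `|s|) - series (exp_coeff (2 * `|s|)) n).
Proof.
move=> aW; have W0 := exp_bounded_ge0 aW.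
have cW : series (fun k => W * exp_coeff (2 * `|s|) k) @ \oo --> W * expR (2 * `|s|).
  rewrite (_ : series _ = fun n => W * series (exp_coeff (2 * `|s|)) n).
    by apply: cvgMr; exact: is_cvg_series_exp_coeff.
  by apply/funext => n; rewrite /series/= mulr_sumr.
have [||cw tail] := @series_dominated_tail _ (fun k => a k / k`!%:R * s ^+ k)
  (fun k => W * exp_coeff (2 * `|s|) k).
- move=> k; rewrite !normrM normfV normr_nat normrX /exp_coeff /= exprMn.
  rewrite mulrAC [leRHS]mulrA ler_wpM2r// mulrA ler_wpM2r ?exprn_ge0//.
  by rewrite mulrC aW.
- by apply/cvg_ex; eexists; exact: cW.
split => // n; apply: (le_trans (tail n)).
rewrite (cvg_lim _ cW)// mulrBr lerB//
  [leRHS](_ : _ = series (fun k => W * exp_coeff (2 * `|s|) k) n)//.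
by rewrite /series/= mulr_sumr.
Qed.

Lemma poisson_bound W a s M : exp_bounded W a -> `|s| <= M ->
  `|poisson a s| <= W * expR (3 * M).
Proof.
move=> aW sM; have W0 := exp_bounded_ge0 aW.
have [_ /(_ 0%N)] := pseries_exp_bounded s aW.
rewrite /pseries /series/= !big_geq// !subr0 => le1.
rewrite /poisson normrM (ger0_norm (expR_ge0 _)).
apply: (@le_trans _ _ (expR M * (W * expR (2 * M)))); last first.
  by rewrite mulrCA -expRD ler_wpM2l// ler_expR; lra.
apply: ler_pM; rewrite ?expR_ge0//.
  by rewrite ler_expR (le_trans _ sM)// -normrN ler_norm.
by apply: (le_trans le1); rewrite ler_wpM2l// ler_expR ler_wpM2l.
Qed.

(** Differentiating a_k s^k / k! termwise shifts the sequence; the other term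
    comes from the factor exp (- s). *)
Lemma poisson_is_derive W a s : exp_bounded W a ->
  is_derive s 1 (poisson a) (poisson (fun k => a k.+1) s - poisson a s).
Proof.
move=> aW; set f := fun k => a k / k`!%:R.
have diffE b : pseries_diffs (fun k => b k / k`!%:R) = fun k => b k.+1 / k`!%:R :> R.
  apply/funext => k; rewrite /pseries_diffs factS natrM.
  by rewrite invfM mulrCA mulVKf// pnatr_eq0.
pose K := `|s| + 1.
have sK : `|s| < `|K| by rewrite /K [ltRHS]ger0_norm ?ltrDl// addr_ge0.
have D := @pseries_snd_diffs R f K s.
have {}D : is_derive s 1 (fun x => limn (pseries f x))
    (limn (pseries (fun k => a k.+1 / k`!%:R) s)).
  have [c1 _] := pseries_exp_bounded K aW.
  have [c2 _] := pseries_exp_bounded K (exp_bounded_shift aW).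
  have [c3 _] := pseries_exp_bounded K (exp_bounded_shift (exp_bounded_shift aW)).
  by have := D c1; rewrite !diffE; apply.
have E : is_derive s 1 (fun x => expR (- x)) (- expR (- s)).
  rewrite -mulrN1; apply: (@is_derive1_comp _ expR -%R s).
have H := is_deriveM E D.
rewrite (_ : poisson a = (fun x => expR (- x)) * (fun x => limn (pseries f x)))//.
apply: (is_derive_eq H).
pose x := limn (pseries (fun k => a k.+1 / k`!%:R) s); pose y := limn (pseries f s).
suff : expR (- s) * x + y * - expR (- s) = expR (- s) * x - expR (- s) * y by [].
by rewrite mulrN [y * _]mulrC.
Qed.

Lemma poisson_continuous W a : exp_bounded W a -> continuous (poisson a).
Proof.
move=> aW s; apply: differentiable_continuous; apply/derivable1_diffP.
by have [] := poisson_is_derive s aW.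
Qed.

Lemma poisson_mvt W a s t : exp_bounded W a ->
  exists2 c, Num.min s t <= c <= Num.max s t &
    poisson a t - poisson a s =
    (poisson (fun k => a k.+1) c - poisson a c) * (t - s).
Proof.
move=> aW; wlog st : s t / s <= t.
  move=> H; case/orP: (le_total s t) => [/H//|/H[c cst E]].
  by exists c; rewrite 1?minC 1?maxC// -opprB E -mulrN opprB.
have [||c cst E] := MVT_segment st (f := poisson a)
    (df := fun c => poisson (fun k => a k.+1) c - poisson a c).
- by move=> x _; exact: poisson_is_derive aW.
- by apply: continuous_subspaceT; exact: poisson_continuous aW.
by exists c => //; move: cst; rewrite in_itv/= min_l// max_r.
Qed.

Lemma poisson_lipschitz W a s t M : exp_bounded W a -> `|s| <= M -> `|t| <= M ->
  `|poisson a t - poisson a s| <= 3 * W * expR (3 * M) * `|t - s|.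
Proof.
move=> aW sM tM.
have [c cst ->] := poisson_mvt s t aW.
have cM : `|c| <= M.
  move: sM tM; rewrite !ler_norml => /andP[s1 s2] /andP[t1 t2].
  have /andP[+ +] := cst; rewrite ge_min le_max => c1 c2.
  by apply/andP; split; [case/orP: c1|case/orP: c2] => ?; lra.
rewrite normrM ler_wpM2r//; apply: (le_trans (ler_normB _ _)).
have := poisson_bound aW cM; have := poisson_bound (exp_bounded_shift aW) cM.
lra.
Qed.

(** The mean value theorem moves the derivative to an intermediate point c, and
    the Lipschitz bound brings it back to s. The shifted sequence contributes
    3 * 2 W and the sequence itself 3 W, whence the constant 9. *)
Lemma poisson_taylor W a s t M : exp_bounded W a -> `|s| <= M -> `|t| <= M ->
  `|poisson a t - poisson a s - (poisson (fun k => a k.+1) s - poisson a s) * (t - s)|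
  <= 9 * W * expR (3 * M) * `|t - s| ^+ 2.
Proof.
move=> aW sM tM.
have [c cst ->] := poisson_mvt s t aW; rewrite -mulrBl normrM expr2 mulrA.
have cM : `|c| <= M.
  move: sM tM; rewrite !ler_norml => /andP[s1 s2] /andP[t1 t2].
  have /andP[+ +] := cst; rewrite ge_min le_max => c1 c2.
  by apply/andP; split; [case/orP: c1|case/orP: c2] => ?; lra.
have cs : `|c - s| <= `|t - s|.
  have /andP[] := cst; have [st|ts] := lerP s t => c1 c2.
    by rewrite !ger0_norm ?subr_ge0//; lra.
  by rewrite !ler0_norm ?subr_le0//; lra.
rewrite ler_wpM2r//.
have l1 := poisson_lipschitz (exp_bounded_shift aW) sM cM.
have l2 := poisson_lipschitz aW sM cM.
apply: (@le_trans _ _ (9 * W * expR (3 * M) * `|c - s|)); last first.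
  by rewrite ler_wpM2l// !mulr_ge0 ?expR_ge0// (exp_bounded_ge0 aW).
rewrite -[X in _ <= X](_ : 3 * (2 * W) * expR (3 * M) * `|c - s| +
  3 * W * expR (3 * M) * `|c - s| = _); last by ring.
apply: le_trans (lerD l1 l2); apply: le_trans (ler_normB _ _).
by rewrite le_eqVlt; apply/orP; left; apply/eqP; congr (`|_|); ring.
Qed.

Definition poisson_weight s k := expR (- s) * exp_coeff s k.

Lemma poisson_weight_ge0 s k : 0 <= s -> 0 <= poisson_weight s k.
Proof. by move=> s0; rewrite /poisson_weight mulr_ge0 ?expR_ge0// exp_coeff_ge0. Qed.

Lemma poisson_partial W a s : exp_bounded W a ->
  (fun n => \sum_(0 <= k < n) poisson_weight s k * a k) @ \oo --> poisson a s.
Proof.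
move=> aW; have [cw _] := pseries_exp_bounded s aW.
rewrite (_ : (fun n => _) =
    fun n => expR (- s) * pseries (fun k => a k / k`!%:R) s n).
  exact: cvgMr.
apply/funext => n; rewrite /pseries /series/= mulr_sumr.
by apply: eq_bigr => k _; rewrite /poisson_weight /exp_coeff/=; ring.
Qed.

Lemma poisson_tail W a s n : exp_bounded W a ->
  `|poisson a s - \sum_(0 <= k < n) poisson_weight s k * a k| <=
   expR (- s) * (expR (2 * `|s|) - series (exp_coeff (2 * `|s|)) n) * W.
Proof.
move=> aW; have [_ /(_ n)] := pseries_exp_bounded s aW.
rewrite mulrAC -mulrA => le1; have := ler_wpM2l (expR_ge0 (- s)) le1.
apply: le_trans; rewrite -(ger0_norm (expR_ge0 (- s))) -normrM mulrBr.
rewrite /poisson.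
rewrite le_eqVlt; apply/orP; left; apply/eqP; congr (`|_ - _|).
rewrite /pseries /series/= mulr_sumr.
by apply: eq_bigr => k _; rewrite /poisson_weight /exp_coeff/=; ring.
Qed.

Lemma poisson_tail_cvg0 s :
  expR (- s) * (expR (2 * `|s|) - series (exp_coeff (2 * `|s|)) n) @[n --> \oo] --> 0.
Proof.
rewrite -(mulr0 (expR (- s))); apply: cvgMr; rewrite -(subrr (expR (2 * `|s|))).
by apply: cvgB; [exact: cvg_cst|exact: is_cvg_series_exp_coeff].
Qed.

Lemma exp_bounded_cst (c : R) : exp_bounded `|c| (cst c).
Proof. by move=> k /=; rewrite ler_peMl// exprn_ege1// ler1n. Qed.

Lemma poisson_cst (c : R) s : poisson (cst c) s = c.
Proof.
have L := @poisson_partial _ _ s (exp_bounded_cst c).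
rewrite -(cvg_lim _ L)//; apply: cvg_lim => //.
rewrite (_ : (fun n => _) = fun n => expR (- s) * series (exp_coeff s) n * c); last first.
  apply/funext => n; rewrite /series/= mulr_sumr mulr_suml; apply: eq_bigr => k _.
  by rewrite /poisson_weight.
have E : expR (- s) * expR s = 1 by rewrite mulrC expRxMexpNx_1.
rewrite -[X in _ --> X]mul1r -E.
by apply: cvgMl; apply: cvgMr; exact: is_cvg_series_exp_coeff.
Qed.

(** The generating function of the Poisson law. *)
Lemma poisson_weight_geometric s la n : 0 <= s -> 0 <= la ->
  \sum_(0 <= k < n) poisson_weight s k * la ^+ k <= expR (- ((1 - la) * s)).
Proof.
move=> s0 la0.
have -> : - ((1 - la) * s) = - s + la * s by ring.
rewrite expRD.
have -> : \sum_(0 <= k < n) poisson_weight s k * la ^+ k =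
    expR (- s) * series (exp_coeff (la * s)) n.
  rewrite /series/= mulr_sumr; apply: eq_bigr => k _.
  by rewrite /poisson_weight /exp_coeff/= exprMn; ring.
rewrite ler_wpM2l ?expR_ge0//.
apply: nondecreasing_cvgn_le; last exact: is_cvg_series_exp_coeff.
by apply: nondecreasing_series => k _ _; rewrite exp_coeff_ge0// mulr_ge0.
Qed.

End poisson_average.

(** * The semigroup generated by an averaging operator *)

Section averaging_semigroup.
Context d (T : measurableType d) (R : realType).
Variables (mu : {measure set T -> \bar R}) (G : set T).
Hypotheses (mG : measurable G) (finG : (mu G < +oo)%E).
Variables (P : (T -> R) -> T -> R) (b ka : R).
Implicit Types (f g u : T -> R) (t : R).

Local Notation L1 f := (mu.-integrable G (EFin \o f)).
Local Notation Int f := (\int[mu]_(x in G) f x).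

Hypotheses (avgP : averaging mu G P) (b0 : 0 <= b)
  (Pbd : forall g, L1 g -> forall x, G x ->
    `|P g x| <= `|g x| + b * Int (fun y => `|g y|))
  (ka0 : 0 < ka).

Let avgPk k := averaging_iter mG finG k avgP.

Let IPk k u : L1 u -> L1 (iter k P u).
Proof. exact: (averaging_integrable (avgPk k)). Qed.

Let I1 c : L1 (cst c). Proof. exact: integrable_finite_cst. Qed.

Lemma averaging_norm_mass Q f : averaging mu G Q -> L1 f ->
  Int (fun x => `|Q f x|) <= Int (fun x => `|f x|).
Proof.
move=> avgQ If; have Inf := integrable_norm If.
rewrite -(averaging_mass avgQ Inf); apply: le_Rintegral => //.
- exact: integrable_norm (averaging_integrable avgQ If).
- exact: averaging_integrable.
- by apply: (averaging_norm_le mG finG avgQ).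
Qed.

Lemma averaging_sum (w : nat -> R) (F : nat -> T -> R) n x :
  (forall k, L1 (F k)) -> G x ->
  L1 (fun y => \sum_(0 <= k < n) w k * F k y) /\
  P (fun y => \sum_(0 <= k < n) w k * F k y) x = \sum_(0 <= k < n) w k * P (F k) x.
Proof.
move=> IF Gx.
have Isum m : L1 (fun y => \sum_(0 <= k < m) w k * F k y).
  elim: m => [|m ih].
    by apply: (integrable_eq_in mG _ (I1 0)) => y _; rewrite big_geq.
  apply: (integrable_eq_in mG _ (integrable_lin mG (w m) (IF m) ih)) => y _.
  by rewrite big_nat_recr//= addrC.
split=> //; elim: n => [|n ih].
  rewrite big_geq// -[RHS](mul0r (P (cst 0) x)) -[RHS]addr0.
  rewrite -(averaging_affine mG finG avgP)//.
  apply: (eq_averaging mG avgP) => //.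
    by apply: (integrable_lin mG 0 (I1 0)); exact: (I1 0).
  by move=> y _; rewrite big_geq// mul0r addr0.
rewrite (eq_averaging mG avgP (Isum n.+1) (integrable_lin mG (w n) (IF n) (Isum n)))//.
  by rewrite (averaging_lin avgP)// ih big_nat_recr//= addrC.
by move=> y _; rewrite big_nat_recr//= addrC.
Qed.

(** A weight dominating all iterates of P at x up to a linear factor, because each
    application of P adds at most b times the L1 norm. *)
Definition envelope u x := `|u x| + b * Int (fun y => `|u y|).

Lemma envelope_integrable u : L1 u -> L1 (envelope u).
Proof.
move=> Iu.
have := integrable_lin mG 1 (integrable_norm Iu) (I1 (b * Int (fun y => `|u y|))).
by apply: integrable_eq_in => // x _; rewrite mul1r.
Qed.

Lemma envelope_ge0 u x : 0 <= envelope u x.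
Proof. by rewrite addr_ge0// mulr_ge0// Rintegral_ge0. Qed.

Lemma iter_exp_bounded u x : L1 u -> G x ->
  exp_bounded (envelope u x) (fun k => iter k P u x).
Proof.
move=> Iu Gx k; pose N := Int (fun y => `|u y|).
have N0 : 0 <= N by apply: Rintegral_ge0.
have : `|iter k P u x| <= `|u x| + k%:R * (b * N).
  elim: k => [|k ih] /=; first by rewrite mul0r addr0.
  apply: (le_trans (Pbd (IPk k Iu) Gx)); rewrite -natr1 mulrDl mul1r addrA.
  by rewrite lerD// ler_wpM2l// averaging_norm_mass.
move=> /le_trans; apply; rewrite /envelope -/N mulrDr; apply: lerD.
  by rewrite ler_peMl// exprn_ege1// ler1n.
by rewrite ler_wpM2r ?mulr_ge0// -natrX ler_nat ltnW// ltn_expl.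
Qed.

Definition semigroup u t x := poisson (fun k => iter k P u x) (ka * t).

Let psum u t n x := \sum_(0 <= k < n) poisson_weight (ka * t) k * iter k P u x.

Let tau t n := expR (- (ka * t)) *
  (expR (2 * `|ka * t|) - series (exp_coeff (2 * `|ka * t|)) n).

Let psum_dist u t n x : L1 u -> G x ->
  `|semigroup u t x - psum u t n x| <= tau t n * envelope u x.
Proof. by move=> Iu Gx; apply: poisson_tail; exact: iter_exp_bounded. Qed.

Let psum_cvg u t x : L1 u -> G x -> psum u t ^~ x @ \oo --> semigroup u t x.
Proof. by move=> Iu Gx; apply: poisson_partial; exact: iter_exp_bounded. Qed.

Let psum_integrable u t n : L1 u -> L1 (psum u t n).
Proof.
move=> Iu; have [G0|/set0P[x Gx]] := eqVneq G set0.
  rewrite G0; exact: integrable_set0.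
by have [] := averaging_sum (poisson_weight (ka * t)) n (fun k => IPk k Iu) Gx.
Qed.

Lemma semigroup_bound u t M x : L1 u -> G x -> `|t| <= M ->
  `|semigroup u t x| <= expR (3 * (ka * M)) * envelope u x.
Proof.
move=> Iu Gx tM; rewrite mulrC; apply: poisson_bound; first exact: iter_exp_bounded.
by rewrite normrM gtr0_norm// ler_pM2l.
Qed.

Lemma semigroup_integrable u t : L1 u -> L1 (semigroup u t).
Proof.
move=> Iu; apply: (integrable_dominated mG _ _
  (integrableZl mG (expR (3 * (ka * `|t|))) (envelope_integrable Iu))).
  apply: (@measurable_fun_cvg _ _ _ _ (psum u t)) => [n|x Gx].
    exact: integrable_measurable_fun (psum_integrable t n Iu).
  exact: psum_cvg.
by move=> x Gx; exact: semigroup_bound.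
Qed.

Lemma semigroup0 u x : L1 u -> G x -> semigroup u 0 x = u x.
Proof.
move=> Iu Gx; apply/eqP; rewrite -subr_eq0 -normr_eq0 eq_le normr_ge0 andbT.
have := poisson_tail 0 1 (iter_exp_bounded Iu Gx).
rewrite big_nat1 /semigroup mulr0 normr0 mulr0 /series/= big_nat1.
rewrite /poisson_weight /exp_coeff /= fact0 oppr0 expR0 divr1 !mul1r subrr.
by rewrite mul0r.
Qed.

(** P goes through the Poisson series because the remainders are uniformly small
    relative to the envelope ([averaging_dist]). *)
Lemma averaging_semigroup u t x : L1 u -> G x ->
  P (semigroup u t) x = poisson (fun k => iter k.+1 P u x) (ka * t).
Proof.
move=> Iu Gx.
have c1 : P (psum u t n) x @[n --> \oo] -->
    poisson (fun k => iter k.+1 P u x) (ka * t).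
  have := @poisson_partial _ _ _ (ka * t) (exp_bounded_shift (iter_exp_bounded Iu Gx)).
  rewrite (_ : (fun n => \sum_(_ <= _ < _) _) = fun n => P (psum u t n) x)//.
  apply/funext => n.
  by have [_ ->] := averaging_sum (poisson_weight (ka * t)) n (fun k => IPk k Iu) Gx.
apply/eqP; rewrite -subr_eq0 -normr_eq0 eq_le normr_ge0 andbT.
set l := poisson _ _ in c1 *.
have c2 : `|P (semigroup u t) x - P (psum u t n) x| -
    tau t n * (envelope u x + b * Int (envelope u)) @[n --> \oo] -->
    `|P (semigroup u t) x - l| - 0 * (envelope u x + b * Int (envelope u)).
  apply: cvgB; first by apply: cvg_norm; apply: cvgB => //; exact: cvg_cst.
  by apply: cvgMl; exact: poisson_tail_cvg0.
rewrite -[leLHS]subr0 -[X in _ - X](mul0r (envelope u x + b * Int (envelope u))).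
apply: (cvgr_to_le c2); apply: nearW => n; rewrite subr_le0.
apply: (averaging_dist mG avgP b0 Pbd) => //.
- exact: semigroup_integrable.
- exact: psum_integrable.
- exact: envelope_integrable.
- by move=> y Gy; exact: psum_dist.
Qed.

Lemma semigroup_lipschitz u s t M x : L1 u -> G x -> `|s| <= M -> `|t| <= M ->
  `|semigroup u t x - semigroup u s x| <=
    3 * expR (3 * (ka * M)) * ka * `|t - s| * envelope u x.
Proof.
move=> Iu Gx sM tM.
have := @poisson_lipschitz _ _ _ (ka * s) (ka * t) (ka * M) (iter_exp_bounded Iu Gx).
rewrite -mulrBr !normrM (gtr0_norm ka0) !ler_pM2l// => /(_ sM tM).
by move=> /le_trans; apply; rewrite le_eqVlt; apply/orP; left; apply/eqP; ring.
Qed.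

Lemma semigroup_taylor u s t M x : L1 u -> G x -> `|s| <= M -> `|t| <= M ->
  `|semigroup u t x - semigroup u s x -
    (t - s) * (ka * (P (semigroup u s) x - semigroup u s x))| <=
    9 * expR (3 * (ka * M)) * ka ^+ 2 * `|t - s| ^+ 2 * envelope u x.
Proof.
move=> Iu Gx sM tM; rewrite averaging_semigroup//.
have := @poisson_taylor _ _ _ (ka * s) (ka * t) (ka * M) (iter_exp_bounded Iu Gx).
rewrite -[ka * t - ka * s]mulrBr !normrM (gtr0_norm ka0) !ler_pM2l// => /(_ sM tM).
rewrite -/(semigroup u s x) -/(semigroup u t x).
have -> : (t - s) * (ka * (poisson (fun k => iter k.+1 P u x) (ka * s) -
      semigroup u s x)) = (poisson (fun k => iter k.+1 P u x) (ka * s) -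
      semigroup u s x) * (ka * (t - s)) by ring.
by move=> /le_trans; apply; rewrite le_eqVlt; apply/orP; left; apply/eqP; ring.
Qed.

Lemma semigroup_mass u t : L1 u -> Int (semigroup u t) = Int u.
Proof.
move=> Iu.
have c1 : Int (psum u t n) @[n --> \oo] --> Int u.
  have := @poisson_partial _ _ _ (ka * t) (exp_bounded_cst (Int u)); rewrite poisson_cst.
  rewrite (_ : (fun n => \sum_(_ <= _ < _) _) = fun n => Int (psum u t n))//.
  apply/funext => n; elim: n => [|n ih].
    rewrite big_geq// /psum (_ : (fun x => _) = cst 0) ?Rintegral_cst ?mul0r//.
    by apply/funext => x; rewrite big_geq.
  rewrite big_nat_recr//= ih.
  have -> : Int (psum u t n.+1) =
      Int (fun x => poisson_weight (ka * t) n * iter n P u x + psum u t n x).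
    by apply: eq_Rintegral => x _; rewrite /psum big_nat_recr//= addrC.
  rewrite (Rintegral_lin mG _ (IPk n Iu) (psum_integrable t n Iu)).
  by rewrite (averaging_mass (avgPk n))// addrC.
apply/eqP; rewrite -subr_eq0 -normr_eq0 eq_le normr_ge0 andbT.
have c2 : `|Int (semigroup u t) - Int (psum u t n)| -
    tau t n * Int (envelope u) @[n --> \oo] -->
    `|Int (semigroup u t) - Int u| - 0 * Int (envelope u).
  apply: cvgB; first by apply: cvg_norm; apply: cvgB => //; exact: cvg_cst.
  by apply: cvgMl; exact: poisson_tail_cvg0.
rewrite -[leLHS]subr0 -[X in _ - X](mul0r (Int (envelope u))).
apply: (cvgr_to_le c2); apply: nearW => n; rewrite subr_le0.
have Isg := semigroup_integrable t Iu; have Ips := psum_integrable t n Iu.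
have Idiff := integrable_sub mG Isg Ips; have Ienv := envelope_integrable Iu.
rewrite -RintegralB//; apply: (le_trans (le_normr_Rintegral mG Idiff)).
rewrite -RintegralZl//; apply: le_Rintegral => //.
- exact: integrable_norm Idiff.
- exact: (integrableZl mG _ Ienv).
- by move=> x Gx; exact: psum_dist.
Qed.

Lemma semigroup_sub_cst u c t x : L1 u -> G x ->
  semigroup (fun y => u y - c) t x = semigroup u t x - c.
Proof.
move=> Iu Gx.
have Iuc : L1 (fun y => u y - c) by exact: integrable_sub (I1 c).
have iterE k : iter k P (fun y => u y - c) x = iter k P u x - c.
  rewrite -[X in X - c]mul1r -(averaging_affine mG finG (avgPk k))//.
  apply: (eq_averaging mG (avgPk k)) => //.
    exact: (integrable_lin mG 1 Iu (I1 (- c))).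
  by move=> y _; rewrite mul1r.
have L1' := psum_cvg (t := t) Iuc Gx; have L2 := psum_cvg (t := t) Iu Gx.
have L3 := @poisson_partial _ _ _ (ka * t) (exp_bounded_cst c); rewrite poisson_cst in L3.
rewrite -(cvg_lim _ L1')//; apply: cvg_lim => //.
rewrite (_ : psum _ t ^~ x = fun n => psum u t n x -
    \sum_(0 <= k < n) poisson_weight (ka * t) k * cst c k); last first.
  apply/funext => n; rewrite /psum -sumrB; apply: eq_bigr => k _.
  by rewrite iterE mulrBr.
exact: cvgB.
Qed.

(** Jensen's inequality for the Poisson weights bounds the partial sums, and
    Fatou's lemma passes to the limit. *)
Lemma semigroup_decay B la p v t : 0 <= B -> 0 <= la -> 1 <= p -> 0 <= t ->
  L1 v -> L1 (fun x => `|v x| `^ p) ->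
  (forall k, Int (fun x => `|iter k P v x| `^ p) <=
     B * la ^+ k * Int (fun x => `|v x| `^ p)) ->
  (\int[mu]_(x in G) (`|semigroup v t x| `^ p)%:E <=
    (B * expR (- ((1 - la) * (ka * t))) * Int (fun x => `|v x| `^ p))%:E)%E.
Proof.
move=> B0 la0 p1 t0 Iv Ivp decay.
set N := Int (fun x => `|v x| `^ p); have N0 : 0 <= N.
  by apply: Rintegral_ge0 => x _; exact: powR_ge0.
have s0 : 0 <= ka * t by rewrite mulr_ge0// ltW.
have Ikp k : L1 (fun x => `|iter k P v x| `^ p).
  exact: (averaging_powR_integrable mG finG (avgPk k)).
pose w := poisson_weight (ka * t).
have w0 k : 0 <= w k by exact: poisson_weight_ge0.
have w1 n : \sum_(0 <= k < n) w k <= 1.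
  have := poisson_weight_geometric n s0 (@ler01 R).
  rewrite subrr mul0r oppr0 expR0; apply: le_trans.
  by apply: ler_sum => k _; rewrite expr1n mulr1.
have mps n : measurable_fun G (fun x => (`|psum v t n x| `^ p)%:E).
  apply/measurable_EFinP; apply: (measurableT_comp (measurable_powR _)).
  apply: measurableT_comp => //.
  exact: integrable_measurable_fun (psum_integrable t n Iv).
have psum_le n : (\int[mu]_(x in G) (`|psum v t n x| `^ p)%:E <=
    (B * expR (- ((1 - la) * (ka * t))) * N)%:E)%E.
  have Isum m : L1 (fun x => \sum_(0 <= k < m) w k * `|iter k P v x| `^ p) /\
      Int (fun x => \sum_(0 <= k < m) w k * `|iter k P v x| `^ p) =
      \sum_(0 <= k < m) w k * Int (fun x => `|iter k P v x| `^ p).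
    elim: m => [|m [ih1 ih2]].
      split.
        by apply: (integrable_eq_in mG _ (I1 0)) => x _; rewrite big_geq.
      rewrite big_geq// (_ : (fun x => _) = cst 0) ?Rintegral_cst ?mul0r//.
      by apply/funext => x; rewrite big_geq.
    have H := integrable_lin mG (w m) (Ikp m) ih1.
    have HE x : w m * `|iter m P v x| `^ p +
        \sum_(0 <= k < m) w k * `|iter k P v x| `^ p =
        \sum_(0 <= k < m.+1) w k * `|iter k P v x| `^ p.
      by rewrite big_nat_recr//= addrC.
    split; first by apply: (integrable_eq_in mG _ H) => x _; exact: HE.
    rewrite big_nat_recr//= -ih2 addrC -(Rintegral_lin mG _ (Ikp m) ih1).
    by apply: eq_Rintegral => x _; rewrite HE.
  have [Is IsE] := Isum n.
  apply: (@le_trans _ _ (\int[mu]_(x in G)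
    (\sum_(0 <= k < n) w k * `|iter k P v x| `^ p)%:E)%E).
    apply: ge0_le_integral => //.
    - by apply/measurable_EFinP; exact: integrable_measurable_fun Is.
    - by move=> x Gx; rewrite lee_fin; exact: powR_norm_sum_le.
  rewrite -[leLHS]fineK ?(integrable_fin_num mG Is)// lee_fin.
  rewrite -/(Rintegral _ _ _) IsE.
  apply: (@le_trans _ _ (\sum_(0 <= k < n) (w k * la ^+ k) * (B * N))).
    apply: ler_sum => k _; rewrite -mulrA ler_wpM2l//.
    by apply: (le_trans (decay k)); rewrite mulrCA mulrA.
  rewrite -mulr_suml [leRHS]mulrAC [leRHS]mulrC ler_wpM2r ?mulr_ge0//.
  exact: poisson_weight_geometric.
(* lower semicontinuity of the power, from its supporting line at the limit *)
have liminf x : G x ->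
    ((`|semigroup v t x| `^ p)%:E <= limn_einf (fun n => (`|psum v t n x| `^ p)%:E))%E.
  move=> Gx; have [l tan] := powR_norm_tangent (semigroup v t x) p1.
  pose g n := (`|semigroup v t x| `^ p + l * (psum v t n x - semigroup v t x))%:E.
  have cg : g n @[n --> \oo] --> (`|semigroup v t x| `^ p)%:E.
    apply: cvg_EFin; first exact: nearW.
    rewrite -[X in _ --> X]addr0 -(mulr0 l) -(subrr (semigroup v t x)).
    apply: cvgD; first exact: cvg_cst.
    by apply: cvgMr; apply: cvgB; [exact: psum_cvg|exact: cvg_cst].
  rewrite -(cvg_limn_einf_sup cg).1 !limn_einf_lim.
  apply: lee_lim; [exact: is_cvg_einfs|exact: is_cvg_einfs|].
  apply: nearW => n; apply: le_ereal_inf_tmp => _ [m /= nm <-].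
  apply: (@le_trans _ _ (g m)); last by rewrite lee_fin tan.
  by apply: ereal_inf_lbound; exists m.
apply: (@le_trans _ _ (\int[mu]_(x in G) limn_einf (fun n => (`|psum v t n x| `^ p)%:E))%E).
  apply: ge0_le_integral => //.
  - apply/measurable_EFinP; apply: (measurableT_comp (measurable_powR _)).
    apply: measurableT_comp => //.
    exact: integrable_measurable_fun (semigroup_integrable t Iv).
  - apply: (emeasurable_fun_cvg
      (fun n x => einfs (fun m => (`|psum v t m x| `^ p)%:E) n)) => [n|x _].
      exact: (measurable_fun_einfs (f := fun m x => (`|psum v t m x| `^ p)%:E)).
    by rewrite limn_einf_lim; exact: is_cvg_einfs.
apply: (le_trans (fatou mu mG mps _)) => [n x _|]; first by rewrite lee_fin powR_ge0.
rewrite limn_einf_lim; apply: lime_le; first exact: is_cvg_einfs.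
apply: nearW => n; apply: le_trans (psum_le n).
by apply: ereal_inf_lbound; exists n => /=.
Qed.

End averaging_semigroup.

(** * The L^p norm over a set of finite measure *)

Section Lp_norm.
Context d (T : measurableType d) (R : realType).
Variables (mu : {measure set T -> \bar R}) (G : set T) (p : R).
Hypotheses (mG : measurable G) (finG : (mu G < +oo)%E) (p1 : 1 <= p).
Implicit Types (f g : T -> R) (a : R).

Local Notation L1 f := (mu.-integrable G (EFin \o f)).
Local Notation Int f := (\int[mu]_(x in G) f x).

Let p0 : 0 < p. Proof. exact: lt_le_trans p1. Qed.

Definition Lp f := measurable_fun G f /\ L1 (fun x => `|f x| `^ p).

Definition Lp_norm f := Int (fun x => `|f x| `^ p) `^ p^-1.

Lemma Lp_integrable f : Lp f -> L1 f.
Proof.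
move=> [mf If].
have I1 := integrable_lin mG 1 If (integrable_finite_cst mG 1 finG).
apply: (integrable_dominated mG mf _ I1) => x _ /=; rewrite mul1r.
have [f1|/ltW f1] := leP `|f x| 1.
  by rewrite (le_trans f1)// lerDr powR_ge0.
by rewrite (le_trans (le1r_powR f1 p1))// lerDl.
Qed.

Lemma measurable_fun_norm_powR f : measurable_fun G f ->
  measurable_fun G (fun x => `|f x| `^ p).
Proof.
move=> mf; apply: (measurableT_comp (measurable_powR _)).
exact: measurableT_comp.
Qed.

Lemma Lp_dominated f g : measurable_fun G f ->
  (forall x, G x -> `|f x| <= `|g x|) -> Lp g -> Lp f.
Proof.
move=> mf fg [mg Ig]; split => //.
apply: (integrable_dominated mG (measurable_fun_norm_powR mf) _ Ig) => x Gx.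
by rewrite ger0_norm ?powR_ge0// ge0_ler_powR ?nnegrE ?fg// ltW.
Qed.

Lemma LpZ a f : Lp f -> Lp (fun x => a * f x).
Proof.
move=> [mf If]; split; first exact: measurable_funM.
apply: (integrable_eq_in mG _ (integrableZl mG (`|a| `^ p) If)) => x _ /=.
by rewrite normrM powRM.
Qed.

Lemma LpD f g : Lp f -> Lp g -> Lp (fun x => f x + g x).
Proof.
move=> [mf If] [mg Ig]; have mfg : measurable_fun G (fun x => f x + g x).
  exact: measurable_funD.
split => //.
have I2 := integrableZl mG (2 `^ p) (integrable_lin mG 1 If Ig).
apply: (integrable_dominated mG (measurable_fun_norm_powR mfg) _ I2) => x _ /=.
rewrite ger0_norm ?powR_ge0// mul1r.
have max0 : 0 <= Num.max `|f x| `|g x| by rewrite le_max normr_ge0.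
apply: (@le_trans _ _ ((2 * Num.max `|f x| `|g x|) `^ p)).
  rewrite ge0_ler_powR ?nnegrE ?mulr_ge0 ?(ltW p0)//.
  apply: (le_trans (ler_normD _ _)); rewrite mulr_natl mulr2n.
  by rewrite lerD// le_max lexx ?orbT.
rewrite powRM// ler_wpM2l ?powR_ge0//.
by have [_|_] := leP `|f x| `|g x|; rewrite ?lerDl ?lerDr powR_ge0.
Qed.

Lemma Lp_cst a : Lp (cst a).
Proof. by split => //; exact: (integrable_finite_cst mG (`|a| `^ p) finG). Qed.

Lemma eq_Lp f g : (forall x, G x -> f x = g x) -> Lp f -> Lp g.
Proof.
move=> fg [mf If]; split.
  by apply: eq_measurable_fun mf => x /[!inE] Gx; rewrite fg.
by apply: (integrable_eq_in mG _ If) => x Gx; rewrite fg.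
Qed.

Lemma Lp_norm_ge0 f : 0 <= Lp_norm f. Proof. exact: powR_ge0. Qed.

Lemma eq_Lp_norm f g : (forall x, G x -> f x = g x) -> Lp_norm f = Lp_norm g.
Proof.
by move=> fg; congr (_ `^ _); apply: eq_Rintegral_in => x Gx; rewrite fg.
Qed.

Lemma Lp_normE f : Lp f ->
  Lnorm mu p%:E (EFin \o (f \_ G)) = (Lp_norm f)%:E.
Proof.
move=> [mf If]; rewrite unlock /Lnorm /Lp_norm -poweR_EFin; congr (_ `^ _)%E.
rewrite /Rintegral fineK; last exact: integrable_fin_num If.
rewrite [RHS]integral_mkcond; apply: eq_integral => x _ /=.
rewrite !patchE; case: ifP => // _.
by rewrite [X in X `^ _]normr0 powR0// gt_eqF.
Qed.

Lemma measurable_restrict_Lp f : Lp f -> measurable_fun setT (f \_ G).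
Proof. by move=> [mf _]; apply/(measurable_restrictT _ mG). Qed.

Lemma Lp_normD f g : Lp f -> Lp g ->
  Lp_norm (fun x => f x + g x) <= Lp_norm f + Lp_norm g.
Proof.
move=> Lf Lg.
have := minkowski_EFin mu (measurable_restrict_Lp Lf) (measurable_restrict_Lp Lg) p1.
rewrite (Lp_normE Lf) (Lp_normE Lg).
have -> : (f \_ G \+ g \_ G)%R = (fun x => f x + g x) \_ G.
  by apply/funext => x /=; rewrite !patchE; case: ifP => // _; rewrite addr0.
by rewrite (Lp_normE (LpD Lf Lg)) -EFinD lee_fin.
Qed.

Lemma Lp_norm_le f g : Lp f -> Lp g -> (forall x, G x -> `|f x| <= `|g x|) ->
  Lp_norm f <= Lp_norm g.
Proof.
move=> [mf If] [mg Ig] fg.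
apply: ge0_ler_powR; rewrite ?nnegrE ?invr_ge0 ?(ltW p0)//.
- by apply: Rintegral_ge0 => x _; exact: powR_ge0.
- by apply: Rintegral_ge0 => x _; exact: powR_ge0.
- apply: le_Rintegral => // x Gx.
  by apply: ge0_ler_powR; rewrite ?nnegrE ?(ltW p0)// fg.
Qed.

Lemma Lp_normZ a f : Lp f -> Lp_norm (fun x => a * f x) = `|a| * Lp_norm f.
Proof.
move=> [mf If]; rewrite /Lp_norm.
have -> : Int (fun x => `|a * f x| `^ p) = `|a| `^ p * Int (fun x => `|f x| `^ p).
  by rewrite -RintegralZl//; apply: eq_Rintegral => x _; rewrite normrM powRM.
rewrite powRM ?powR_ge0//; last by apply: Rintegral_ge0 => x _; exact: powR_ge0.
by rewrite -powRrM mulfV ?gt_eqF// powRr1.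
Qed.

Lemma Lp_norm_eq0 f : Lp f -> Lp_norm f = 0 -> {ae mu, forall x, G x -> f x = 0}.
Proof.
move=> [mf If] /powR_eq0_eq0 I0.
have := Rintegral_eq0_ae mG If (fun x _ => powR_ge0 _ _) I0.
apply: filterS => x fx Gx; apply/eqP; rewrite -normr_eq0; apply/eqP.
exact: powR_eq0_eq0 (fx Gx).
Qed.

Lemma Lp_averaging P f : averaging mu G P -> Lp f -> Lp (P f) /\ Lp_norm (P f) <= Lp_norm f.
Proof.
move=> avgP Lf; have If := Lp_integrable Lf; have [mf Ifp] := Lf; split.
  split; first exact: integrable_measurable_fun (averaging_integrable avgP If).
  exact: (averaging_powR_integrable mG finG avgP).
apply: ge0_ler_powR; rewrite ?nnegrE ?invr_ge0 ?(ltW p0)//.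
- by apply: Rintegral_ge0 => x _; exact: powR_ge0.
- by apply: Rintegral_ge0 => x _; exact: powR_ge0.
- exact: (averaging_powR_contraction mG finG avgP).
Qed.

End Lp_norm.

(** * Uniqueness for the evolution equation *)

Section left_dini.
Context {R : realType}.

(** If g tm were larger than g 0, then g t - ep * t with a small slope ep would
    have its maximum at some c > 0, where the hypothesis forces larger values
    just to the left. *)
Lemma left_dini_le (g : R -> R) (tm : R) : 0 < tm ->
  {within `[0, tm], continuous g} ->
  (forall t, 0 < t <= tm -> exists2 e : R -> R,
     e h @[h --> 0^'+] --> 0 &
     \forall h \near 0^'+, g t <= g (t - h) + h * e h) ->
  g tm <= g 0.
Proof.
move=> T0 cg dini; rewrite leNgt; apply/negP => gT.
(* half the mean slope of g over [0, tm] *)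
pose ep := (g tm - g 0) / (2 * tm).
have ep0 : 0 < ep by rewrite divr_gt0 ?subr_gt0// mulr_gt0.
pose psi t := g t - ep * t.
have cpsi : {within `[0, tm], continuous psi}.
  move=> t; apply: cvgB; first exact: cg.
  apply: continuous_subspaceT => {}t; apply: cvgMr; exact: cvg_id.
have [c c01 cmax] := EVT_max (ltW T0) cpsi.
have psi0T : psi 0 < psi tm.
  have epT : ep * tm = (g tm - g 0) / 2 by rewrite /ep; field; rewrite gt_eqF.
  by rewrite /psi mulr0 epT; lra.
have c0 : 0 < c.
  rewrite lt_neqAle; move: (c01); rewrite in_itv/= => /andP[-> _]; rewrite andbT.
  apply/eqP => c0; have := cmax tm; rewrite in_itv/= (ltW T0) lexx => /(_ isT).
  by rewrite -c0 leNgt psi0T.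
have cT : c <= tm by move: c01; rewrite in_itv/= => /andP[].
have [e e0 near_e] := dini c (introT andP (conj c0 cT)).
have : \forall h \near 0^'+, e h < ep by apply: cvgr_lt e0 _ ep0.
move=> near_ep.
have [h [[h0 hc] he gh]] :
    exists h, [/\ 0 < h /\ h < c, e h < ep & g c <= g (c - h) + h * e h].
  near (0 : R)^'+ => h; exists h; split; [split|near: h|near: h] => //.
have : psi (c - h) <= psi c.
  by apply: cmax; rewrite in_itv/=; apply/andP; split; lra.
rewrite /psi => le1.
have : h * e h < h * ep by rewrite ltr_pM2l.
lra.
Unshelve. all: by end_near. Qed.

End left_dini.

Section evolution_uniqueness.
Context d (T : measurableType d) (R : realType).
Variables (mu : {measure set T -> \bar R}) (G : set T) (p : R).
Hypotheses (mG : measurable G) (finG : (mu G < +oo)%E) (p1 : 1 <= p).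
Variables (P : (T -> R) -> T -> R) (ka : R).
Hypotheses (avgP : averaging mu G P) (ka0 : 0 < ka).
Implicit Types (u : R -> T -> R) (t : R).

Local Notation L1 f := (mu.-integrable G (EFin \o f)).
Local Notation Lp := (Lp mu G p).
Local Notation N f := (Lp_norm mu G p f).

(** Classical solutions in L^p of du/dt = ka * (P u - u): differentiability is
    two-sided for t > 0, and at 0 only continuity is required. *)
Definition evolution u := [/\ forall t, 0 <= t -> Lp (u t),
  forall t, 0 <= t ->
    N (fun x => u s x - u t x) @[s --> within [set s | 0 <= s] (nbhs t)] --> 0 &
  forall t, 0 < t ->
    N (fun x => h^-1 * (u (t + h) x - u t x) - ka * (P (u t) x - u t x))
      @[h --> 0^'] --> 0].

Lemma LpB f g : Lp f -> Lp g -> Lp (fun x => f x - g x).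
Proof.
move=> Lf Lg; have := LpD mG p1 (LpZ mG (-1) Lg) Lf.
by apply: eq_Lp => // x _; rewrite mulN1r addrC.
Qed.

Lemma Lp_normN f : Lp f -> N (fun x => - f x) = N f.
Proof.
move=> Lf; have := Lp_normZ mG p1 (-1) Lf; rewrite normrN1 mul1r => <-.
by apply: eq_Lp_norm => x _; rewrite mulN1r.
Qed.

Lemma Lp_normB f g : Lp f -> Lp g -> N (fun x => f x - g x) <= N f + N g.
Proof.
move=> Lf Lg; rewrite -(Lp_normN Lg).
apply: Lp_normD => //; have := LpZ mG (-1) Lg.
by apply: eq_Lp => // x _; rewrite mulN1r.
Qed.

Lemma near_dnbhs_right_opp (Q : R -> Prop) :
  (\forall h \near 0^', Q h) -> \forall h \near 0^'+, Q (- h).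
Proof.
move=> [e /= e0 H]; exists e => //= h /= he h0; apply: H => /=.
  by move: he; rewrite !sub0r !normrN.
by rewrite oppr_eq0 gt_eqF.
Qed.

(** An implicit Euler step for the difference D of two solutions:
    (1 + ka * h) * D t = D (t - h) + ka * h * P (D t) + o(h). As P contracts the
    norm, the norm of D t exceeds that of D (t - h) by o(h) at most. Looking
    backwards in time makes the terms in ka * h cancel exactly, so that no
    Gronwall argument is needed. *)
Lemma evolution_contraction u1 u2 : evolution u1 -> evolution u2 ->
  forall t, 0 <= t ->
    N (fun x => u1 t x - u2 t x) <= N (fun x => u1 0 x - u2 0 x).
Proof.
move=> [Lu1 c1 d1] [Lu2 c2 d2] tm; rewrite le_eqVlt => /predU1P[<-//|tm0].
pose D t x := u1 t x - u2 t x.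
have LD t : 0 <= t -> Lp (D t) by move=> t0; apply: LpB; [exact: Lu1|exact: Lu2].
pose g t := N (D t); rewrite -/(g tm) -/(g 0).
have dist_g s t : 0 <= s -> 0 <= t ->
    `|g t - g s| <= N (fun x => u1 s x - u1 t x) + N (fun x => u2 s x - u2 t x).
  move=> s0 t0; have Lst := LpB (LD _ s0) (LD _ t0).
  have Nst : N (fun x => D s x - D t x) <=
      N (fun x => u1 s x - u1 t x) + N (fun x => u2 s x - u2 t x).
    have := Lp_normB (LpB (Lu1 _ s0) (Lu1 _ t0)) (LpB (Lu2 _ s0) (Lu2 _ t0)).
    by apply: le_trans; rewrite (@eq_Lp_norm _ _ _ _ _ _ _
      (fun x => u1 s x - u1 t x - (u2 s x - u2 t x)))// => x _; rewrite /D; ring.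
  apply: le_trans Nst; rewrite ler_norml; apply/andP; split.
    rewrite lerBrDl lerBlDl.
    have := Lp_normD mG p1 Lst (LD _ t0).
    by rewrite (@eq_Lp_norm _ _ _ _ _ _ _ (D s))// => x _; rewrite subrK.
  rewrite lerBlDl -lerBlDr lerBlDl addrC.
  have := Lp_normB (LD _ s0) Lst.
  by rewrite (@eq_Lp_norm _ _ _ _ _ _ _ (D t))// => x _; rewrite subKr.
apply: (left_dini_le tm0).
  apply/subspace_continuousP => t; rewrite /= in_itv/= => /andP[t0 tT].
  apply/cvgrPdist_le => e e0; have e20 : 0 < e / 2 by rewrite divr_gt0.
  have /cvgrPdist_le/(_ _ e20) near1 := c1 t t0.
  have /cvgrPdist_le/(_ _ e20) near2 := c2 t t0.
  have {}near1 : \forall s \near t, 0 <= s ->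
      `|0 - N (fun x => u1 s x - u1 t x)| <= e / 2 by exact: near1.
  have {}near2 : \forall s \near t, 0 <= s ->
      `|0 - N (fun x => u2 s x - u2 t x)| <= e / 2 by exact: near2.
  suff : \forall s \near t, `[0, tm]%classic s -> `|g t - g s| <= e by [].
  near=> s; rewrite /= in_itv/= => /andP[s0 _].
  apply: (le_trans (dist_g s t s0 t0)); rewrite (splitr e); apply: lerD.
    apply: le_trans (near near1 s _ s0) => //.
    by rewrite sub0r normrN ler_norm.
  apply: le_trans (near near2 s _ s0) => //.
  by rewrite sub0r normrN ler_norm.
move=> t /andP[t0 tT]; have t0' := ltW t0.
pose r u h x := h^-1 * (u (t + h) x - u t x) - ka * (P (u t) x - u t x) : R.
exists (fun h => N (r u1 (- h)) + N (r u2 (- h))).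
  have cv u : N (r u h) @[h --> 0^'] --> 0 -> N (r u (- h)) @[h --> 0^'+] --> 0.
    move=> c; apply/cvgrPdist_le => e e0.
    have /cvgrPdist_le/(_ _ e0) := c.
    exact: (@near_dnbhs_right_opp (fun h => `|0 - N (r u h)| <= e)).
  rewrite -[X in _ --> X](addr0 0).
  by apply: cvgD; apply: cv; [exact: d1|exact: d2].
near=> h.
have h0 : 0 < h by near: h; exact: nbhs_right_gt.
have ht : h < t by near: h; exact: nbhs_right_lt.
have th0 : 0 <= t - h by rewrite subr_ge0 ltW.
have LP u : Lp (u t) -> Lp (P (u t)).
  by move=> Lu; have [] := Lp_averaging mG finG p1 avgP Lu.
have Lr u : (forall s, 0 <= s -> Lp (u s)) -> Lp (r u (- h)).
  move=> Lu; have Lt := Lu t t0'; have Lth := Lu _ th0.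
  exact: (LpB (LpZ mG (- h)^-1 (LpB Lth Lt)) (LpZ mG ka (LpB (LP u Lt) Lt))).
have LDt := LD t t0'; have LDth := LD _ th0.
have [LPD PD] := Lp_averaging mG finG p1 avgP LDt.
have Lr1 := Lr u1 Lu1; have Lr2 := Lr u2 Lu2.
have step : (1 + ka * h) * g t <=
    g (t - h) + ka * h * g t + h * (N (r u1 (- h)) + N (r u2 (- h))).
  have kh0 : 0 <= ka * h by rewrite mulr_ge0// ltW.
  rewrite -[1 + ka * h]ger0_norm ?addr_ge0// -(Lp_normZ mG p1 _ LDt).
  have Lr12 := LpB Lr1 Lr2.
  rewrite (@eq_Lp_norm _ _ _ _ _ _ _ (fun x => D (t - h) x + ka * h * P (D t) x +
    h * (r u1 (- h) x - r u2 (- h) x))); last first.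
    move=> x Gx; rewrite (averagingB mG avgP) ?(Lp_integrable mG finG p1)//; last 2 first.
    - exact: Lu1.
    - exact: Lu2.
    rewrite /r /D invrN; field; rewrite gt_eqF//.
  have LkP := LpZ mG (ka * h) LPD; have Lhr := LpZ mG h Lr12.
  have A1 := Lp_normD mG p1 LDth LkP.
  have A2 := Lp_normD mG p1 (LpD mG p1 LDth LkP) Lhr.
  have A3 : N (fun x => ka * h * P (D t) x) <= ka * h * g t.
    rewrite (Lp_normZ mG p1 (ka * h) LPD) (ger0_norm kh0).
    exact: (ler_wpM2l kh0 PD).
  have A4 : N (fun x => h * (r u1 (- h) x - r u2 (- h) x)) <=
      h * (N (r u1 (- h)) + N (r u2 (- h))).
    rewrite (Lp_normZ mG p1 h Lr12) (gtr0_norm h0).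
    exact: (ler_wpM2l (ltW h0) (Lp_normB Lr1 Lr2)).
  exact: (le_trans A2 (lerD (le_trans A1 (lerD (lexx _) A3)) A4)).
by move: step; rewrite mulrDl mul1r [leRHS]addrAC lerD2r.
Unshelve. all: by end_near. Qed.

Lemma evolution_unique u1 u2 : evolution u1 -> evolution u2 ->
  {ae mu, forall x, G x -> u1 0 x = u2 0 x} ->
  forall t, 0 <= t -> {ae mu, forall x, G x -> u1 t x = u2 t x}.
Proof.
move=> E1 E2 u0 t t0; have [Lu1 _ _] := E1; have [Lu2 _ _] := E2.
have LD s : 0 <= s -> Lp (fun x => u1 s x - u2 s x).
  by move=> s0; apply: LpB; [exact: Lu1|exact: Lu2].
have N0 : N (fun x => u1 0 x - u2 0 x) = 0.
  rewrite /Lp_norm (@eq_Rintegral_ae _ _ _ mu G mG _ (cst 0)).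
  - by rewrite Rintegral_cst// mul0r powR0// invr_eq0 gt_eqF// (lt_le_trans ltr01).
  - by have [] := LD 0 (lexx _) => mf _; exact: measurable_fun_norm_powR.
  - exact: measurable_cst.
  - apply: filterS u0 => x ux Gx; rewrite ux// subrr normr0 powR0//.
    by rewrite gt_eqF// (lt_le_trans ltr01).
have := evolution_contraction E1 E2 t0; rewrite N0 => Nle.
have Nt : N (fun x => u1 t x - u2 t x) = 0.
  by apply/eqP; rewrite eq_le Nle Lp_norm_ge0.
have := Lp_norm_eq0 mG (LD t t0) Nt.
by apply: filterS => x ux Gx; apply/eqP; rewrite -subr_eq0 ux.
Qed.

End evolution_uniqueness.

(** * The semigroup solves the evolution equation *)

Section semigroup_evolution.
Context d (T : measurableType d) (R : realType).
Variables (mu : {measure set T -> \bar R}) (G : set T) (p : R).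
Hypotheses (mG : measurable G) (finG : (mu G < +oo)%E) (p1 : 1 <= p).
Variables (P : (T -> R) -> T -> R) (b ka : R).
Local Notation L1 f := (mu.-integrable G (EFin \o f)).
Hypotheses (avgP : averaging mu G P) (b0 : 0 <= b)
  (Pbd : forall g, L1 g -> forall x, G x ->
    `|P g x| <= `|g x| + b * \int[mu]_(y in G) `|g y|)
  (ka0 : 0 < ka).

Local Notation sg := (semigroup P ka).
Local Notation W u := (envelope mu G b u).

(** The pointwise Lipschitz and Taylor estimates hold relative to the envelope,
    which lies in L^p with u; integrating them yields continuity and
    differentiability in norm. *)
Lemma semigroup_evolution (u : T -> R) : Lp mu G p u ->
  evolution mu G p P ka (sg u).
Proof.
move=> Lu; have Iu := Lp_integrable mG finG p1 Lu.
have LW : Lp mu G p (W u).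
  have Lnu : Lp mu G p (fun x => `|u x|).
    apply: (Lp_dominated mG p1 _ _ Lu); last by move=> x _; rewrite normr_id.
    by apply: measurableT_comp => //; case: Lu.
  exact: (eq_Lp mG _
    (LpD mG p1 Lnu (Lp_cst p mG finG (b * \int[mu]_(y in G) `|u y|)))).
have Lsg t : Lp mu G p (sg u t).
  apply: (Lp_dominated mG p1 _ _ (LpZ mG (expR (3 * (ka * `|t|))) LW)).
    exact: integrable_measurable_fun (semigroup_integrable mG finG avgP b0 Pbd ka0 t Iu).
  move=> x Gx; rewrite [leRHS]ger0_norm; last first.
    by rewrite mulr_ge0 ?expR_ge0// envelope_ge0.
  exact: (semigroup_bound mG finG avgP b0 Pbd ka0 Iu Gx).
have normW K f : 0 <= K -> Lp mu G p f -> (forall x, G x -> `|f x| <= K * W u x) ->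
    Lp_norm mu G p f <= K * Lp_norm mu G p (W u).
  move=> K0 Lf fK.
  have := Lp_normZ mG p1 K LW; rewrite (ger0_norm K0) => <-.
  apply: (Lp_norm_le mG p1 Lf (LpZ mG K LW)) => x Gx.
  by rewrite [leRHS]ger0_norm ?fK// mulr_ge0// envelope_ge0.
have cvg_lin K c (t : R) : (fun s => K * `|s - t| * c) @ t --> 0.
  have : (fun s => K * `|s - t| * c) @ t --> K * `|t - t| * c.
    apply: cvgMl; apply: cvgMr; apply: cvg_norm.
    by apply: cvgB; [exact: cvg_id|exact: cvg_cst].
  by rewrite subrr normr0 mulr0 mul0r.
split=> [t _|t t0|t t0].
- exact: Lsg.
- pose K := 3 * expR (3 * (ka * (`|t| + 1))) * ka.
  have K0 : 0 <= K by rewrite !mulr_ge0 ?expR_ge0// ltW.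
  apply: (@squeeze_cvgr _ _ _ _ (cst 0) (fun s => K * `|s - t| * Lp_norm mu G p (W u))).
  + apply: cvg_within; near=> s; apply/andP; split; first exact: Lp_norm_ge0.
    apply: normW; [by rewrite mulr_ge0|exact: LpB|].
    move=> x Gx; apply: (semigroup_lipschitz mG finG avgP b0 Pbd ka0 Iu Gx).
      by rewrite lerDl.
    near: s; exists 1 => //= s; rewrite /= distrC => st.
    rewrite -[X in `|X|](subrK t) addrC (le_trans (ler_normD _ _))// lerD2l.
    exact: ltW.
  + exact: cvg_cst.
  + by apply: cvg_within_filter; exact: cvg_lin.
- pose K := 9 * expR (3 * (ka * (`|t| + 1))) * ka ^+ 2.
  have K0 : 0 <= K by rewrite !mulr_ge0 ?expR_ge0 ?exprn_ge0// ltW.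
  apply: (@squeeze_cvgr _ _ _ _ (cst 0) (fun h => K * `|h - 0| * Lp_norm mu G p (W u))).
  + near=> h; apply/andP; split; first exact: Lp_norm_ge0.
    have h0 : h != 0 by near: h; exact: nbhs_dnbhs_neq.
    have h1 : `|h| < 1.
      by near: h; exists 1 => //= z; rewrite /= sub0r normrN.
    have [LP _] := Lp_averaging mG finG p1 avgP (Lsg t).
    apply: normW; first by rewrite mulr_ge0.
      exact: (LpB mG p1 (LpZ mG h^-1 (LpB mG p1 (Lsg (t + h)) (Lsg t)))
        (LpZ mG ka (LpB mG p1 LP (Lsg t)))).
    move=> x Gx.
    have := @semigroup_taylor _ _ _ _ _ mG finG _ _ _ avgP b0 Pbd ka0
      u t (t + h) (`|t| + 1) x Iu Gx.
    have -> : t + h - t = h by ring.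
    have tM : `|t| <= `|t| + 1 by rewrite lerDl.
    have thM : `|t + h| <= `|t| + 1.
      by rewrite (le_trans (ler_normD _ _))// lerD2l ltW.
    move=> /(_ tM thM).
    have hh : 0 < `|h| by rewrite normr_gt0.
    move=> le1; rewrite -(ler_pM2l hh) -normrM subr0.
    have -> : h * (h^-1 * (sg u (t + h) x - sg u t x) - ka * (P (sg u t) x - sg u t x))
       = sg u (t + h) x - sg u t x - h * (ka * (P (sg u t) x - sg u t x)).
      by field.
    apply: (le_trans le1); rewrite /K.
    by rewrite le_eqVlt; apply/orP; left; apply/eqP; ring.
  + exact: cvg_cst.
  + by apply: cvg_within_filter; exact: cvg_lin.
Unshelve. all: by end_near. Qed.

End semigroup_evolution.

(** * The lazy step of a bounded symmetric kernel *)

Section bounded_symmetric_kernel.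
Context d (T : measurableType d) (R : realType).
Variables (mu : {sigma_finite_measure set T -> \bar R}) (D : set T).
Hypotheses (mD : measurable D) (finD : (mu D < +oo)%E).
Variables (k : T -> T -> R) (b : R).
Hypotheses (mk : measurable_fun setT (fun z : T * T => k z.1 z.2))
  (k_ge0 : forall x y, 0 <= k x y) (k_le : forall x y, k x y <= b)
  (k_sym : forall x y, k x y = k y x).
Implicit Types (f g : T -> R).

Local Notation L1 f := (mu.-integrable D (EFin \o f)).
Local Notation Int f := (\int[mu]_(x in D) f x).

Definition kernel_op g x := \int[mu]_(y in D) (k x y * g y).

Lemma kernel_bound_ge0 : T -> 0 <= b.
Proof. by move=> x; exact: le_trans (k_le x x). Qed.

Lemma measurable_kernel_slice x A : measurable_fun A (k x).
Proof.
apply/measurable_funTS.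
rewrite (_ : k x = (fun z : T * T => k z.1 z.2) \o pair x)//.
by apply: measurableT_comp => //; exact: measurable_pair1.
Qed.

Lemma kernel_slice_integrable x g : L1 g -> L1 (fun y => k x y * g y).
Proof.
move=> Ig.
have Ibg : L1 (fun y => b * `|g y|).
  exact: (integrableZl mD b (integrable_norm Ig)).
apply: (integrable_dominated mD _ _ Ibg).
  apply: measurable_funM; first exact: measurable_kernel_slice.
  exact: integrable_measurable_fun Ig.
by move=> y _; rewrite normrM ger0_norm// ler_wpM2r.
Qed.

Lemma kernel_op_lin a f g x : L1 f -> L1 g ->
  kernel_op (fun y => a * f y + g y) x = a * kernel_op f x + kernel_op g x.
Proof.
move=> If Ig; rewrite /kernel_op -Rintegral_lin//; last 2 first.
- exact: kernel_slice_integrable.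
- exact: kernel_slice_integrable.
by apply: eq_Rintegral => y _; ring.
Qed.

Lemma kernel_op_ge0 g x : (forall y, D y -> 0 <= g y) -> 0 <= kernel_op g x.
Proof. by move=> g0; apply: Rintegral_ge0 => y Dy; rewrite mulr_ge0// g0. Qed.

Lemma kernel_op_bound g x : L1 g ->
  `|kernel_op g x| <= b * Int (fun y => `|g y|).
Proof.
move=> Ig; apply: le_trans (le_normr_Rintegral mD (kernel_slice_integrable x Ig)) _.
have Ing := integrable_norm Ig.
rewrite -RintegralZl//; apply: le_Rintegral => //.
- exact: integrable_norm (kernel_slice_integrable x Ig).
- exact: (integrableZl mD b Ing).
- by move=> y _; rewrite normrM ger0_norm// ler_wpM2r.
Qed.

(** The integrand cut off to D in both variables: Fubini's theorem on the whole
    product then computes integrals over D. *)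
Let F g (z : T * T) : \bar R := (\1_D z.1 * (k z.1 z.2 * (g \_ D) z.2))%:E.

Let mF g : L1 g -> measurable_fun setT (F g).
Proof.
move=> Ig; apply/measurable_EFinP; apply: measurable_funM.
  by apply: (measurableT_comp (measurable_indic mD)); exact: measurable_fst.
apply: measurable_funM => //.
apply: (measurableT_comp _ (@measurable_snd _ _ T T)).
by apply/(measurable_restrictT _ mD); exact: integrable_measurable_fun Ig.
Qed.

Let F1E g x : L1 g ->
  (\int[mu]_y F g (x, y) = (\1_D x * kernel_op g x)%:E)%E.
Proof.
move=> Ig; rewrite EFinM /kernel_op /Rintegral fineK; last first.
  exact: integrable_fin_num (kernel_slice_integrable x Ig).
rewrite -integralZl//; last exact: kernel_slice_integrable.
rewrite [RHS]integral_mkcond; apply: eq_integral => y _ /=.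
rewrite /F /= !patchE; case: ifP => _ //.
by rewrite !mulr0.
Qed.

Let F2E g y : L1 g ->
  (\int[mu]_x F g (x, y) = ((fun y => g y * kernel_op (cst 1) y) \_ D y)%:E)%E.
Proof.
move=> Ig; have I1 : L1 (cst 1) by exact: integrable_finite_cst.
rewrite patchE; case: ifPn => yD; last first.
  rewrite (@integral0_eq _ _ _ mu)// => x _.
  by rewrite /F /= patchE (negbTE yD) !mulr0.
rewrite EFinM /kernel_op /Rintegral fineK; last first.
  exact: integrable_fin_num (kernel_slice_integrable y I1).
rewrite -integralZl//; last exact: kernel_slice_integrable.
rewrite [RHS]integral_mkcond; apply: eq_integral => x _ /=.
rewrite /F /= !patchE yD indicE; case: ifP => _ //=.
  by rewrite mul1r mulr1 k_sym mulrC.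
by rewrite mul0r.
Qed.

Let IF g : L1 g -> (mu \x mu)%E.-integrable setT (F g).
Proof.
move=> Ig; apply/(integrable12ltyP _ _ (mF Ig)).
pose ng : T -> R := fun y => `|g y|.
have Ing : L1 ng := integrable_norm Ig.
have -> : (\int[mu]_x \int[mu]_y `|F g (x, y)| =
    \int[mu]_x (\1_D x * kernel_op ng x)%:E)%E.
  apply: eq_integral => x _; rewrite -F1E//; apply: eq_integral => y _.
  rewrite /F /= !normrM (ger0_norm (k_ge0 _ _)) ger0_norm// !patchE.
  by case: ifP => // _; rewrite [`|_|]normr0.
have mK : measurable_fun setT (fun x => (\1_D x * kernel_op ng x)%:E).
  rewrite (_ : (fun x => _) = fubini_F mu (F ng)).
    apply: measurable_fun_fubini_tonelli_F; first exact: mF.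
    move=> z; rewrite lee_fin !mulr_ge0// patchE; case: ifP => //=.
    by rewrite normr_ge0.
  by apply/funext => x; rewrite /fubini_F F1E.
apply: (@le_lt_trans _ _ (\int[mu]_(x in D) (b * Int ng)%:E)%E);
  last first.
  rewrite integral_cst// lte_mul_pinfty// lee_fin.
  have [->|/set0P[x _]] := eqVneq D set0; first by rewrite Rintegral_set0 mulr0.
  apply: mulr_ge0; first exact: kernel_bound_ge0 x.
  by apply: Rintegral_ge0 => y _; exact: normr_ge0.
rewrite [leRHS]integral_mkcond; apply: ge0_le_integral => //.
- move=> x _; rewrite lee_fin mulr_ge0//; apply: kernel_op_ge0 => y _.
  exact: normr_ge0.
- apply/(measurable_restrictT _ mD); exact: measurable_cst.
- move=> x _; rewrite patchE indicE; case: ifP => _ /=; last by rewrite mul0r.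
  rewrite mul1r lee_fin (le_trans (ler_norm _))//.
  apply: (le_trans (kernel_op_bound x Ing)).
  have -> // : Int (fun y => `|ng y|) = Int ng.
  by apply: eq_Rintegral => y _; exact: normr_id.
Qed.

Lemma kernel_op_integrable g : L1 g -> L1 (kernel_op g).
Proof.
move=> Ig; have := integrable_fubini_F (IF Ig).
rewrite (_ : fubini_F _ _ = fun x => (\1_D x * kernel_op g x)%:E); last first.
  by apply/funext => x; rewrite /fubini_F F1E.
move=> /(integrableS measurableT mD (@subsetT _ _)).
apply: eq_integrable => // x xD /=.
by rewrite indicE xD mul1r.
Qed.

(** Fubini's theorem and the symmetry of k. *)
Lemma Rintegral_kernel_op g : L1 g ->
  Int (kernel_op g) = Int (fun y => g y * kernel_op (cst 1) y).
Proof.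
move=> Ig; rewrite /Rintegral; congr fine.
transitivity (\int[mu]_x \int[mu]_y F g (x, y))%E.
  rewrite [LHS]integral_mkcond; apply: eq_integral => x _.
  rewrite F1E// patchE indicE; case: ifP => _ /=; first by rewrite mul1r.
  by rewrite mul0r.
rewrite (Fubini (IF Ig)) [RHS]integral_mkcond; apply: eq_integral => y _.
by rewrite F2E// !patchE; case: ifP.
Qed.

Variable c : R.
Hypotheses (c0 : 0 <= c) (cb : c * (b * fine (mu D)) <= 2^-1).

(** One step of the walk with jump rates k, slowed down by c so that it stays put
    with probability at least one half. *)
Definition lazy_step g x := g x + c * (kernel_op g x - kernel_op (cst 1) x * g x).

Let I1 a : L1 (cst a). Proof. exact: integrable_finite_cst. Qed.

Lemma kernel_degree_le x : `|kernel_op (cst 1) x| <= b * fine (mu D).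
Proof.
apply: (le_trans (kernel_op_bound x (I1 1))).
rewrite ler_wpM2l ?(kernel_bound_ge0 x)//.
have -> // : Int (fun=> `|1|) = fine (mu D).
rewrite -[RHS]mul1r -Rintegral_cst//; apply: eq_Rintegral => y _.
by rewrite normr1.
Qed.

Lemma kernel_degree_bound x : 0 <= c * kernel_op (cst 1) x <= 2^-1.
Proof.
rewrite mulr_ge0 ?kernel_op_ge0//=; apply: le_trans cb.
by rewrite ler_wpM2l// (le_trans (ler_norm _))// kernel_degree_le.
Qed.

Lemma kernel_degree_mul_integrable g : L1 g ->
  L1 (fun x => kernel_op (cst 1) x * g x).
Proof.
move=> Ig; have Ing := integrableZl mD (b * fine (mu D)) (integrable_norm Ig).
apply: (integrable_dominated mD _ _ Ing).
  apply: measurable_funM; last exact: integrable_measurable_fun Ig.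
  exact: integrable_measurable_fun (kernel_op_integrable (I1 1)).
by move=> x Dx /=; rewrite normrM ler_wpM2r// kernel_degree_le.
Qed.

Lemma lazy_step_integrable g : L1 g -> L1 (lazy_step g).
Proof.
move=> Ig; have I2 := kernel_degree_mul_integrable Ig.
have I3 := integrable_lin mD (-1) I2 (kernel_op_integrable Ig).
apply: (integrable_eq_in mD _ (integrable_lin mD c I3 Ig)) => x _.
by rewrite /lazy_step; ring.
Qed.

Lemma lazy_step_ge_half g : L1 g -> (forall x, D x -> 0 <= g x) ->
  forall x, D x -> 2^-1 * g x + c * kernel_op g x <= lazy_step g x.
Proof.
move=> Ig g0 x Dx; rewrite /lazy_step.
have := g0 x Dx; have /andP[] := kernel_degree_bound x.
move: (kernel_op (cst 1) x) (kernel_op g x) (g x) => u v w cu0 cu1 w0.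
have : 0 <= (2^-1 - c * u) * w by apply: mulr_ge0; rewrite ?subr_ge0.
lra.
Qed.

(** Preservation of the integral is the symmetry of k, through
    [Rintegral_kernel_op]. *)
Lemma lazy_step_averaging : averaging mu D lazy_step.
Proof.
split.
- exact: lazy_step_integrable.
- by move=> a f g If Ig x Dx; rewrite /lazy_step kernel_op_lin//; ring.
- move=> g Ig g0 x Dx; apply: le_trans (lazy_step_ge_half Ig g0 Dx).
  by rewrite addr_ge0 ?mulr_ge0 ?g0 ?kernel_op_ge0// invr_ge0.
- by move=> x Dx; rewrite /lazy_step mulr1 subrr mulr0 addr0.
- move=> g Ig; have I3 := lazy_step_integrable Ig.
  have I2 := kernel_degree_mul_integrable Ig.
  have IK := kernel_op_integrable Ig.
  have I4 := integrable_lin mD (-1) I2 IK.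
  rewrite /lazy_step.
  transitivity (Int (fun x =>
      c * (-1 * (kernel_op (cst 1) x * g x) + kernel_op g x) + g x)).
    by apply: eq_Rintegral => x _; ring.
  rewrite (Rintegral_lin mD c I4 Ig) (Rintegral_lin mD (-1) I2 IK).
  rewrite Rintegral_kernel_op//.
  have -> : Int (fun y => g y * kernel_op (cst 1) y) =
            Int (fun y => kernel_op (cst 1) y * g y).
    by apply: eq_Rintegral => x _; rewrite mulrC.
  by rewrite mulN1r addNr mulr0 add0r.
Qed.

Lemma lazy_step_bound g : L1 g -> forall x, D x ->
  `|lazy_step g x| <= `|g x| + c * b * Int (fun y => `|g y|).
Proof.
move=> Ig x Dx.
have -> : lazy_step g x = (1 - c * kernel_op (cst 1) x) * g x + c * kernel_op g x.
  by rewrite /lazy_step; ring.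
apply: (le_trans (ler_normD _ _)); rewrite !normrM.
have /andP[u0 u1] := kernel_degree_bound x.
apply: lerD.
  rewrite ger0_norm ?subr_ge0; last by apply: le_trans u1 _; lra.
  by rewrite ler_piMl// lerBlDr lerDl.
by rewrite (ger0_norm c0) -mulrA ler_wpM2l// kernel_op_bound.
Qed.

Section chain_of_sets.
Variables (I : finType) (B : I -> set T) (j0 : R).
Hypotheses (c_gt0 : 0 < c) (j0_gt0 : 0 < j0)
  (mB : forall i, measurable (B i)) (DB : D `<=` \bigcup_i B i)
  (kB : forall i x y, B i x -> B i y -> j0 <= k x y).

Let overlap : rel I := fun i j => `[< (0 < mu (D `&` (B i `&` B j)))%E >].

Hypothesis chain : forall i j, D `&` B i !=set0 -> D `&` B j !=set0 ->
  connect overlap i j.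

Let mDB i : measurable (D `&` B i). Proof. exact: measurableI. Qed.

Let mDBB i j : measurable (D `&` (B i `&` B j)).
Proof. by apply: measurableI => //; exact: measurableI. Qed.

Let overlap_bound : exists2 ov : R, 0 < ov &
  forall i j, overlap i j -> ov <= fine (mu (D `&` (B i `&` B j))).
Proof.
exists (\big[Num.min/1]_(p : I * I | overlap p.1 p.2)
  fine (mu (D `&` (B p.1 `&` B p.2)))); last first.
  by move=> i j ij; exact: (bigmin_le_cond _ (j := (i, j))).
apply: lt_bigmin => // -[i j] /= /asboolP ij.
rewrite fine_gt0// ij/=; apply: le_lt_trans finD.
by apply: le_measure; rewrite ?inE.
Qed.

Let kernel_op_ge h x A e : measurable A -> A `<=` D -> L1 h ->
  (forall y, D y -> 0 <= h y) -> (forall y, A y -> j0 <= k x y) ->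
  0 <= e -> \int[mu]_(y in A) h y >= e -> j0 * e <= kernel_op h x.
Proof.
move=> mA AD Ih h0 kA e0 eA; have IhA := integrableS mD mA AD Ih.
apply: (@le_trans _ _ (\int[mu]_(y in A) (k x y * h y))); last first.
  apply: Rintegral_subset_le => //; first exact: kernel_slice_integrable.
  by move=> y Dy; rewrite mulr_ge0// h0.
apply: (@le_trans _ _ (\int[mu]_(y in A) (j0 * h y))).
  by rewrite RintegralZl// ler_wpM2l// ltW.
apply: le_Rintegral => //.
- exact: (integrableZl mA j0 IhA).
- exact: integrableS (kernel_slice_integrable x Ih).
- by move=> y Ay; rewrite ler_wpM2r ?kA ?h0//; exact: AD.
Qed.

(** Mass lying in B i spreads over all of B i in one step, then passes from one
    set to an overlapping one at the cost of a factor q per step. A path without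
    repetitions has at most n = #|I| steps; laziness lets the walk wait in the
    last set until time n + 1 exactly. Summing over the starting sets i recovers
    the whole mass of g, and the division by n + 1 makes up for the number of
    sets. *)
Lemma lazy_step_minorized : exists m de, [/\ (0 < m)%N, 0 < de &
  forall g, L1 g -> (forall x, D x -> 0 <= g x) ->
    forall x, D x -> de * Int g <= iter m lazy_step g x].
Proof.
have [ov ov0 ovP] := overlap_bound.
(* 1/2 is the cost of waiting, c * j0 * ov that of a move to an overlapping set *)
pose q := Num.min 2^-1 (c * (j0 * ov)).
have q0 : 0 < q by rewrite lt_min invr_gt0 ltr0n/= !mulr_gt0.
have q2 : q <= 2^-1 by rewrite ge_min lexx.
have qo : q <= c * (j0 * ov) by rewrite ge_min lexx orbT.
pose n := #|I|.
exists n.+1, (c * j0 * q ^+ n / n.+1%:R); split => //.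
  by rewrite divr_gt0 ?ltr0n// !mulr_gt0// exprn_gt0.
move=> g Ig g0 x Dx.
have avg j := averaging_iter mD finD j lazy_step_averaging.
have Igk j : L1 (iter j lazy_step g) by exact: (averaging_integrable (avg j)).
have gk0 j y : D y -> 0 <= iter j lazy_step g y.
  by move=> Dy; apply: (averaging_ge0 (avg j)).
have K0 h y : L1 h -> (forall z, D z -> 0 <= h z) -> 0 <= c * kernel_op h y.
  by move=> Ih h0; rewrite mulr_ge0// kernel_op_ge0.
have stay j e i : 0 <= e -> (forall y, D y -> B i y -> e <= iter j lazy_step g y) ->
    forall y, D y -> B i y -> q * e <= iter j.+1 lazy_step g y.
  move=> e0 ge y Dy By /=.
  apply: le_trans (lazy_step_ge_half (Igk j) (gk0 j) Dy).
  apply: (@le_trans _ _ (2^-1 * iter j lazy_step g y)).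
    by apply: ler_pM => //; [exact: ltW|exact: ge].
  by rewrite lerDl K0//; exact: gk0.
have hop j e i i' : 0 <= e -> overlap i i' ->
    (forall y, D y -> B i y -> e <= iter j lazy_step g y) ->
    forall y, D y -> B i' y -> q * e <= iter j.+1 lazy_step g y.
  move=> e0 ii' ge y Dy By /=.
  apply: le_trans (lazy_step_ge_half (Igk j) (gk0 j) Dy).
  apply: (@le_trans _ _ (c * kernel_op (iter j lazy_step g) y)); last first.
    by rewrite lerDr mulr_ge0 ?invr_ge0// gk0.
  apply: (@le_trans _ _ (c * (j0 * (e * ov)))).
    have -> : c * (j0 * (e * ov)) = c * (j0 * ov) * e by ring.
    by rewrite ler_wpM2r.
  rewrite ler_wpM2l//.
  apply: (@kernel_op_ge _ _ (D `&` (B i `&` B i'))) => //.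
  - exact: gk0.
  - by move=> z [_ [_ Bz]]; exact: kB By Bz.
  - by rewrite mulr_ge0// ltW.
  apply: (@le_trans _ _ (e * fine (mu (D `&` (B i `&` B i'))))).
    by rewrite ler_wpM2l// ovP.
  rewrite -Rintegral_cst//; apply: le_Rintegral => //.
  - by apply: integrableS (I1 e).
  - by apply: integrableS (Igk j).
  - by move=> z [Dz [Bz _]]; exact: ge.
have first_ i y : D y -> B i y ->
    c * (j0 * \int[mu]_(z in D `&` B i) g z) <= iter 1 lazy_step g y.
  move=> Dy By; apply: le_trans (lazy_step_ge_half Ig g0 Dy).
  apply: (@le_trans _ _ (c * kernel_op g y)); last first.
    by rewrite lerDr mulr_ge0 ?invr_ge0// g0.
  rewrite ler_wpM2l//; apply: (@kernel_op_ge _ _ (D `&` B i)) => //.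
  - by move=> z [_ Bz]; exact: kB By Bz.
  - by apply: Rintegral_ge0 => z [Dz _]; exact: g0.
pose e0 i := c * (j0 * \int[mu]_(z in D `&` B i) g z).
have e0_ge0 i : 0 <= e0 i.
  by rewrite !mulr_ge0 ?(ltW j0_gt0)// Rintegral_ge0// => z [Dz _]; exact: g0.
have walk i p : path overlap i p -> forall y, D y -> B (last i p) y ->
    q ^+ size p * e0 i <= iter (size p).+1 lazy_step g y.
  elim/last_ind: p => [_|p j ih]; first by rewrite mul1r; exact: first_.
  rewrite rcons_path last_rcons size_rcons => /andP[ip pj] y Dy By.
  rewrite exprS -mulrA; apply: (hop _ _ _ _ _ pj (ih ip)) => //.
  by rewrite mulr_ge0// exprn_ge0// ltW.
have from_set i : e0 i * q ^+ n <= iter n.+1 lazy_step g x.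
  have [DBi|] := pselect (D `&` B i !=set0); last first.
    move=> /set0P/negP/negPn/eqP DBi; rewrite /e0 DBi Rintegral_set0 !mulr0 mul0r.
    exact: gk0.
  have [j _ Bjx] := DB Dx.
  have /connectP[p0 ip0 ej] : connect overlap i j by apply: chain => //; exists x.
  move: Bjx; rewrite ej; case/shortenP: ip0 => p ip up _ Bx.
  have pn : (size p <= n)%N.
    rewrite -ltnS; apply: leqW; rewrite /n.
    by have /card_uniqP /= <- := up; exact: max_card.
  have linger l y : D y -> B (last i p) y ->
      q ^+ l * (q ^+ size p * e0 i) <= iter (l + (size p).+1) lazy_step g y.
    elim: l y => [|l ih] y Dy By; first by rewrite mul1r add0n; exact: walk.
    rewrite exprS -mulrA addSn; apply: (stay _ _ _ _ ih) => //.
    by apply: mulr_ge0; [|apply: mulr_ge0]; rewrite ?exprn_ge0 ?(ltW q0).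
  have := linger (n - size p)%N x Dx Bx.
  by rewrite addnS subnK// mulrA -exprD subnK// mulrC.
have cover : Int g <= \sum_(i : I) \int[mu]_(z in D `&` B i) g z.
  pose gi i := g \_ (B i).
  have Igi i : L1 (gi i).
    have : L1 ((\1_(B i) : T -> R) \* g).
      apply: (integrable_dominated mD _ _ (integrable_norm Ig)).
        apply: measurable_funM; first exact: measurable_funTS (measurable_indic _).
        exact: integrable_measurable_fun Ig.
      move=> y _; rewrite /= normrM ler_piMl// indicE.
      by case: (y \in B i); rewrite ?normr1 ?normr0.
    apply: integrable_eq_in => // y _; rewrite /gi patchE /= indicE.
    by case: ifP => _; rewrite ?mul1r ?mul0r.
  have sumE (s : seq I) : L1 (fun z => \sum_(i <- s) gi i z) /\
      \sum_(i <- s) \int[mu]_(z in D `&` B i) g z = Int (fun z => \sum_(i <- s) gi i z).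
    elim: s => [|i s [ih1 ih2]].
      split; first by apply: (integrable_eq_in mD _ (I1 0)) => y _; rewrite big_nil.
      rewrite big_nil (_ : (fun z => _) = cst 0) ?Rintegral_cst ?mul0r//.
      by apply/funext => y; rewrite big_nil.
    have E y : 1 * gi i y + \sum_(i <- s) gi i y = \sum_(i <- i :: s) gi i y.
      by rewrite mul1r big_cons.
    have H := integrable_lin mD 1 (Igi i) ih1.
    split; first by apply: (integrable_eq_in mD _ H) => y _; exact: E.
    rewrite big_cons ih2 Rintegral_mkcondr -/(gi i) -[X in X + _ = _]mul1r.
    rewrite -(Rintegral_lin mD 1 (Igi i) ih1).
    by apply: eq_Rintegral => y _; rewrite E.
  have [Is ->] := sumE (index_enum I).
  apply: le_Rintegral => // y Dy; have [i _ By] := DB Dy.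
  rewrite (bigD1 i)//= {1}/gi patchE mem_set// lerDl sumr_ge0// => j _.
  by rewrite /gi patchE; case: ifP => // _; exact: g0.
apply: (@le_trans _ _ (c * j0 * q ^+ n / n.+1%:R *
    \sum_(i : I) \int[mu]_(z in D `&` B i) g z)).
  by rewrite ler_wpM2l// divr_ge0// !mulr_ge0 ?exprn_ge0 ?ltW.
rewrite mulr_sumr.
apply: (@le_trans _ _ (\sum_(i : I) (iter n.+1 lazy_step g x / n.+1%:R))).
  apply: ler_sum => i _; rewrite mulrAC ler_wpM2r// ?invr_ge0//.
  by apply: le_trans (from_set i); rewrite /e0 -!mulrA [q ^+ n * _]mulrC.
rewrite sumr_const -[leLHS]mulr_natr -mulrA ler_piMr//; first exact: gk0.
by rewrite mulrC ler_pdivrMr ?ltr0n// mul1r ler_nat.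
Qed.

End chain_of_sets.

End bounded_symmetric_kernel.

(** * Harmonic extension and the operator induced on a subset *)

Section harmonic_extension.
Context d (T : measurableType d) (R : realType).
Variables (mu : {measure set T -> \bar R}) (D G : set T).
Hypotheses (mD : measurable D) (finD : (mu D < +oo)%E).
Hypotheses (mG : measurable G) (GD : G `<=` D) (G0 : (0 < mu G)%E).
Variables (S : (T -> R) -> T -> R) (be de : R) (m : nat).
Implicit Types (f g : T -> R).

Local Notation I := (D `\` G).
Local Notation L1 A f := (mu.-integrable A (EFin \o f)).
Local Notation Int A f := (\int[mu]_(x in A) f x).

Hypotheses (avgS : averaging mu D S)
  (be0 : 0 <= be)
  (Sbd : forall g, L1 D g -> forall x, D x ->
    `|S g x| <= `|g x| + be * Int D (fun y => `|g y|))
  (Shalf : forall g, L1 D g -> (forall x, D x -> 0 <= g x) ->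
    forall x, D x -> 2^-1 * g x <= S g x)
  (m0 : (0 < m)%N) (de0 : 0 < de) (de1 : de * fine (mu D) < 1)
  (Smin : forall g, L1 D g -> (forall x, D x -> 0 <= g x) ->
    forall x, D x -> de * Int D g <= iter m S g x).

Let mI : measurable I. Proof. exact: measurableD. Qed.

Let muGD : (mu G <= mu D)%E.
Proof. by apply: le_measure => //; rewrite inE. Qed.

Let finG : (mu G < +oo)%E. Proof. exact: le_lt_trans finD. Qed.

Let muG_gt0 : 0 < fine (mu G). Proof. by rewrite fine_gt0// G0. Qed.

Let I1 a : L1 D (cst a). Proof. exact: integrable_finite_cst. Qed.

Let th : R := 1 - de * fine (mu G).

Let th01 : 0 < th < 1.
Proof.
rewrite /th subr_gt0 gtrBl mulr_gt0// andbT; apply: le_lt_trans de1.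
by rewrite ler_wpM2l ?(ltW de0)// fine_le// ge0_fin_numE.
Qed.

Lemma iter_integrable k g : L1 D g -> L1 D (iter k S g).
Proof. by move=> Ig; exact: (averaging_integrable (averaging_iter mD finD k avgS)). Qed.

Let oneG : T -> R := \1_G.

Let IG : L1 D oneG.
Proof.
have : L1 D ((fun=> 1 : R) \_ G).
  by apply: integrable_restrict_sub => //; exact: integrable_finite_cst.
apply: integrable_eq_in => // x _.
by rewrite /oneG indicE patchE; case: ifP.
Qed.

Let S1G x : D x -> de * fine (mu G) <= iter m S oneG x.
Proof.
move=> Dx; apply: le_trans (Smin IG _ Dx) => [|y _]; last first.
  by rewrite /oneG indicE.
rewrite le_eqVlt; apply/orP; left; apply/eqP; congr (_ * _).
rewrite -[LHS]mul1r -Rintegral_cst// [LHS]Rintegral_mkcond [RHS]Rintegral_mkcond.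
apply: eq_Rintegral => y _; rewrite !patchE /oneG indicE.
have [yG|yG] := boolP (y \in G); last by case: ifP.
by rewrite mem_set//; apply: GD; rewrite -in_setE.
Qed.

(** Wherever it starts, the walk is in G at time m with probability at least
    de * mu G = 1 - th. *)
Lemma iter_le_off_trap w C : L1 D w -> 0 <= C ->
  (forall x, G x -> w x <= 0) -> (forall x, D x -> w x <= C) ->
  forall x, D x -> iter m S w x <= th * C.
Proof.
move=> Iw C0 wG wC x Dx.
have avgm := averaging_iter mD finD m avgS.
apply: (@le_trans _ _ (iter m S (fun y => - C * oneG y + C) x)).
  apply: (averaging_le mD avgm) => //.
    by apply: integrable_lin => //; exact: I1.
  move=> y Dy; rewrite /oneG indicE; have [yG|yG] := boolP (y \in G).
    by rewrite mulr1 addNr wG// -in_setE.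
  by rewrite mulr0 add0r wC.
rewrite (averaging_affine mD finD avgm)// /th.
have := ler_wpM2l C0 (S1G Dx); lra.
Qed.

(** Maximum principle. The positive part w of v is subharmonic everywhere, hence
    w <= S^m w, and by [iter_le_off_trap] each block of m steps improves an upper
    bound of w by the factor th. *)
Lemma subharmonic_le0 v M : L1 D v -> (forall x, G x -> v x <= 0) ->
  (forall x, I x -> v x <= S v x) -> (forall x, D x -> v x <= M) ->
  forall x, D x -> v x <= 0.
Proof.
move=> Iv vG vS vM.
pose w x := Num.max (v x) 0.
have w0 x : 0 <= w x by rewrite le_max lexx orbT.
have Iw : L1 D w.
  apply: (integrable_dominated mD _ _ (integrable_norm Iv)).
    by apply: measurable_maxr => //; exact: integrable_measurable_fun Iv.
  move=> x _; rewrite ger0_norm// /w ge_max ler_norm/=; exact: normr_ge0.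
have wS x : D x -> w x <= S w x.
  move=> Dx; have Sw0 : 0 <= S w x by exact: (averaging_ge0 avgS).
  rewrite ge_max Sw0 andbT.
  have [Gx|nGx] := pselect (G x); first by apply: (le_trans (vG _ Gx)).
  apply: (le_trans (vS x _)) => //; apply: (averaging_le mD avgS) => // y _.
  by rewrite le_max lexx.
have wSk k x : D x -> w x <= iter k S w x.
  elim: k x => [//|k ih] x Dx /=; apply: (le_trans (wS _ Dx)).
  by apply: (averaging_le mD avgS) => //; exact: iter_integrable.
have M0 : 0 <= Num.max M 0 by rewrite le_max lexx orbT.
have [t0 t1] := andP th01.
have wn n x : D x -> w x <= Num.max M 0 * th ^+ n.
  elim: n x => [|n ih] x Dx.
    by rewrite mulr1 ge_max M0 andbT le_max vM.
  rewrite exprS mulrCA; apply: (le_trans (wSk m x Dx)).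
  apply: iter_le_off_trap => //.
    by rewrite mulr_ge0// exprn_ge0// ltW.
  by move=> y Gy; rewrite ge_max lexx andbT vG.
move=> x Dx; apply: (@le_trans _ _ (w x)); first by rewrite le_max lexx.
by apply: (@le0_geometric _ _ (Num.max M 0) th); rewrite ?(ltW t0)// => n; exact: wn.
Qed.

(** The walk removed once it has reached G: the k-th iterate sees the paths whose
    first k positions avoid G. *)
Definition killed g := (S g) \_ I.

Let ID : I `<=` D. Proof. by move=> x []. Qed.

Lemma killed_integrable g : L1 D g -> L1 D (killed g).
Proof.
move=> Ig; apply: integrable_restrict_sub => //.
by apply: integrableS (averaging_integrable avgS Ig).
Qed.

Lemma killedE g x : I x -> killed g x = S g x.
Proof. by move=> Ix; rewrite /killed patchE mem_set. Qed.

Lemma killed_trap g x : G x -> killed g x = 0.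
Proof. by move=> Gx; rewrite /killed patchE memNset// => -[]. Qed.

Lemma killed_norm_le f g : L1 D f -> L1 D g -> (forall x, D x -> `|f x| <= g x) ->
  forall x, D x -> `|killed f x| <= killed g x.
Proof.
move=> If Ig fg x Dx; have [Gx|nGx] := pselect (G x).
  by rewrite !killed_trap// normr0.
by rewrite !killedE//; apply: (averaging_norm_le mD finD avgS).
Qed.

Let survival k := iter k killed (\1_I : T -> R).

Let survival_integrable k : L1 D (survival k).
Proof.
elim: k => [|k ih]; last exact: killed_integrable.
have : L1 D ((fun=> 1 : R) \_ I).
  apply: integrable_restrict_sub => //.
  by apply: integrableS (I1 1).
apply: integrable_eq_in => // x _.
by rewrite /survival/= indicE patchE; case: ifP.
Qed.

Let survival_ge0 k x : D x -> 0 <= survival k x.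
Proof.
elim: k x => [|k ih] x Dx; first by rewrite /survival/= indicE.
apply: le_trans (killed_norm_le (survival_integrable k) (survival_integrable k) _ Dx).
  exact: normr_ge0.
by move=> y Dy; rewrite ger0_norm// ih.
Qed.

Let killed_le f g : L1 D f -> L1 D g -> (forall x, D x -> 0 <= f x <= g x) ->
  forall x, D x -> killed f x <= killed g x.
Proof.
move=> If Ig fg x Dx; apply: (le_trans (ler_norm _)).
apply: killed_norm_le => // y Dy; have /andP[f0 fgy] := fg y Dy.
by rewrite ger0_norm.
Qed.

Let survival_le1 k x : D x -> survival k.+1 x <= survival k x.
Proof.
elim: k x => [|k ih] x Dx; last first.
  apply: (killed_le (survival_integrable k.+1) (survival_integrable k)) => // y Dy.
  by rewrite survival_ge0//= ih.
rewrite /survival/= indicE; have [Gx|nGx] := pselect (G x).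
  by rewrite killed_trap.
rewrite killedE// mem_set// -[leRHS](averaging_cst1 avgS Dx).
apply: (averaging_le mD avgS) => //; first exact: (survival_integrable 0).
by move=> y Dy; rewrite indicE; case: (y \in I).
Qed.

Let survival_m x : D x -> survival m x <= th.
Proof.
move=> Dx; rewrite -[th]mulr1; have Iu := survival_integrable 0.
apply: (@le_trans _ _ (iter m S (survival 0) x)).
  elim: m x Dx => [//|k ih] x Dx /=.
  have [Gx|nGx] := pselect (G x).
    rewrite killed_trap//; apply: (averaging_ge0 avgS) => //.
      exact: iter_integrable.
    by move=> y Dy; apply: le_trans (ih y Dy); exact: survival_ge0.
  rewrite killedE//; apply: (averaging_le mD avgS (survival_integrable k)) => //.
  exact: iter_integrable.
apply: iter_le_off_trap => // y.
  by move=> Gy; rewrite /survival/= indicE memNset// => -[].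
by move=> _; rewrite /survival/= indicE; case: (y \in I).
Qed.

Let survival_step k x : D x -> survival (k + m) x <= th * survival k x.
Proof.
elim: k x => [|k ih] x Dx.
  rewrite add0n; have [Gx|nGx] := pselect (G x).
    have sG j : survival j x = 0.
      case: j => [|j]; last by rewrite /survival/= killed_trap.
      by rewrite /survival/= indicE memNset// => -[].
    by rewrite !sG mulr0.
  by rewrite /survival/= indicE mem_set// mulr1; exact: survival_m.
have [t0 _] := andP th01.
rewrite addSn /=; have [Gx|nGx] := pselect (G x).
  by rewrite /survival/= !killed_trap// mulr0.
rewrite /survival/= !killedE//.
apply: (@le_trans _ _ (S (fun y => th * survival k y + 0) x)).
  apply: (averaging_le mD avgS (survival_integrable (k + m))) => //.
    by apply: integrable_lin => //; exact: I1.
  by move=> y Dy; rewrite addr0; exact: ih.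
by rewrite (averaging_affine mD finD avgS)// addr0.
Qed.

(** The iterates are the probabilities that the walk started at x has avoided G up
    to time k. *)
Lemma survival_decay : exists B la : R, [/\ 0 < B, 0 < la < 1 &
  forall k x, D x -> iter k killed (\1_I : T -> R) x <= B * la ^+ k].
Proof.
have [t0 t1] := andP th01.
have [la la01 decay] := geometric_decay m0 t0 t1.
exists th^-1, la; split => //; first by rewrite invr_gt0.
move=> k x Dx.
apply: le_trans (decay (survival ^~ x) _ _ _ k) _ => [j|j|j|].
- exact: survival_ge0.
- exact: survival_le1.
- exact: survival_step.
- rewrite /survival/= ler_piMr ?indicE//.
    by rewrite mulr_ge0 ?exprn_ge0 ?invr_ge0 ?(ltW t0)//; have /andP[/ltW] := la01.
  by case: (x \in I).
Qed.

(** The mean of f at the point where the walk first enters G: the k-th term of the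
    series is the contribution of the paths entering at time k + 1. *)
Definition harmonic_extension f x :=
  (f \_ G) x + limn (series (fun k => iter k killed (killed (f \_ G)) x)).

Lemma Rintegral_restrict_norm f : Int D (fun x => `|(f \_ G) x|) = Int G (fun x => `|f x|).
Proof.
rewrite [LHS]Rintegral_mkcond [RHS]Rintegral_mkcond; apply: eq_Rintegral => x _.
rewrite !patchE; have [xG|xG] := boolP (x \in G).
  by rewrite mem_set//; apply: GD; rewrite -in_setE.
by case: ifP => // _; exact: normr0.
Qed.

(** The terms of the series are bounded by the survival probabilities times the
    L1 norm of f, hence decay geometrically; this makes E f bounded off G for an f
    that is merely integrable. Applying S to a partial sum yields the next one at
    points off G, and the limit is harmonic there. *)
Lemma harmonic_extension_spec : exists2 C : R, 0 <= C & forall f, L1 G f ->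
  [/\ L1 D (harmonic_extension f),
      forall x, G x -> harmonic_extension f x = f x,
      forall x, I x -> `|harmonic_extension f x| <= C * Int G (fun y => `|f y|) &
      forall x, I x -> S (harmonic_extension f) x = harmonic_extension f x].
Proof.
have [B [la [B0 la01 surv]]] := survival_decay; have [la0 la1] := andP la01.
have la01' : 0 <= la < 1 by rewrite (ltW la0).
exists (be * B / (1 - la)).
  by rewrite divr_ge0// ?subr_ge0 ?(ltW la1)// mulr_ge0// ltW.
move=> f If; set N := Rintegral _ _ (fun y => `|f y|).
have N0 : 0 <= N by apply: Rintegral_ge0.
pose f0 := f \_ G; have If0 : L1 D f0 by exact: integrable_restrict_sub.
have f0I x : I x -> f0 x = 0 by move=> [_ nGx]; rewrite /f0 patchE memNset.
have f0G x : G x -> f0 x = f x by move=> Gx; rewrite /f0 patchE mem_set.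
pose v k := iter k killed (killed f0).
have Iv k : L1 D (v k).
  by elim: k => [|k ih]; [exact: killed_integrable|exact: killed_integrable].
have vG k x : G x -> v k x = 0.
  by move=> Gx; case: k => [|k]; rewrite /v/= killed_trap.
have vle k x : D x -> `|v k x| <= be * N * survival k x.
  elim: k x => [|k ih] x Dx.
    have [Gx|nGx] := pselect (G x).
      by rewrite vG// normr0 !mulr_ge0// survival_ge0.
    rewrite /v/= killedE// /survival/= indicE mem_set// mulr1.
    by apply: (le_trans (Sbd If0 Dx)); rewrite f0I// normr0 add0r Rintegral_restrict_norm.
  have [Gx|nGx] := pselect (G x).
    by rewrite vG// normr0 !mulr_ge0// survival_ge0.
  have Isk : L1 D (fun y => be * N * survival k y + 0).
    by apply: integrable_lin => //; exact: I1.
  have := killed_norm_le (Iv k) Isk.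
  move=> /(_ _ x Dx); rewrite [in leRHS]killedE//.
  rewrite (averaging_affine mD finD avgS)// addr0.
  have -> : survival k.+1 x = S (survival k) x by exact: killedE.
  by apply => y Dy; rewrite addr0 ih.
pose M := be * N * B / (1 - la).
have tail x : D x -> cvgn (series (v ^~ x)) /\
    forall n, `|limn (series (v ^~ x)) - series (v ^~ x) n| <= M * la ^+ n.
  move=> Dx; apply: series_geometric_tail => // k.
  apply: (le_trans (vle k x Dx)); rewrite -[leRHS]mulrA ler_wpM2l ?mulr_ge0//.
  exact: surv.
have M0 : 0 <= M by rewrite /M divr_ge0 ?subr_ge0 ?(ltW la1)// !mulr_ge0// ltW.
pose s n x := f0 x + series (v ^~ x) n.
have sS n x : s n.+1 x = 1 * s n x + v n x.
  by rewrite /s /series/= big_nat_recr//= mul1r addrA.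
have s0 x : s 0%N x = f0 x by rewrite /s /series/= big_geq// addr0.
have Is n : L1 D (s n).
  elim: n => [|n ih].
    by apply: (integrable_eq_in mD _ If0) => x _; rewrite s0.
  by apply: (integrable_eq_in mD _ (integrable_lin mD 1 ih (Iv n))) => x _; rewrite sS.
have hs n x : D x -> `|harmonic_extension f x - s n x| <= M * la ^+ n.
  move=> Dx; have [_ /(_ n)] := tail x Dx; apply: le_trans.
  by rewrite /harmonic_extension /s opprD addrACA subrr add0r.
have hG x : G x -> harmonic_extension f x = f x.
  move=> Gx; rewrite /harmonic_extension.
  rewrite -[X in X + _ = _]/(f0 x) f0G// (_ : series _ = cst 0) ?lim_cst ?addr0//.
  by apply/funext => n; rewrite /series/= big1// => k _; exact: vG.
have mh : measurable_fun D (harmonic_extension f).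
  apply: (@measurable_fun_cvg _ _ _ _ s) => [n|x Dx].
    exact: integrable_measurable_fun (Is n).
  apply: cvgD; first exact: cvg_cst.
  by have [] := tail x Dx.
have Ih : L1 D (harmonic_extension f).
  apply: (integrable_dominated mD mh _
    (integrable_lin mD 1 (integrable_norm If0) (I1 M))) => x Dx /=.
  rewrite mul1r addrC -lerBlDr; apply: (le_trans (lerB_dist _ _)).
  by have := hs 0%N x Dx; rewrite mulr1 s0.
split => //.
- move=> x Ix; have := hs 0%N x (ID Ix).
  rewrite s0 f0I// subr0 mulr1; congr (_ <= _).
  by rewrite /M; ring.
- have Ss n x : I x -> S (s n) x = s n.+1 x.
    move=> Ix; have Dx := ID Ix.
    elim: n => [|n ih].
      rewrite (eq_averaging mD avgS (Is 0%N) If0)//.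
      by rewrite sS s0 f0I// mulr0 add0r /v/= killedE.
    rewrite (eq_averaging mD avgS (Is n.+1) (integrable_lin mD 1 (Is n) (Iv n)))//.
    rewrite (averaging_lin avgS)// ih [RHS]sS; congr (_ + _).
    by rewrite /v/= killedE.
  move=> x Ix; have Dx := ID Ix.
  apply/eqP; rewrite -subr_eq0 -normr_eq0 eq_le normr_ge0 andbT.
  apply: (@le0_geometric _ _ (M * (1 + be * Int D (cst 1)) + M) la) => // n.
  rewrite -[X in `|X|](subrKA (S (s n) x)); apply: (le_trans (ler_normD _ _)).
  rewrite mulrDl; apply: lerD.
    rewrite mulrAC; apply: (averaging_dist mD avgS be0 Sbd Ih (Is n) (I1 1)) => // y Dy.
    by rewrite mulr1; exact: hs.
  rewrite Ss// distrC (le_trans (hs n.+1 x Dx))// ler_wpM2l//.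
  by rewrite exprS ler_piMl ?exprn_ge0// ltW.
Qed.

Let E := harmonic_extension.

(** The class in which the maximum principle determines a function from its values
    on G. Boundedness is asked for off G only, the datum on G being merely
    integrable. *)
Definition bounded_harmonic v := [/\ L1 D v,
  exists M, forall x, I x -> `|v x| <= M & forall x, I x -> S v x = v x].

Lemma bounded_harmonic_le v w : bounded_harmonic v -> bounded_harmonic w ->
  (forall x, G x -> v x <= w x) -> forall x, D x -> v x <= w x.
Proof.
move=> [Iv [M vM] Sv] [Iw [N wN] Sw] vw x Dx; rewrite -subr_le0.
apply: (@subharmonic_le0 _ (Num.max 0 (M + N)) (integrable_sub mD Iv Iw)) => //.
- by move=> y Gy; rewrite subr_le0 vw.
- by move=> y Iy; rewrite (averagingB mD avgS)//; [rewrite Sv ?Sw|exact: ID].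
- move=> y Dy; rewrite le_max; have [Gy|nGy] := pselect (G y).
    by rewrite subr_le0 vw.
  apply/orP; right; apply: (le_trans (ler_norm _)).
  by apply: (le_trans (ler_normB _ _)); rewrite lerD ?vM ?wN.
Qed.

Lemma bounded_harmonic_eq v w : bounded_harmonic v -> bounded_harmonic w ->
  (forall x, G x -> v x = w x) -> forall x, D x -> v x = w x.
Proof.
move=> hv hw vw x Dx; apply/le_anti/andP; split.
  by apply: bounded_harmonic_le => // y Gy; rewrite vw.
by apply: bounded_harmonic_le => // y Gy; rewrite vw.
Qed.

Lemma bounded_harmonic_lin a v w : bounded_harmonic v -> bounded_harmonic w ->
  bounded_harmonic (fun x => a * v x + w x).
Proof.
move=> [Iv [M vM] Sv] [Iw [N wN] Sw]; split.
- exact: integrable_lin.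
- exists (`|a| * M + N) => x Ix; rewrite (le_trans (ler_normD _ _))//.
  by rewrite lerD ?wN// normrM ler_wpM2l ?vM.
- by move=> x Ix; rewrite (averaging_lin avgS) ?Sv ?Sw//; exact: ID.
Qed.

Lemma bounded_harmonic_cst a : bounded_harmonic (cst a).
Proof.
split; [exact: I1|by exists `|a| |move=> x Ix; have Dx := ID Ix].
rewrite -[RHS]add0r -[X in X + _](mul0r (S (cst a) x)).
rewrite -(averaging_affine mD finD avgS)//; apply: (eq_averaging mD avgS (I1 a)) => //.
- by apply: (integrable_lin mD 0 (I1 a)); exact: (I1 (cst a x)).
- by move=> y _; rewrite mul0r add0r.
Qed.

Lemma bounded_harmonic_extension f : L1 G f -> bounded_harmonic (E f).
Proof.
have [C C0 spec] := harmonic_extension_spec.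
by move=> /spec[IE _ Eb SE]; split => //; exists (C * Int G (fun y => `|f y|)).
Qed.

Lemma harmonic_extension_trap f x : L1 G f -> G x -> E f x = f x.
Proof.
have [C C0 spec] := harmonic_extension_spec.
by move=> /spec[_ EG _ _]; exact: EG.
Qed.

Lemma harmonic_extension_integrable f : L1 G f -> L1 D (E f).
Proof. by move=> /bounded_harmonic_extension[]. Qed.

Lemma harmonic_extension_lin a f g : L1 G f -> L1 G g -> forall x, D x ->
  E (fun y => a * f y + g y) x = a * E f x + E g x.
Proof.
move=> If Ig; have Ifg := integrable_lin mG a If Ig.
apply: bounded_harmonic_eq.
- exact: bounded_harmonic_extension.
- by apply: bounded_harmonic_lin; exact: bounded_harmonic_extension.
- by move=> x Gx; rewrite !harmonic_extension_trap.
Qed.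

Lemma harmonic_extension_le f g : L1 G f -> L1 G g ->
  (forall x, G x -> f x <= g x) -> forall x, D x -> E f x <= E g x.
Proof.
move=> If Ig fg; apply: bounded_harmonic_le.
- exact: bounded_harmonic_extension.
- exact: bounded_harmonic_extension.
- by move=> x Gx; rewrite !harmonic_extension_trap// fg.
Qed.

Lemma harmonic_extension_cst a : forall x, D x -> E (cst a) x = a.
Proof.
apply: (@bounded_harmonic_eq _ (cst a)).
- by apply: bounded_harmonic_extension; exact: integrable_finite_cst.
- exact: bounded_harmonic_cst.
- by move=> x Gx; rewrite harmonic_extension_trap//; exact: integrable_finite_cst.
Qed.

Lemma harmonic_extension_ge0 f : L1 G f -> (forall x, G x -> 0 <= f x) ->
  forall x, D x -> 0 <= E f x.
Proof.
move=> If f0 x Dx; rewrite -[leLHS](harmonic_extension_cst 0 Dx).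
by apply: harmonic_extension_le => //; exact: integrable_finite_cst.
Qed.

(** One step of the walk watched only during its visits to G: an excursion off G
    is replaced by the point of return. *)
Definition trace_step f := S (E f).

(** S (E f) and E f have the same integral over D and agree off G by harmonicity,
    so they have the same integral over G, where E f is f. *)
Lemma trace_step_averaging : averaging mu G trace_step.
Proof.
have DE : D = G `|` I by rewrite setDUK.
have IE f : L1 G f -> L1 D (E f) by exact: harmonic_extension_integrable.
have ISE f : L1 G f -> L1 D (S (E f)).
  by move=> If; exact: (averaging_integrable avgS (IE f If)).
split.
- by move=> f If; apply: integrableS (ISE f If).
- move=> a f g If Ig x Gx; rewrite /trace_step -(averaging_lin avgS) ?IE//.
    apply: (eq_averaging mD avgS) => //.
    + by apply: IE; exact: integrable_lin.
    + by apply: integrable_lin => //; exact: IE.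
    + exact: harmonic_extension_lin.
    + exact: GD.
  exact: GD.
- move=> f If f0 x Gx; apply: (averaging_ge0 avgS); [exact: IE| |exact: GD].
  exact: harmonic_extension_ge0.
- move=> x Gx; rewrite /trace_step -[RHS](averaging_cst1 avgS (GD Gx)).
  apply: (eq_averaging mD avgS); [|exact: I1| |exact: GD].
    by apply: IE; exact: integrable_finite_cst.
  exact: harmonic_extension_cst.
- move=> f If; have [_ _ SE] := bounded_harmonic_extension If.
  have := averaging_mass avgS (IE f If).
  have GI0 : [disjoint G & I] by apply/disj_setPS => x [Gx []].
  rewrite {1 2}DE !Rintegral_setU// -?DE; [|exact: IE|exact: ISE].
  rewrite (eq_Rintegral_in mu SE) => /addIr ->.
  by apply: eq_Rintegral_in => x Gx; rewrite harmonic_extension_trap.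
Qed.

Lemma trace_step_half f : L1 G f -> (forall x, G x -> 0 <= f x) ->
  forall x, G x -> 2^-1 * f x <= trace_step f x.
Proof.
move=> If f0 x Gx; rewrite -{1}(harmonic_extension_trap If Gx).
apply: Shalf; [exact: harmonic_extension_integrable| |exact: GD].
exact: harmonic_extension_ge0.
Qed.

Lemma trace_step_bound : exists2 b, 0 <= b & forall f, L1 G f ->
  forall x, G x -> `|trace_step f x| <= `|f x| + b * Int G (fun y => `|f y|).
Proof.
have [C C0 spec] := harmonic_extension_spec.
exists (be * (1 + C * fine (mu D))).
  by rewrite mulr_ge0// addr_ge0// mulr_ge0// fine_ge0.
move=> f If x Gx; have [IE EG EI SE] := spec f If.
apply: (le_trans (Sbd IE (GD Gx))); rewrite EG// lerD2l -mulrA ler_wpM2l//.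
set N := Rintegral _ _ (fun y => `|f y|).
have N0 : 0 <= N by apply: Rintegral_ge0.
have -> : (1 + C * fine (mu D)) * N =
    1 * Int D (fun y => `|(f \_ G) y|) + Int D (cst (C * N)).
  have -> : Int D (cst (C * N)) = C * N * fine (mu D) by exact: Rintegral_cst.
  by rewrite Rintegral_restrict_norm -/N; ring.
have If0 : L1 D (f \_ G) by exact: integrable_restrict_sub.
rewrite -(Rintegral_lin mD 1 (integrable_norm If0) (I1 (C * N))).
apply: le_Rintegral => //; first exact: integrable_norm.
  exact: (integrable_lin mD 1 (integrable_norm If0) (I1 (C * N))).
move=> y Dy; rewrite mul1r; have [Gy|nGy] := pselect (G y).
  by rewrite /= EG// patchE mem_set// lerDl mulr_ge0.
by rewrite /= patchE memNset// [X in _ <= X + _]normr0 add0r EI.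
Qed.

(** E (P f) is at least half of S (E f): on G the two coincide, and off G it
    follows from P f >= f / 2, since S (E f) = E f there.
    By iteration E (P^m f) >= 2^-m * S^m (E f), to which the bound for S
    applies. *)
Lemma trace_step_minorized : forall f, L1 G f -> (forall x, G x -> 0 <= f x) ->
  forall x, G x -> 2^-1 ^+ m * de * Int G f <= iter m trace_step f x.
Proof.
move=> f If f0.
have avgT k := averaging_iter mG finG k trace_step_averaging.
pose F k := iter k trace_step f.
have IF k : L1 G (F k) by exact: (averaging_integrable (avgT k)).
have F0 k x : G x -> 0 <= F k x by exact: (averaging_ge0 (avgT k)).
have IE k : L1 D (E (F k)) by exact: harmonic_extension_integrable.
have E0 k x : D x -> 0 <= E (F k) x.
  by apply: harmonic_extension_ge0 => // y; exact: F0.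
have half0 : 0 <= 2^-1 :> R by rewrite invr_ge0.
have IS k : L1 D (iter k S (E f)).
  by apply: iter_integrable; exact: harmonic_extension_integrable.
have step k x : D x -> 2^-1 * S (E (F k)) x <= E (F k.+1) x.
  move=> Dx; have [Gx|nGx] := pselect (G x).
    rewrite harmonic_extension_trap// -[leRHS]mul1r ler_wpM2r//.
      by apply: (averaging_ge0 avgS); [exact: IE|exact: E0|].
    by rewrite invf_le1// ler1n.
  have [_ _ SE] := bounded_harmonic_extension (IF k).
  rewrite SE// -[leLHS]addr0 -(harmonic_extension_cst 0 Dx).
  have I0 : L1 G (cst 0) by exact: integrable_finite_cst.
  rewrite -harmonic_extension_lin//; apply: harmonic_extension_le => //.
    exact: integrable_lin.
  by move=> y Gy; rewrite addr0; apply: (trace_step_half (IF k)) => // z; exact: F0.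
have iterle k x : D x -> 2^-1 ^+ k * iter k S (E f) x <= E (F k) x.
  elim: k x => [|k ih] x Dx; first by rewrite mul1r.
  apply: le_trans (step k x Dx); rewrite exprS -mulrA ler_wpM2l//=.
  rewrite -[leLHS]addr0 -(averaging_affine mD finD avgS)//.
  apply: (averaging_le mD avgS) => //.
    by apply: integrable_lin => //; exact: I1.
  by move=> y Dy; rewrite addr0; exact: ih.
move=> x Gx; rewrite -[leRHS](harmonic_extension_trap (IF m) Gx).
apply: le_trans (iterle m x (GD Gx)); rewrite -mulrA ler_wpM2l ?exprn_ge0//.
apply: le_trans (Smin (IE 0%N) (E0 0%N) (GD Gx)); rewrite ler_wpM2l ?(ltW de0)//.
have <- : Int G (E f) = Int G f.
  by apply: eq_Rintegral_in => y Gy; rewrite harmonic_extension_trap.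
rewrite -[X in Rintegral _ X (E (F 0%N))](setDUK GD) Rintegral_setU//; last 2 first.
- by rewrite setDUK//; exact: (IE 0%N).
- by apply/disj_setPS => y [Gy []].
rewrite lerDl; apply: Rintegral_ge0 => y Iy; exact: (E0 0%N _ (ID Iy)).
Qed.

(** Uniqueness among integrable extensions, harmonic only almost everywhere, is
    out of reach of the maximum principle, which works with bounded functions.
    Instead |v| is made subharmonic at every point by changing it on a null set.
    The integral of S^m |v| - |v| over D is zero, while on G the integrand is at
    least de times the integral of |v|, which must therefore vanish. *)
Lemma harmonic_ae_eq0 v : L1 D v -> (forall x, G x -> v x = 0) ->
  {ae mu, forall x, I x -> S v x = v x} -> {ae mu, forall x, D x -> v x = 0}.
Proof.
move=> Iv vG [N [mN N0 SvN]].
have nullN : {ae mu, forall x, ~ N x} by exists N; split => // x /= /contrapT.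
have SvE x : ~ N x -> I x -> S v x = v x.
  by move=> nNx; apply: contrapT => /(SvN x); exact: nNx.
(* off the null set N where harmonicity fails; on N, g is 0 <= S g *)
pose g := (fun x => `|v x|) \_ (~` N).
have gN x : N x -> g x = 0 by move=> Nx; rewrite /g patchE memNset.
have gE x : ~ N x -> g x = `|v x| by move=> nNx; rewrite /g patchE mem_set.
have g0 x : 0 <= g x.
  by have [Nx|/gE->//] := pselect (N x); rewrite gN.
have Inv := integrable_norm Iv.
have Ig : L1 D g.
  apply: (integrable_dominated mD _ _ Inv); last first.
    move=> x _; rewrite ger0_norm//=.
    by have [Nx|nNx] := pselect (N x); [rewrite gN|rewrite gE].
  apply/(measurable_restrict _ (measurableC mN) mD).
  by apply: measurable_funS (integrable_measurable_fun Inv) => // x [].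
have Idg := integrable_norm (integrable_sub mD Ig Inv).
have gv : Int D (fun x => `|g x - `|v x| |) = 0.
  rewrite (@eq_Rintegral_ae _ _ _ mu D mD _ (cst 0)).
  - by rewrite Rintegral_cst// mul0r.
  - exact: integrable_measurable_fun Idg.
  - exact: measurable_cst.
  - by apply: filterS nullN => x nNx _; rewrite gE// subrr normr0.
have gS x : D x -> g x <= S g x.
  move=> Dx; have Sg0 : 0 <= S g x by exact: (averaging_ge0 avgS).
  have [Nx|nNx] := pselect (N x); first by rewrite gN.
  have [Gx|nGx] := pselect (G x); first by rewrite gE// vG// normr0.
  have -> : S g x = S (fun x => `|v x|) x.
    apply/eqP; rewrite -subr_eq0 -normr_eq0 eq_le normr_ge0 andbT.
    rewrite -(averagingB mD avgS)//.
    apply: (le_trans (Sbd (integrable_sub mD Ig Inv) Dx)).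
    by rewrite gv mulr0 addr0 gE// subrr normr0.
  by rewrite gE// -[in leLHS]SvE//; apply: (averaging_norm_le mD finD avgS).
have Igk k : L1 D (iter k S g) by exact: iter_integrable.
have gSk k x : D x -> g x <= iter k S g x.
  elim: k x => [//|k ih] x Dx /=; apply: (le_trans (gS _ Dx)).
  exact: (averaging_le mD avgS).
have Ih := integrable_sub mD (Igk m) Ig.
have h0 : Int D (fun x => iter m S g x - g x) = 0.
  by rewrite RintegralB// (averaging_mass (averaging_iter mD finD m avgS))// subrr.
have Int_g : Int D g = 0.
  apply/eqP; rewrite eq_le Rintegral_ge0// andbT.
  have : de * Int D g * fine (mu G) <= 0.
    rewrite -h0 -Rintegral_cst// -{2}(setDUK GD) Rintegral_setU//; last 2 first.
    - by rewrite setDUK.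
    - by apply/disj_setPS => y [Gy []].
    rewrite -[leLHS]addr0; apply: lerD.
      apply: le_Rintegral => //; first exact: integrable_finite_cst.
        exact: integrableS Ih.
      move=> x Gx; rewrite (_ : g x = 0) ?subr0 ?Smin//; first exact: GD.
      have [Nx|nNx] := pselect (N x); first by rewrite gN.
      by rewrite gE// vG// normr0.
    by apply: Rintegral_ge0 => x Ix; rewrite subr_ge0 gSk//; exact: ID.
  by rewrite pmulr_lle0// pmulr_rle0.
apply: filterS2 nullN (Rintegral_eq0_ae mD Ig (fun x _ => g0 x) Int_g).
by move=> x nNx gx Dx; apply/eqP; rewrite -normr_eq0 -gE// gx.
Qed.

End harmonic_extension.

(** * Cubes and Lebesgue measure in R^n *)

Section cubes.
Context {R : realType} {n : nat}.
Implicit Types (x y : 'rV[R]_n) (e : R) (A U : set 'rV[R]_n).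

Local Notation mu := (@lebesgue_rV R n).

(** Sup-norm balls, written by coordinates so that their volume is a product. *)
Definition cube x e := [set y : 'rV[R]_n | forall i, `|x ord0 i - y ord0 i| < e].

Lemma cube_center x e : 0 < e -> cube x e x.
Proof. by move=> e0 i; rewrite subrr normr0. Qed.

Lemma nbhs_cube x A : nbhs x A <-> exists2 e, 0 < e & cube x e `<=` A.
Proof.
split=> [/nbhs_ballP[e /= e0 xA]|[e e0 xA]].
  by exists e => // y xy; apply: xA; split=> // i j; rewrite (ord1 i); exact: xy.
by apply/nbhs_ballP; exists e => //= y [_ xy]; apply: xA => i; exact: xy.
Qed.

Lemma open_cube x e : open (cube x e).
Proof.
rewrite openE => y xy; rewrite /interior /=.
apply: (@filter_forall _ _ (fun i z => `|x ord0 i - z ord0 i| < e) (nbhs y)) => i.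
have c : `|x ord0 i - z ord0 i| @[z --> y] --> `|x ord0 i - y ord0 i|.
  apply: cvg_norm; apply: cvgB; first exact: cvg_cst.
  exact: coord_continuous.
exact: (cvgr_lt _ c).
Qed.

Lemma cubeE x e : cube x e =
  [set y | forall i, `](x ord0 i - e), (x ord0 i + e)[%classic (y ord0 i)].
Proof.
by apply/seteqP; split => y xy i; have := xy i; rewrite /= in_itv/= ltr_distlC.
Qed.

Lemma measurable_cube x e : measurable (cube x e).
Proof.
rewrite cubeE.
apply: (measurable_rV_box
  (B := fun i => `](x ord0 i - e), (x ord0 i + e)[%classic)) => i.
exact: measurable_itv.
Qed.

Lemma lebesgue_rV_cube_gt0 x e : 0 < e -> (0 < mu (cube x e))%E.
Proof.
move=> e0; rewrite cubeE (lebesgue_rV_box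
  (B := fun i => `](x ord0 i - e), (x ord0 i + e)[%classic)); last first.
  by move=> i; exact: measurable_itv.
apply: (big_ind (fun z => 0 < z)%E) => [|y z y0 z0|i _]; first by rewrite lte_fin.
  exact: mule_gt0.
rewrite lebesgue_measure_itv/= lte_fin ifT; last by lra.
by rewrite -EFinB lte_fin; lra.
Qed.

(** An open set is the union of the countably many cubes with rational centre and
    radius 1 / (m + 1) that it contains. *)
Lemma open_rV_measurable U : open U -> measurable U.
Proof.
move=> oU.
pose F (qm : 'rV[rat]_n * nat) : set 'rV[R]_n :=
  let c := cube (map_mx ratr qm.1) qm.2.+1%:R^-1 in
  if `[< c `<=` U >] then c else set0.
suff -> : U = \bigcup_qm F qm.
  apply: countable_bigcupT_measurable => // -[q m].
  by rewrite /F; case: ifP => // _; exact: measurable_cube.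
apply/seteqP; split => [x Ux|x [qm _]]; last first.
  by rewrite /F; case: asboolP => // cU /cU.
have /nbhs_cube[e e0 xeU] : nbhs x U by apply: open_nbhs_nbhs.
have [m me] : exists m, m.+1%:R^-1 < e / 2.
  have e20 : 0 < e / 2 by rewrite divr_gt0.
  near \oo => m; exists m; near: m.
  exact: near_infty_natSinv_lt (PosNum e20).
have m0 : 0 < m.+1%:R^-1 :> R by rewrite invr_gt0 ltr0n.
have q_ i : exists q : rat, `|x ord0 i - ratr q| < m.+1%:R^-1.
  have : x ord0 i - m.+1%:R^-1 < x ord0 i + m.+1%:R^-1.
    by rewrite ltrBlDr -addrA ltrDl addr_gt0.
  move=> /rat_in_itvoo[q]; rewrite in_itv/= => qx.
  by exists q; rewrite distrC ltr_distl.
have /choice[q qx] := q_.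
exists (\row_i q i, m) => //; rewrite /F.
have cU : cube (map_mx ratr (\row_i q i)) m.+1%:R^-1 `<=` U.
  move=> y qy; apply: xeU => i.
  have := qx i; have := qy i; rewrite !mxE => qyi qxi.
  rewrite -(subrKA (ratr (q i))); apply: (le_lt_trans (ler_normD _ _)).
  by rewrite (splitr e) ltrD// (lt_trans _ me).
case: asboolP => // _ i; rewrite !mxE distrC; exact: qx.
Unshelve. all: by end_near. Qed.

Lemma lebesgue_rV_open_gt0 U : open U -> U !=set0 -> (0 < mu U)%E.
Proof.
move=> oU [x Ux]; have /nbhs_cube[e e0 eU] : nbhs x U by apply: open_nbhs_nbhs.
apply: (lt_le_trans (lebesgue_rV_cube_gt0 x e0)).
apply: le_measure => //; rewrite inE; first exact: measurable_cube.
exact: open_rV_measurable.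
Qed.

Lemma bounded_rV_box A : bounded_set A ->
  exists M : R, forall x i, A x -> `|x ord0 i| <= M.
Proof.
move=> [M [_ AM]]; exists (M + 1) => x i Ax.
have : `|x| <= M + 1 by apply: AM => //; rewrite ltrDl.
apply: le_trans; rewrite [leRHS]mx_normrE.
exact: (le_bigmax _ (fun j => `|x j.1 j.2|) (ord0, i)).
Qed.

Lemma lebesgue_rV_bounded_lty A : measurable A -> bounded_set A -> (mu A < +oo)%E.
Proof.
move=> mA /bounded_rV_box[M AM].
pose Q := [set x : 'rV[R]_n | forall i, `[(- M), M]%classic (x ord0 i)].
have mQ : measurable Q.
  apply: (measurable_rV_box (B := fun=> `[(- M), M]%classic)) => i.
  exact: measurable_itv.
apply: (@le_lt_trans _ _ (mu Q)).
  apply: le_measure; rewrite ?inE// => x Ax i /=.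
  by rewrite in_itv/= -ler_norml AM.
rewrite (lebesgue_rV_box (B := fun=> `[(- M), M]%classic)); last first.
  by move=> i; exact: measurable_itv.
rewrite -ge0_fin_numE; last by apply: prode_ge0 => i _; exact: measure_ge0.
apply: prode_fin_num => i _; rewrite lebesgue_measure_itv/=.
by case: ifP => // _; rewrite -EFinB.
Qed.

Lemma continuous_rV_measurable (f : 'rV[R]_n -> R) : continuous f ->
  measurable_fun setT f.
Proof.
move=> cf; apply: (measurability _ (RGenOInfty.measurableE R)).
move=> _ [_ [a ->] <-]; rewrite setTI; apply: open_rV_measurable.
apply: open_comp; first by move=> x _; exact: cf.
by rewrite set_itv_o_infty; exact: open_gt.
Qed.

Lemma bounded_cube_cover A e : bounded_set A -> 0 < e ->
  exists s : seq 'rV[R]_n, forall x, A x -> exists2 z, z \in s & cube z e x.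
Proof.
move=> /bounded_rV_box[M AM] e0.
have : compact [set x : 'rV[R]_n | forall i, `[(- M), M]%classic (x ord0 i)].
  by apply: (@rV_compact R n (fun=> `[(- M), M]%classic)) => i; exact: segment_compact.
rewrite compact_cover => /(_ _ setT (fun z => cube z e)).
move=> [z _|x _|D _ AD]; first exact: open_cube.
  by exists x => //; exact: cube_center.
exists (finmap.enum_fset D) => x Ax.
have [|z /= Dz zx] := AD x; last by exists z.
by move=> i /=; rewrite in_itv/= -ler_norml AM.
Qed.

End cubes.

(** * Chains of cubes in a domain; the strip *)

Section domain.
Context {R : realType} {n : nat}.
Variables (Omega : set 'rV[R]_n).
Hypotheses (oO : open Omega) (cO : connected Omega) (bO : bounded_set Omega).

Local Notation mu := (@lebesgue_rV R n).

Lemma enorm0 : enorm (0 : 'rV[R]_n) = 0.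
Proof. by rewrite /enorm big1 ?sqrtr0// => i _; rewrite mxE expr0n. Qed.

Lemma enormN (x : 'rV[R]_n) : enorm (- x) = enorm x.
Proof. by rewrite /enorm; congr Num.sqrt; apply: eq_bigr => i _; rewrite mxE sqrrN. Qed.

Lemma enorm_continuous : continuous (@enorm R n).
Proof.
move=> x.
have sum_cvg (s : seq 'I_n) :
    (fun y : 'rV[R]_n => \sum_(j <- s) y ord0 j ^+ 2) @ x -->
    \sum_(j <- s) x ord0 j ^+ 2.
  elim: s => [|i s ih].
    rewrite big_nil.
    rewrite (_ : (fun y : 'rV[R]_n => \sum_(j <- [::]) y ord0 j ^+ 2) = cst 0).
      exact: cst_continuous.
    by apply/funext => y; rewrite big_nil.
  rewrite big_cons.
  rewrite (_ : (fun y : 'rV[R]_n => \sum_(j <- i :: s) y ord0 j ^+ 2) =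
    fun y : 'rV[R]_n => y ord0 i ^+ 2 + \sum_(j <- s) y ord0 j ^+ 2); last first.
    by apply/funext => y; rewrite big_cons.
  apply: cvgD ih.
  by apply: (@continuous_comp _ _ _ (fun y : 'rV[R]_n => y ord0 i) (fun z => z ^+ 2));
    [exact: coord_continuous|exact: exprn_continuous].
apply: (@continuous_comp _ _ _ (fun x : 'rV[R]_n => \sum_(i < n) x ord0 i ^+ 2)).
  exact: sum_cvg.
exact: sqrt_continuous.
Qed.

Lemma enorm_sub_continuous (b : 'rV[R]_n) :
  continuous (fun x : 'rV[R]_n => enorm (x - b)).
Proof.
move=> x; apply: (@continuous_comp _ _ _ (fun x : 'rV[R]_n => x - b) (@enorm R n)).
  exact: (@continuousB _ _ _ (id : 'rV[R]_n -> 'rV[R]_n) (cst b) x (@cvg_id _ _)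
    (@cst_continuous _ _ b x)).
exact: enorm_continuous.
Qed.

Lemma open_enorm_sub_lt (b : 'rV[R]_n) e : open [set x : 'rV[R]_n | enorm (x - b) < e].
Proof.
rewrite (_ : [set x | _] = (fun x : 'rV[R]_n => enorm (x - b)) @^-1` [set z | z < e])//.
by apply: open_comp; [move=> x _; exact: enorm_sub_continuous|exact: open_lt].
Qed.

(** The cubes linked to cube i by overlaps inside Omega and the remaining cubes
    cover Omega by two open sets that are disjoint in Omega; as Omega is connected
    there are no remaining cubes that meet it. Overlaps inside Omega are open, so
    nonempty ones have positive measure. *)
Lemma finite_cube_cover_chain e : 0 < e ->
  exists (N : nat) (B : 'I_N -> set 'rV[R]_n),
  [/\ forall i, measurable (B i), Omega `<=` \bigcup_i B i,
      forall i x y, B i x -> B i y -> forall k, `|x ord0 k - y ord0 k| < e &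
      forall i j, Omega `&` B i !=set0 -> Omega `&` B j !=set0 ->
        connect (fun i j => `[< (0 < mu (Omega `&` (B i `&` B j)))%E >]) i j].
Proof.
move=> e0; have e20 : 0 < e / 2 by rewrite divr_gt0.
have [s Os] := bounded_cube_cover bO e20.
pose B (i : 'I_(size s)) := cube (nth 0 s i) (e / 2).
have oB i : open (B i) by exact: open_cube.
have OB : Omega `<=` \bigcup_i B i.
  move=> x /Os[z zs zx]; have zi : (index z s < size s)%N by rewrite index_mem.
  by exists (Ordinal zi) => //; rewrite /B /= nth_index.
exists (size s), B; split => //.
- by move=> i; exact: measurable_cube.
- move=> i x y Bx By k; rewrite -(subrKA (nth 0 s i ord0 k)).
  apply: (le_lt_trans (ler_normD _ _)); rewrite (splitr e) ltrD//.
  by rewrite distrC; exact: Bx.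
move=> i j [x0 [Ox0 Bx0]] [x1 [Ox1 Bx1]].
set ov : rel _ := fun i j => _.
have ovP l l' x : Omega x -> B l x -> B l' x -> ov l l'.
  move=> Ox Bx B'x; apply/asboolP; apply: lebesgue_rV_open_gt0; last by exists x.
  by apply: openI => //; exact: openI.
pose C := [set l | connect ov i l].
pose U := \bigcup_(l in C) B l; pose V := \bigcup_(l in ~` C) B l.
have oU : open U by apply: bigcup_open => l _; exact: oB.
have oV : open V by apply: bigcup_open => l _; exact: oB.
have UV : Omega `&` U = Omega `&` ~` V.
  apply/seteqP; split => x [Ox]; last first.
    move=> nVx; have [l _ Bl] := OB x Ox; split=> //; exists l => //.
    by apply: contrapT => nC; apply: nVx; exists l.
  move=> [l Cl Bl]; split => // -[l' nCl' Bl']; apply: nCl'.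
  apply: (connect_trans Cl); apply: connect1; exact: ovP Bl Bl'.
have : Omega `&` U = Omega.
  apply: cO.
  - by exists x0; split => //; exists i => //; exact: connect0.
  - by exists U.
  - by exists (~` V) => //; exact: open_closedC.
move=> OU; have : (Omega `&` U) x1 by rewrite OU.
move=> [_ [l Cl Bl]]; apply: (connect_trans Cl); apply: connect1.
exact: ovP Bl Bx1.
Qed.

(** The set is the intersection of the open neighbourhoods of radius
    r + 1 / (k + 1) of B. *)
Lemma measurable_euclid_dist_le r (B : set 'rV[R]_n) : B !=set0 ->
  measurable [set x | euclid_dist x B <= r].
Proof.
move=> [b0 Bb0].
pose F k := \bigcup_(b in B) [set x : 'rV[R]_n | enorm (x - b) < r + k.+1%:R^-1].
have oF k : open (F k) by apply: bigcup_open => b _; exact: open_enorm_sub_lt.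
have hinf x : has_inf [set enorm (x - y) | y in B].
  split; first by exists (enorm (x - b0)), b0.
  by exists 0 => _ [y _ <-]; exact: sqrtr_ge0.
suff -> : [set x | euclid_dist x B <= r] = \bigcap_k F k.
  by apply: bigcapT_measurable => k; exact: open_rV_measurable.
apply/seteqP; split => x /=.
  move=> xr k _; have k0 : 0 < k.+1%:R^-1 :> R by rewrite invr_gt0 ltr0n.
  have [_ [b Bb <-] xb] := inf_adherent k0 (hinf x).
  by exists b => //=; apply: (lt_le_trans xb); rewrite lerD2r.
move=> Fx; apply/ler_addgt0Pl => e e0.
near \oo => k.
have [b Bb /= xb] := Fx k I.
apply: (@le_trans _ _ (enorm (x - b))).
  by apply: inf_lbound; [have [] := hinf x|exists b].
apply: (le_trans (ltW xb)); rewrite addrC lerD2r ltW//.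
near: k; exact: near_infty_natSinv_lt (PosNum e0).
Unshelve. all: by end_near. Qed.

Lemma measurable_strip r : measurable (strip Omega r).
Proof.
have mO := open_rV_measurable oO.
rewrite (_ : strip Omega r = Omega `&` [set x | euclid_dist x (boundary Omega) <= r])//.
have [b0|/set0P b0] := eqVneq (boundary Omega) set0; last first.
  by apply: measurableI => //; exact: measurable_euclid_dist_le.
rewrite b0; have [r0|r0] := leP 0 r.
  rewrite (_ : [set x | _] = setT) ?setIT//; apply/seteqP; split => // x _ /=.
  by rewrite /euclid_dist image_set0 inf0.
rewrite (_ : [set x | _] = set0) ?setI0//; apply/seteqP; split => // x /=.
by rewrite /euclid_dist image_set0 inf0 leNgt r0.
Qed.

(** Near a boundary point the strip contains a nonempty open part of Omega. If the
    boundary is empty, the distance to it is the infimum of the empty set, which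
    is 0 by convention, and the strip is all of Omega. *)
Lemma lebesgue_rV_strip_gt0 r : 0 < r -> Omega !=set0 ->
  (0 < mu (strip Omega r))%E.
Proof.
move=> r0 O0.
have [b0|/set0P[z bz]] := eqVneq (boundary Omega) set0.
  rewrite (_ : strip Omega r = Omega); first exact: lebesgue_rV_open_gt0.
  apply/seteqP; split => [x []//|x Ox]; split => //.
  by rewrite /euclid_dist b0 image_set0 inf0 ltW.
have oz : open [set x : 'rV[R]_n | enorm (x - z) < r] by exact: open_enorm_sub_lt.
have oU : open (Omega `&` [set x | enorm (x - z) < r]) by exact: openI.
have nz : nbhs z [set x : 'rV[R]_n | enorm (x - z) < r].
  by apply: open_nbhs_nbhs; split => //=; rewrite subrr enorm0.
have U0 : Omega `&` [set x | enorm (x - z) < r] !=set0.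
  by have [+ _] := bz; apply.
apply: (lt_le_trans (lebesgue_rV_open_gt0 oU U0)).
apply: le_measure; rewrite ?inE.
- exact: open_rV_measurable.
- exact: measurable_strip.
move=> x [Ox /= xz]; split => //; apply: le_trans (ltW xz).
apply: inf_lbound; last by exists z.
by exists 0 => _ [y _ <-]; exact: sqrtr_ge0.
Qed.

Lemma inner_regionU_strip r : inner_region Omega r `|` strip Omega r = Omega.
Proof. by rewrite /inner_region setUC setDUK// => x []. Qed.

End domain.

(** * The nonlocal problem as an evolution on the strip *)

Section Lp_on_strip.
Context {R : realType} {n : nat}.
Variables (D : set 'rV[R]_n) (p : R).
Hypotheses (mD : measurable D) (p1 : 1 <= p).
Local Notation mu := (@lebesgue_rV R n).

Lemma Lp_onP f : Lp_on D p f <-> Lp mu D p f.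
Proof.
split => [Lf|[mf If]].
  have mf : measurable_fun setT (f \_ D).
    by move: Lf; rewrite /Lp_on inE => /andP[]; rewrite inE.
  split; first by apply/(measurable_restrictT _ mD).
  have := integrableS measurableT mD (@subsetT _ _) (Lfun_integrable p1 Lf).
  by apply: (integrable_eq_in mD) => x Dx; rewrite patchE mem_set.
rewrite /Lp_on inE; apply/andP; split; rewrite inE /=.
  exact/(measurable_restrictT _ mD).
by rewrite /finite_norm (Lp_normE mD p1 (conj mf If)) ltry.
Qed.

Lemma eq_Lp_norm_on f g : (forall x, D x -> f x = g x) ->
  Lp_norm_on D p f = Lp_norm_on D p g.
Proof.
move=> fg; rewrite /Lp_norm_on; congr (Lnorm _ _ (EFin \o _)).
by apply/funext => x; rewrite !patchE; case: ifPn => // /[!inE]; exact: fg.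
Qed.

(** The two norms agree on L^p functions only, which is why membership must hold
    eventually along the filter. *)
Lemma Lp_norm_on_cvg0 (F : set_system R) (FF : Filter F) (f : R -> 'rV[R]_n -> R) :
  (\forall h \near F, Lp mu D p (f h)) ->
  (Lp_norm_on D p (f h) @[h --> F] --> 0%E) <->
  (Lp_norm mu D p (f h) @[h --> F] --> (0 : R)).
Proof.
move=> Lf.
have E : \forall h \near F, (Lp_norm mu D p (f h))%:E = Lp_norm_on D p (f h).
  by apply: filterS Lf => h Lh; rewrite /Lp_norm_on (Lp_normE mD p1 Lh).
split => [c|c].
  have c' : (Lp_norm mu D p (f h))%:E @[h --> F] --> (0 : R)%:E.
    by apply: cvg_trans c; apply: near_eq_cvg; apply: filterS E => h ->.
  by move/fine_cvgP : c' => [].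
have c' : (Lp_norm mu D p (f h))%:E @[h --> F] --> (0 : R)%:E.
  by apply: cvg_EFin => //; exact: nearW.
by apply: cvg_trans c'; apply: near_eq_cvg; apply: filterS E => h ->.
Qed.

End Lp_on_strip.

Section kernel.
Context {R : realType} {n : nat} {rho : R} {J : 'rV[R]_n -> R}.
Hypothesis hJ : nonlocal_kernel rho J.

Lemma kernel_sub_sym x y : J (x - y) = J (y - x).
Proof. by apply: (kernel_radial hJ); rewrite -opprB enormN. Qed.

Lemma kernel_le_center x : J x <= J 0.
Proof. by apply: (kernel_decreasing hJ); rewrite enorm0 sqrtr_ge0. Qed.

(** J is largest at 0, and it does not vanish identically because its support
    contains 0. *)
Lemma kernel_center_gt0 : 0 <= rho -> 0 < J 0.
Proof.
move=> rho0; rewrite lt_neqAle (kernel_ge0 hJ) andbT eq_sym; apply/eqP => J0.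
have := kernel_support hJ.
rewrite (_ : [set x | J x != 0] = set0) ?closure0; last first.
  apply/seteqP; split => // x /=; rewrite (_ : J x = 0) ?eqxx//.
  by apply/le_anti; rewrite (kernel_ge0 hJ) andbT -J0 kernel_le_center.
by move=> /seteqP[_ /(_ 0)]; apply; rewrite /= enorm0.
Qed.

Lemma kernel_near_center : 0 <= rho -> exists2 e : R, 0 < e &
  forall x : 'rV[R]_n, (forall k, `|x ord0 k| < e) -> J 0 / 2 <= J x.
Proof.
move=> rho0; have J0 := kernel_center_gt0 rho0.
have : nbhs (0 : 'rV[R]_n) [set x | J 0 / 2 < J x].
  have := @kernel_continuous _ _ _ _ hJ 0; move=> /cvgr_gt; apply.
  by rewrite ltr_pdivrMr// ltr_pMr// ltr1n.
move=> /nbhs_cube[e e0 eJ]; exists e => // x xe; apply: ltW; apply: eJ => k.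
by rewrite mxE sub0r normrN.
Qed.

Lemma measurable_kernel_sub :
  measurable_fun setT (fun z : 'rV[R]_n * 'rV[R]_n => J (z.1 - z.2)).
Proof.
apply: (measurableT_comp (continuous_rV_measurable (kernel_continuous hJ))).
apply/measurable_fun_rVP => i.
rewrite (_ : _ \o _ = fun z : 'rV[R]_n * 'rV[R]_n =>
  rV_coord i z.1 - rV_coord i z.2); last first.
  by apply/funext => z; rewrite /rV_coord /= !mxE.
apply: measurable_funB.
  by apply: (measurableT_comp (measurable_rV_coord i)); exact: measurable_fst.
by apply: (measurableT_comp (measurable_rV_coord i)); exact: measurable_snd.
Qed.

End kernel.

Section strip_operator.
Context {R : realType} {n : nat}.
Variables (Omega : set 'rV[R]_n) (rho : R) (J : 'rV[R]_n -> R) (r : R).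
Hypotheses (O0 : Omega !=set0) (oO : open Omega) (cO : connected Omega)
  (bO : bounded_set Omega) (hJ : nonlocal_kernel rho J) (r0 : 0 < r)
  (rrho : r <= rho).
Local Notation mu := (@lebesgue_rV R n).
Local Notation G := (strip Omega r).
Local Notation I := (inner_region Omega r).
Local Notation L1 A f := (mu.-integrable A (EFin \o f)).

(** The reduction: E solves the first equation uniquely, P = S (E _) turns the
    second into du/dt = ka * (P u - u) with ka = 1 / c, and P decays on functions
    of mean zero. The constants ka, B and la are chosen before p and f, as the
    rate C' must not depend on the initial datum. *)
Lemma strip_operator_exists :
  exists (P E : ('rV[R]_n -> R) -> 'rV[R]_n -> R) (ka b B la : R),
  [/\ [/\ averaging mu G P, 0 < ka, 0 <= b &
        forall g, L1 G g -> forall x, G x ->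
          `|P g x| <= `|g x| + b * \int[mu]_(y in G) `|g y|],
      [/\ 0 < B, 0 < la < 1 & forall p f k, 1 <= p -> L1 G f ->
        L1 G (fun x => `|f x| `^ p) -> \int[mu]_(x in G) f x = 0 ->
        \int[mu]_(x in G) (`|iter k P f x| `^ p) <=
          B * la ^+ k * \int[mu]_(x in G) (`|f x| `^ p)],
      forall p f, 1 <= p -> Lp mu G p f -> is_the_extension Omega J r p f (E f) &
      forall f, L1 G f -> L1 Omega (E f) /\ forall x, G x ->
        nonlocal J Omega (E f) x = ka * (P f x - f x)].
Proof.
have mO := open_rV_measurable oO.
have mG := measurable_strip oO r.
have finO : (mu Omega < +oo)%E by exact: lebesgue_rV_bounded_lty.
have GO : G `<=` Omega by move=> x [].
have G0 := lebesgue_rV_strip_gt0 oO r0 O0.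
have mI : measurable I by exact: measurableD.
have rho0 : 0 <= rho by rewrite (le_trans (ltW r0)).
have J0 := kernel_center_gt0 hJ rho0.
pose k x y := J (x - y).
have mk : measurable_fun setT (fun z : 'rV[R]_n * 'rV[R]_n => k z.1 z.2).
  exact: measurable_kernel_sub hJ.
have k0 x y : 0 <= k x y by exact: (kernel_ge0 hJ).
have kb x y : k x y <= J 0 by exact: (kernel_le_center hJ).
have ks x y : k x y = k y x by exact: (kernel_sub_sym hJ).
pose m := fine (mu Omega); have m0 : 0 <= m by exact: fine_ge0.
(* J 0 * m bounds the total jump rate, and + 1 keeps the denominator positive *)
pose c := (2 * (J 0 * m + 1))^-1.
have den0 : 0 < 2 * (J 0 * m + 1) by rewrite mulr_gt0// ltr_wpDl// mulr_ge0// ltW.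
have c0 : 0 < c by rewrite invr_gt0.
have cb : c * (J 0 * fine (mu Omega)) <= 2^-1.
  by rewrite mulrC ler_pdivrMr// mulKf// lerDl.
pose S := lazy_step mu Omega k c.
have avgS : averaging mu Omega S :=
  lazy_step_averaging mO finO mk k0 kb ks (ltW c0) cb.
have Sbd := lazy_step_bound mO finO mk k0 kb (ltW c0) cb.
have Shalf g : L1 Omega g -> (forall x, Omega x -> 0 <= g x) ->
    forall x, Omega x -> 2^-1 * g x <= S g x.
  move=> Ig g0 x Ox.
  apply: le_trans (lazy_step_ge_half mO finO mk k0 kb (ltW c0) cb Ig g0 Ox).
  by rewrite lerDl mulr_ge0 ?(ltW c0)// kernel_op_ge0.
have [e e0 Je] := kernel_near_center hJ rho0.
have [N [B [mB OB Be chain]]] := finite_cube_cover_chain oO cO bO e0.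
have J02 : 0 < J 0 / 2 by rewrite divr_gt0.
have kB i x y : B i x -> B i y -> J 0 / 2 <= k x y.
  by move=> Bx By; apply: Je => l; rewrite !mxE; exact: Be Bx By l.
have [l [de1 [l0 de1_gt0 Smin1]]] :=
  lazy_step_minorized mO finO mk k0 kb ks (ltW c0) cb c0 J02 mB OB kB chain.
(* the second bound keeps 1 - de * mu Omega positive *)
pose de := Num.min de1 (m + 1)^-1.
have m1 : 0 < m + 1 by rewrite ltr_wpDl.
have de0 : 0 < de by rewrite lt_min de1_gt0 invr_gt0.
have dem : de * fine (mu Omega) < 1.
  apply: (@le_lt_trans _ _ ((m + 1)^-1 * m)).
    by rewrite ler_wpM2r// ge_min lexx orbT.
  by rewrite mulrC ltr_pdivrMr// mul1r ltrDl.
have Smin g : L1 Omega g -> (forall x, Omega x -> 0 <= g x) ->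
    forall x, Omega x -> de * \int[mu]_(y in Omega) g y <= iter l S g x.
  move=> Ig g0 x Ox; apply: le_trans (Smin1 g Ig g0 x Ox).
  rewrite ler_wpM2r ?ge_min ?lexx//.
  by apply: Rintegral_ge0 => y Oy; exact: g0.
have be0 : 0 <= c * J 0 by rewrite mulr_ge0// ltW.
pose P := trace_step Omega G S; pose E := harmonic_extension Omega G S.
have avgP : averaging mu G P :=
  trace_step_averaging mO finO mG GO G0 avgS be0 Sbd l0 de0 dem Smin.
have [b b0 Pbd] := trace_step_bound mO finO mG GO G0 avgS be0 Sbd l0 de0 dem Smin.
have Pmin := trace_step_minorized mO finO mG GO G0 avgS be0 Sbd Shalf l0 de0 dem Smin.
have [C C0 Espec] := harmonic_extension_spec mO finO mG GO G0 avgS be0 Sbd l0 de0 dem Smin.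
have muGO : (mu G <= mu Omega)%E by apply: le_measure; rewrite ?inE.
have finG : (mu G < +oo)%E by exact: le_lt_trans finO.
have finI : (mu I < +oo)%E.
  by apply: le_lt_trans finO; apply: le_measure; rewrite ?inE// => x [].
have h0 : 0 < 2^-1 ^+ l * de by rewrite mulr_gt0// exprn_gt0// invr_gt0.
have h1 : 2^-1 ^+ l * de * fine (mu G) < 1.
  apply: le_lt_trans dem; apply: ler_pM => //.
  - exact: ltW.
  - exact: fine_ge0.
  - by rewrite ler_piMl ?(ltW de0)// exprn_ile1// ?invr_ge0// invf_le1// ler1n.
  - by rewrite fine_le// ge0_fin_numE.
have [K [la [K0 la01 decay]]] := averaging_iter_decay mG finG avgP l0 h0 h1 G0
  (fun g Ig g0 x Gx => Pmin g Ig g0 x Gx).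
have I1 a : L1 Omega (cst a) by exact: integrable_finite_cst.
have nonlocalE v x : L1 Omega v ->
    nonlocal J Omega v x = c^-1 * (S v x - v x).
  move=> Iv; rewrite /S /lazy_step addrAC subrr add0r mulKf ?gt_eqF//.
  rewrite /nonlocal -(RintegralZr _ mO); last first.
    exact: (kernel_slice_integrable mO mk k0 kb x (I1 1)).
  rewrite -(RintegralB mO); last 2 first.
  - exact: (kernel_slice_integrable mO mk k0 kb x Iv).
  - have := integrableZl mO (v x) (kernel_slice_integrable mO mk k0 kb x (I1 1)).
    by apply: (integrable_eq_in mO) => y _ /=; rewrite mulrC.
  by apply: eq_Rintegral => y _; rewrite /k /=; ring.
exists P, E, c^-1, b, K, la; split => //.
- by split => //; rewrite invr_gt0.
- move=> p f p1 Lf; have If := Lp_integrable mG finG p1 Lf.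
  have [IE EG EI SE] := Espec f If; rewrite -/(E f) in IE EG EI SE.
  have extE : is_extension Omega J r p f (E f).
    split => //.
    + apply/(Lp_onP mI p1 _).
      apply: (Lp_dominated mI p1 _ _
        (Lp_cst p mI finI (C * \int[mu]_(y in G) `|f y|))).
        apply: integrable_measurable_fun (integrableS mO mI _ IE) => //.
        by move=> x [].
      by move=> x Ix; apply: (le_trans (EI x Ix)); exact: ler_norm.
    + apply: aeW => x Ix; rewrite inner_regionU_strip nonlocalE// SE// subrr.
      by rewrite mulr0.
  split => // v' [v'G Lv' eqv'].
  have Iv' : L1 Omega v'.
    apply: (integrable_split mO mG GO).
      by apply: (integrable_eq_in mG _ If) => x Gx; rewrite v'G.
    exact: (Lp_integrable mI finI p1 ((Lp_onP mI p1 v').1 Lv')).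
  have := harmonic_ae_eq0 mO finO mG GO G0 avgS Sbd de0 Smin
    (integrable_sub mO Iv' IE).
  have H1 x : G x -> v' x - E f x = 0 by move=> Gx; rewrite v'G// EG// subrr.
  have H2 : {ae mu, forall x, (Omega `\` G) x ->
      S (fun y => v' y - E f y) x = v' x - E f x}.
    apply: filterS eqv' => x v'x Ix; have Ox : Omega x by case: Ix.
    rewrite (averagingB mO avgS)// SE//; congr (_ - _).
    have := v'x Ix; rewrite inner_regionU_strip nonlocalE// => /esym/eqP.
    by rewrite mulf_eq0 invr_eq0 gt_eqF//= subr_eq0 => /eqP.
  move=> /(_ H1 H2); apply: filterS => x wx [Ox _].
  by apply/eqP; rewrite -subr_eq0 wx.
- move=> f If; have [IE EG _ _] := Espec f If; rewrite -/(E f) in IE EG.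
  by split => // x Gx; rewrite nonlocalE// EG.
Qed.

End strip_operator.

Theorem theorem1p2 (R : realType) (n : nat) (Omega : set 'rV[R]_n)
    (rho : R) (J : 'rV[R]_n -> R) (r p : R) :
  (0 < n)%N ->
  bounded_smooth_domain Omega ->
  nonlocal_kernel rho J ->
  0 < r <= rho ->
  1 <= p ->
  let mu := @lebesgue_rV R n in
  let Gamma := strip Omega r in
  exists2 C' : R, 0 < C' &
  forall u0 : 'rV[R]_n -> R, Lp_on Gamma p u0 ->
  exists u : R -> 'rV[R]_n -> R,
    [/\ is_solution Omega J r p u0 u,
        forall u', is_solution Omega J r p u0 u' ->
          forall t, 0 <= t -> ae_eq mu Gamma (u' t) (u t),
        forall t, 0 < t ->
          \int[mu]_(x in Gamma) u t x = \int[mu]_(x in Gamma) u0 x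
      & exists2 C : R, 0 < C &
        forall t, 0 < t ->
          (\int[mu]_(x in Gamma) (`|u t x - mean_on Gamma u0| `^ p)%:E
             <= (C * expR (- (C' * t)))%:E)%E].
Proof.
move=> n0 [ O0 oO cO bO _] hJ /andP[r0 rrho] p1 mu Gamma.
have [P [E [ka [b [B [la [[avgP ka0 b0 Pbd] [B0 /andP[la0 la1] decay] extE genE]]]]]]] :=
  strip_operator_exists O0 oO cO bO hJ r0 rrho.
have mG : measurable Gamma by exact: measurable_strip.
have mO : measurable Omega by exact: open_rV_measurable.
have finO : (mu Omega < +oo)%E by exact: lebesgue_rV_bounded_lty.
have sub_lty A : measurable A -> A `<=` Omega -> (mu A < +oo)%E.
  by move=> mA AO; apply: (le_lt_trans _ finO); apply: le_measure; rewrite ?inE.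
have finG : (mu Gamma < +oo)%E by apply: sub_lty => // x [].
have muG0 : 0 < fine (mu Gamma) by rewrite fine_gt0// lebesgue_rV_strip_gt0.
exists ((1 - la) * ka); first by rewrite mulr_gt0// subr_gt0.
move=> u0 /(Lp_onP mG p1 _) Lu0; have Iu0 := Lp_integrable mG finG p1 Lu0.
pose u := semigroup P ka u0; exists u.
have F0 : Filter (0 : R)^' by exact: filter_filter.
have evu := semigroup_evolution mG finG p1 avgP b0 Pbd ka0 Lu0.
have u00 x : Gamma x -> u 0 x = u0 x.
  by move=> Gx; exact: (semigroup0 mG finG ka avgP b0 Pbd Iu0 Gx).
have derivative_term (w : R -> 'rV[R]_n -> R) (t : R) : 0 < t ->
    (forall s, 0 <= s -> Lp mu Gamma p (w s)) ->
    \forall h \near 0^', Lp mu Gamma p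
      (fun x => h^-1 * (w (t + h) x - w t x) - ka * (P (w t) x - w t x)).
  move=> t0 Lw; near=> h.
  have th0 : 0 <= t + h.
    have : `|h| < t by near: h; exists t => //= z; rewrite /= sub0r normrN.
    by rewrite ltr_norml => /andP[+ _]; lra.
  have [LP _] := Lp_averaging mG finG p1 avgP (Lw t (ltW t0)).
  exact: (LpB mG p1 (LpZ mG h^-1 (LpB mG p1 (Lw _ th0) (Lw t (ltW t0))))
    (LpZ mG ka (LpB mG p1 LP (Lw t (ltW t0))))).
have increment_term (w : R -> 'rV[R]_n -> R) (t : R) : 0 <= t ->
    (forall s, 0 <= s -> Lp mu Gamma p (w s)) ->
    \forall s \near within [set s | 0 <= s] (nbhs t),
      Lp mu Gamma p (fun x => w s x - w t x).
  move=> t0 Lw; near_simpl; have := withinT [set s : R | 0 <= s] (nbhs_filter t).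
  apply: filterS => s s0; exact: (LpB mG p1 (Lw s s0) (Lw t t0)).
split.
- have [Lu cu du] := evu; split; first split.
  + by move=> t t0; exact: ((Lp_onP mG p1 (u t)).2 (Lu t t0)).
  + move=> t t0.
    exact: ((Lp_norm_on_cvg0 mG p1 _ (increment_term u t t0 Lu)).2 (cu t t0)).
  + move=> t t0; have Lt := Lu t (ltW t0).
    exists (E (u t)); first exact: extE.
    have [_ gen] := genE _ (Lp_integrable mG finG p1 Lt).
    rewrite /Lp_derivative inner_regionU_strip.
    have dt := (Lp_norm_on_cvg0 mG p1 F0 (derivative_term u t t0 Lu)).2 (du t t0).
    apply: cvg_trans dt; apply: near_eq_cvg; apply: nearW => h.
    by apply: eq_Lp_norm_on => x Gx; rewrite gen.
  + by apply: aeW => x Gx; exact: u00.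
- move=> u' [[Lu' cu'] du' u'0].
  have Lu t : 0 <= t -> Lp mu Gamma p (u' t).
    by move=> t0; exact: ((Lp_onP mG p1 _).1 (Lu' t t0)).
  have evu' : evolution mu Gamma p P ka u'.
    split => // t t0.
      exact: ((Lp_norm_on_cvg0 mG p1 _ (increment_term u' t t0 Lu)).1 (cu' t t0)).
    have [v extv dv] := du' t t0.
    apply: (Lp_norm_on_cvg0 mG p1 F0 (derivative_term u' t t0 Lu)).1.
    apply: cvg_trans dv; apply: near_eq_cvg; apply: nearW => h.
    apply: eq_Lp_norm_on => x Gx; congr (_ - _).
    have Lt := Lu t (ltW t0); have It := Lp_integrable mG finG p1 Lt.
    have [IE gen] := genE _ It; rewrite -gen// inner_regionU_strip.
    have [[_ Lv _] vuniq] := extv; have [extEu _] := extE p (u' t) p1 Lt.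
    have Ev := vuniq _ extEu.
    have [vG _ _] := extv.1; have [EG _ _] := extEu.
    (* the extension in the definition of a solution is E (u' t), up to a null set *)
    have vE : {ae mu, forall y, Omega y -> v y = E (u' t) y}.
      apply: filterS Ev => y Ey Oy.
      have [Gy|nGy] := pselect (Gamma y); first by rewrite vG// EG.
      by rewrite Ey.
    have mE : measurable_fun Omega (E (u' t)) := integrable_measurable_fun IE.
    have mv : measurable_fun Omega v.
      apply: integrable_measurable_fun (_ : mu.-integrable Omega (EFin \o v)).
      apply: (integrable_split mO mG) => [y []//||].
        by apply: (integrable_eq_in mG _ It) => y Gy; rewrite vG.
      have mI : measurable (inner_region Omega r) by exact: measurableD.
      have finI : (mu (inner_region Omega r) < +oo)%E.
        by apply: sub_lty => // y [].
      exact: (Lp_integrable mI finI p1 ((Lp_onP mI p1 v).1 Lv)).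
    have mJ : measurable_fun Omega (fun y => J (x - y)).
      pose k (a b : 'rV[R]_n) := J (a - b).
      have mk : measurable_fun setT (fun z : 'rV[R]_n * 'rV[R]_n => k z.1 z.2).
        exact: measurable_kernel_sub hJ.
      exact: (measurable_kernel_slice mk).
    rewrite /nonlocal; apply: eq_Rintegral_ae => //.
    + by apply: measurable_funM => //; apply: measurable_funB.
    + by apply: measurable_funM => //; apply: measurable_funB.
    + by apply: filterS vE => y vy Oy; rewrite vy// (vG x)// (EG x).
  move=> t t0; apply: (evolution_unique mG finG p1 avgP ka0 evu' evu) => //.
  by apply: filterS u'0 => x ux Gx; rewrite ux// -u00.
- move=> t t0; rewrite (semigroup_mass mG finG avgP b0 Pbd ka0 t Iu0)//.
set c := mean_on Gamma u0; pose v x := u0 x - c.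
have Lv : Lp mu Gamma p v by exact: (LpB mG p1 Lu0 (Lp_cst p mG finG c)).
have Iv := Lp_integrable mG finG p1 Lv; have [_ Ivp] := Lv.
have v0 : \int[mu]_(x in Gamma) v x = 0.
  rewrite RintegralB// ?Rintegral_cst//; last exact: integrable_finite_cst.
  by rewrite /c /mean_on mulrAC mulVf ?mul1r ?subrr// gt_eqF.
pose Nv := \int[mu]_(x in Gamma) (`|v x| `^ p).
have Nv0 : 0 <= Nv by apply: Rintegral_ge0 => x _; exact: powR_ge0.
exists (B * Nv + 1); first by rewrite ltr_wpDl// mulr_ge0// ltW.
move=> t t0.
have := semigroup_decay mG finG avgP b0 Pbd ka0 (ltW B0) (ltW la0) p1 (ltW t0) Iv Ivp
  (fun k => decay p v k p1 Iv Ivp v0).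
have -> : (\int[mu]_(x in Gamma) (`|semigroup P ka v t x| `^ p)%:E =
    \int[mu]_(x in Gamma) (`|u t x - c| `^ p)%:E)%E.
  apply: eq_integral => x /[!inE] Gx.
  by rewrite (semigroup_sub_cst mG finG ka avgP b0 Pbd c t Iu0 Gx).
move=> /le_trans; apply; rewrite lee_fin mulrA -/Nv mulrAC.
by rewrite ler_wpM2r ?expR_ge0// lerDl.
Unshelve. all: by end_near. Qed.
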